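(* The following decision problem is in $\mathsf{NP}$: on input an inverse-closed finite convergent length-reducing rewriting system $(\Sigma,T)$, is the group presented by $(\Sigma,T)$ not plain?
   Context: A group is plain if it is isomorphic to a free product of finitely many finite groups and finitely many copies of $\mathbb{Z}$. A length-reducing rewriting system is a pair $(\Sigma,T)$ with $\Sigma$ a non-empty finite alphabet and $T\subseteq \Sigma^*\times\Sigma^*$ such that $|\ell|_\Sigma>|r|_\Sigma$ for all $(\ell,r)\in T$, where $|\cdot|_\Sigma$ is word length and $\lambda$ is the empty word. Write $u\ell v\to urv$ for $u,v\in\Sigma^*$, $(\ell,r)\in T$; $\overset{*}{\to}$ is the reflexive transitive closure and $\overset{*}{\leftrightarrow}$ the reflexive, transitive and symmetric closure. The system is finite if $T$ is finite, convergent if it is terminating (automatic here) and confluent (whenever $w\overset{*}{\to}x$ and $w\overset{*}{\to}y$ there is $z$ with $x\overset{*}{\to}z$ and $y\overset{*}{\to}z$), and inverse-closed if for every $a\in\Sigma$ there is $b\in\Sigma$ with $ab\overset{*}{\to}\lambda$. The group presented by $(\Sigma,T)$ is $M(\Sigma,T)=\Sigma^*/\overset{*}{\leftrightarrow}$, which is a group when the system is inverse-closed. Complexity is measured in the input size $n_T=|\Sigma|+\sum_{(\ell,r)\in T}|\ell r|_\Sigma$. *)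

(* Defs.v *)
From HB Require Import structures.
From Stdlib Require Import Relations.
From mathcomp Require Import all_boot all_order all_algebra all_fingroup.
From mathcomp Require Import boolp zify.
Set Implicit Arguments.
Unset Strict Implicit.
Unset Printing Implicit Defensive.

Local Open Scope quotient_scope.
Local Notation repr := generic_quotient.repr.

(** * Rewriting over an arbitrary alphabet

    [T l r] reads "(l, r) is a rule".  The alphabet and the set of rules may be
    infinite, so that free products are also covered. *)

Section Rewriting.
Variables (A : Type) (T : relation (seq A)).

Definition rw_step : relation (seq A) := fun x y =>
  exists u v l r : seq A, [/\ T l r, x = u ++ l ++ v & y = u ++ r ++ v].

Definition rw_star : relation (seq A) := clos_refl_trans (seq A) rw_step.

Definition rw_equiv : relation (seq A) := clos_refl_sym_trans (seq A) rw_step.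

Definition terminating : Prop := well_founded (fun y x => rw_step x y).

Definition confluent : Prop := forall w x y,
  rw_star w x -> rw_star w y -> exists2 z, rw_star x z & rw_star y z.

Definition convergent : Prop := terminating /\ confluent.

Definition inverse_closed : Prop :=
  forall a : A, exists b : A, rw_star [:: a; b] [::].

Lemma rw_star_equiv x y : rw_star x y -> rw_equiv x y.
Proof.
elim=> [{}x {}y|{}x|{}x {}y z _ xy _ yz]; [exact: rst_step|exact: rst_refl|].
exact: rst_trans xy yz.
Qed.

Lemma rw_step_cat u v x y : rw_step x y -> rw_step (u ++ x ++ v) (u ++ y ++ v).
Proof.
move=> [u' [v' [l [r [Tlr -> ->]]]]].
by exists (u ++ u'), (v' ++ v), l, r; rewrite !catA.
Qed.

Lemma rw_equiv_ctx u v x y :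
  rw_equiv x y -> rw_equiv (u ++ x ++ v) (u ++ y ++ v).
Proof.
elim=> [{}x {}y /(rw_step_cat u v)|{}x|{}x {}y _|{}x {}y z _ xy _ yz].
- exact: rst_step.
- exact: rst_refl.
- exact: rst_sym.
- exact: rst_trans xy yz.
Qed.

Lemma rw_equiv_cat x x' y y' :
  rw_equiv x x' -> rw_equiv y y' -> rw_equiv (x ++ y) (x' ++ y').
Proof.
move=> /(rw_equiv_ctx [::] y) xx' /(rw_equiv_ctx x' [::]).
by rewrite !cats0; apply: rst_trans.
Qed.

Definition letter_inv (h : inverse_closed) (a : A) : A := projT1 (cid (h a)).

Lemma letter_invP h a : rw_equiv [:: a; letter_inv h a] [::].
Proof. exact/rw_star_equiv/(projT2 (cid (h a))). Qed.

Lemma letter_invV h a : rw_equiv [:: letter_inv h a; a] [::].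
Proof.
set b := letter_inv h a; set c := letter_inv h b.
have ab : rw_equiv [:: a; b] [::] := letter_invP h a.
have bc : rw_equiv [:: b; c] [::] := letter_invP h b.
have ac : rw_equiv [:: a] [:: c].
  apply: (rst_trans _ _ _ [:: a; b; c]); last exact: (rw_equiv_ctx [::] [:: c] ab).
  exact/rst_sym/(rw_equiv_ctx [:: a] [::] bc).
exact: rst_trans (rw_equiv_ctx [:: b] [::] ac) bc.
Qed.

Definition word_inv (h : inverse_closed) (w : seq A) : seq A :=
  rev (map (letter_inv h) w).

Lemma word_invP h w : rw_equiv (w ++ word_inv h w) [::].
Proof.
elim: w => [|a w IHw]; first exact: rst_refl.
rewrite /word_inv /= rev_cons -cats1 catA.
apply: rst_trans (letter_invP h a).
exact: (rw_equiv_ctx [:: a] [:: letter_inv h a] IHw).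
Qed.

Lemma word_invV h w : rw_equiv (word_inv h w ++ w) [::].
Proof.
elim: w => [|a w IHw]; first exact: rst_refl.
rewrite /word_inv /= rev_cons -cats1 -catA -cat1s.
apply: rst_trans IHw.
exact: (rw_equiv_ctx (word_inv h w) w (letter_invV h a)).
Qed.

End Rewriting.

(** * The group presented by an inverse-closed rewriting system *)

Section Presented.
Variables (A : choiceType) (T : relation (seq A)).

Definition rw_equivb : rel (seq A) := fun x y => `[< rw_equiv T x y >].

Lemma rw_equivb_refl : reflexive rw_equivb.
Proof. by move=> x; apply/asboolP/rst_refl. Qed.

Lemma rw_equivb_sym : symmetric rw_equivb.
Proof. by move=> x y; apply/asboolP/asboolP; apply: rst_sym. Qed.

Lemma rw_equivb_trans : transitive rw_equivb.
Proof. by move=> y x z /asboolP xy /asboolP yz; apply/asboolP/(rst_trans _ _ _ y). Qed.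

Canonical rw_equiv_rel :=
  EquivRel rw_equivb rw_equivb_refl rw_equivb_sym rw_equivb_trans.

Variable h : inverse_closed T.

(* [h] does not occur in the carrier; it is a parameter so that the group     *)
(* structure below can be found by inference.                                 *)
Definition presented of inverse_closed T : Type := {eq_quot rw_equiv_rel}.
Local Notation M := (presented h).

HB.instance Definition _ := Choice.on M.
HB.instance Definition _ := EqQuotient.on M.

Definition word_class (w : seq A) : M := \pi_M w.

Definition presented_one : M := word_class [::].
Definition presented_mul (x y : M) : M := word_class (repr x ++ repr y).
Definition presented_inv (x : M) : M := word_class (word_inv h (repr x)).

Lemma word_classP (v w : seq A) : word_class v = word_class w <-> rw_equiv T v w.
Proof. by split=> [/eqmodP/asboolP|vw]; last apply/eqmodP/asboolP. Qed.

Lemma word_classK (x : M) : word_class (repr x) = x.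
Proof. exact: reprK. Qed.

Lemma presented_mulE (v w : seq A) :
  presented_mul (word_class v) (word_class w) = word_class (v ++ w).
Proof. by apply/word_classP/rw_equiv_cat; apply/word_classP/word_classK. Qed.

Lemma presented_mulA : associative presented_mul.
Proof.
move=> x y z; rewrite -(word_classK x) -(word_classK y) -(word_classK z).
by rewrite !presented_mulE catA.
Qed.

Lemma presented_mul1 : left_id presented_one presented_mul.
Proof. by move=> x; rewrite -(word_classK x) presented_mulE. Qed.

Lemma presented_mulr1 : right_id presented_one presented_mul.
Proof. by move=> x; rewrite -(word_classK x) presented_mulE cats0. Qed.

Lemma presented_mulV : left_inverse presented_one presented_inv presented_mul.
Proof.
move=> x; rewrite -[in X in presented_mul _ X](word_classK x) presented_mulE.
exact/word_classP/word_invV.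
Qed.

Lemma presented_mulVr : right_inverse presented_one presented_inv presented_mul.
Proof.
move=> x; rewrite -[in X in presented_mul X _](word_classK x) presented_mulE.
exact/word_classP/word_invP.
Qed.

HB.instance Definition _ := isGroup.Build M
  presented_mulA presented_mul1 presented_mulr1 presented_mulV presented_mulVr.

End Presented.

(** * Free products and plain groups *)

Definition isomorphic (G H : groupType) : Prop :=
  exists2 f : G -> H, monoid_morphism f & bijective f.

Section FreeProduct.
Variables (I : choiceType) (G : I -> groupType).
Local Open Scope group_scope.

(* Words over the disjoint union of the factors, modulo multiplication inside *)
(* a factor and deletion of the identities.                                   *)
Inductive free_product_rule : relation (seq {i : I & G i}) :=
| FP_mul i (x y : G i) : free_product_rule
    [:: Tagged (fun i => G i : Type) x; Tagged (fun i => G i : Type) y]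
    [:: Tagged (fun i => G i : Type) (x * y)]
| FP_one i : free_product_rule
    [:: Tagged (fun i => G i : Type) (1 : G i)] [::].

Lemma free_product_inverse_closed : inverse_closed free_product_rule.
Proof.
move=> [i x]; exists (Tagged (fun i => G i : Type) x^-1).
apply: (rt_trans _ _ _ [:: Tagged (fun i => G i : Type) (1 : G i)]).
  apply: rt_step; exists [::], [::]; do 2!eexists; split; last first.
  - by rewrite cats0.
  - by rewrite cats0.
  by rewrite -(mulgV x); apply: FP_mul.
apply: rt_step; exists [::], [::]; do 2!eexists; split; last first.
- by rewrite cats0.
- by rewrite cats0.
exact: FP_one.
Qed.

Definition free_product : groupType := presented free_product_inverse_closed.

End FreeProduct.

Definition plain_factor n k (F : 'I_n -> finGroupType) (x : 'I_n + 'I_k) :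
    groupType :=
  match x with inl i => F i | inr _ => nmodule.Algebra.to_multiplicative int end.

Definition plain (G : groupType) : Prop :=
  exists n k (F : 'I_n -> finGroupType),
    isomorphic G (free_product (@plain_factor n k F)).

(** * Finite length-reducing rewriting systems *)

(* The letters are named 0, ..., n - 1; [lr_rules] lists each rule once.       *)
Record lr_system := LrSystem {
  lr_alph : nat;
  lr_rules : seq (seq 'I_lr_alph * seq 'I_lr_alph);
  lr_alph_gt0 : 0 < lr_alph;
  lr_rules_uniq : uniq lr_rules;
  lr_reducing : all (fun lr => size lr.2 < size lr.1) lr_rules }.

Definition lr_rule (S : lr_system) : relation (seq 'I_(lr_alph S)) :=
  fun l r => (l, r) \in lr_rules S.

Definition input_size (S : lr_system) : nat :=
  lr_alph S + \sum_(lr <- lr_rules S) size (lr.1 ++ lr.2).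

Record icl_system := IclSystem {
  icl_lr :> lr_system;
  icl_inverse_closed : inverse_closed (@lr_rule icl_lr);
  icl_convergent : convergent (@lr_rule icl_lr) }.

Arguments icl_inverse_closed : clear implicits.

Definition presented_group (S : icl_system) : groupType :=
  presented (icl_inverse_closed S).

(** * Encoding of systems as bit strings

    Letter i is 1^(i+1) 0, a word is the sequence of its letters closed by a
    further 0, and a system is 1^n 0 followed by l and r for each rule (l, r). *)

Definition encode_letter (i : nat) : seq bool := rcons (nseq i.+1 true) false.

Definition encode_word (w : seq nat) : seq bool :=
  rcons (flatten (map encode_letter w)) false.

Definition encode_rules (T : seq (seq nat * seq nat)) : seq bool :=
  flatten [seq encode_word lr.1 ++ encode_word lr.2 | lr <- T].

Definition encode (S : lr_system) : seq bool :=
  rcons (nseq (lr_alph S) true) false ++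
  encode_rules [seq (map val lr.1, map val lr.2) | lr <- lr_rules S].

Lemma encode_unary_inj m n s t :
  rcons (nseq m true) false ++ s = rcons (nseq n true) false ++ t ->
  m = n /\ s = t.
Proof.
elim: m n => [|m IHm] [|n] //= => [[->]|[/IHm[-> ->]]]; by split.
Qed.

Lemma encode_word_cons i w :
  encode_word (i :: w) = encode_letter i ++ encode_word w.
Proof. by rewrite /encode_word /= rcons_cat. Qed.

Lemma encode_word_inj v w s t :
  encode_word v ++ s = encode_word w ++ t -> v = w /\ s = t.
Proof.
elim: v w => [|i v IHv] [|j w]; rewrite ?encode_word_cons -?catA //.
  by case=> ->.
by move=> /encode_unary_inj[[->] /IHv[-> ->]].
Qed.

Lemma encode_rules_inj : injective encode_rules.
Proof.
elim=> [|[l r] T IHT] [|[l' r'] T'] //; rewrite /encode_rules /=.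
- by case: l' => [|i l'].
- by case: l => [|i l].
by rewrite -!catA => /encode_word_inj[-> /encode_word_inj[-> /IHT ->]].
Qed.

Lemma encode_inj : injective encode.
Proof.
move=> [n T n0 uT rT] [n' T' n0' uT' rT'] /encode_unary_inj /= [nn'].
case: n' / nn' in T' n0' uT' rT' *.
move=> /encode_rules_inj/inj_map eTT'.
have TT' : T = T'.
  apply: eTT' => -[l r] [l' r'] [].
  by move=> /(inj_map val_inj)-> /(inj_map val_inj)->.
move: uT' rT'; rewrite -TT' => uT' rT'.
by congr LrSystem; apply: bool_irrelevance.
Qed.

(* Lengths of encodings and input sizes are polynomially related.             *)
Lemma input_size_le_encode S : input_size S <= size (encode S).
Proof.
rewrite /input_size /encode size_cat size_rcons size_nseq.
apply: leq_add => //; rewrite /encode_rules.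
have le_word w : size w <= size (encode_word w).
  elim: w => [|i w IHw] //; rewrite encode_word_cons size_cat size_rcons /=.
  by rewrite addSn ltnS (leq_trans IHw) ?leq_addl.
elim: (lr_rules S) => [|[l r] T IHT]; first by rewrite big_nil.
rewrite big_cons /= !size_cat leq_add // leq_add //.
  by rewrite -(size_map val l).
by rewrite -(size_map val r).
Qed.

Lemma size_encode_le S : size (encode S) <= (input_size S + 2) ^ 2.
Proof.
have le_word (w : seq 'I_(lr_alph S)) :
    size (encode_word (map val w)) <= (lr_alph S).+1 * size w + 1.
  elim: w => [|i w IHw]; first by rewrite muln0.
  rewrite map_cons encode_word_cons size_cat [size (i :: w)]/=.
  rewrite /encode_letter size_rcons size_nseq mulnS -addnA.
  by rewrite leq_add // !ltnS; have := ltn_ord i.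
have le_rules : size (encode S) <=
    (lr_alph S).+1 + \sum_(lr <- lr_rules S)
      ((lr_alph S).+1 * size (lr.1 ++ lr.2) + 2).
  rewrite /encode /encode_rules size_cat size_rcons size_nseq leq_add2l.
  elim: (lr_rules S) => [|[l r] T IHT] //=.
  rewrite big_cons /= !size_cat; apply: leq_add => //.
  rewrite mulnDr [_ + 2](_ : _ = ((lr_alph S).+1 * size l + 1) +
                           ((lr_alph S).+1 * size r + 1)).
    by rewrite leq_add.
  by rewrite addnACA.
apply: (leq_trans le_rules).
have : all (fun lr => 0 < size (lr.1 ++ lr.2)) (lr_rules S).
  apply: sub_all (lr_reducing S) => -[l r] /= lt_rl.
  by rewrite size_cat addn_gt0 (leq_ltn_trans _ lt_rl).
rewrite /input_size; set n := lr_alph S; move=> all_gt0.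
set m := \sum_(lr <- _) size _.
have : \sum_(lr <- lr_rules S) (n.+1 * size (lr.1 ++ lr.2) + 2) <= (n + 3) * m.
  rewrite big_distrr /= big_seq [leqRHS]big_seq.
  apply: leq_sum => lr /(allP all_gt0) gt0.
  by rewrite -[3]/(1 + 2) addnA addn1 mulnDl leq_add2l leq_pmulr.
move=> le_m; apply: (leq_trans (leq_add (leqnn _) le_m)).
by rewrite -mulnn; nia.
Qed.

(** * Nondeterministic polynomial time

    A deterministic multitape Turing machine with two-way infinite tapes.  A
    cell holds [None] (blank), a bit, or one of finitely many further symbols;
    a tape is given by its current cell and by the cells to the left and to the
    right of it, nearest first, all cells beyond these lists being blank. *)

Inductive move := Left | Stay | Right.

Section Tape.
Variable X : Type.

Record tape := Tape {
  t_left : seq (option X); t_cur : option X; t_right : seq (option X) }.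

Definition tape_of (w : seq X) : tape :=
  Tape [::] (ohead w) (map Some (behead w)).

Definition tape_move (t : tape) (d : move) : tape :=
  let: Tape l c r := t in
  match d with
  | Left => Tape (behead l) (head None l) (c :: r)
  | Stay => t
  | Right => Tape (c :: l) (head None r) (behead r)
  end.

Definition tape_act (t : tape) (a : option X * move) : tape :=
  tape_move (Tape (t_left t) a.1 (t_right t)) a.2.

End Tape.

(* [tm_work] is the number of tapes besides the input and certificate tapes.  *)
(* A machine halts in the states of non-[None] verdict, accepting if the      *)
(* verdict is [Some true].                                                    *)
Record turing_machine := TuringMachine {
  tm_state : finType;
  tm_aux : finType;
  tm_work : nat;
  tm_start : tm_state;
  tm_verdict : tm_state -> option bool;
  tm_trans : tm_state -> tm_work.+2.-tuple (option (bool + tm_aux)) ->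
             tm_state * tm_work.+2.-tuple (option (bool + tm_aux) * move) }.

Section Run.
Variable M : turing_machine.
Local Notation symbol := (bool + tm_aux M)%type.

Definition tm_config : Type := tm_state M * (tm_work M).+2.-tuple (tape symbol).

Definition tm_step (c : tm_config) : tm_config :=
  if tm_verdict c.1 is Some _ then c else
  let: (q, acts) := tm_trans c.1 (map_tuple (@t_cur _) c.2) in
  (q, [tuple tape_act (tnth c.2 i) (tnth acts i) | i < (tm_work M).+2]).

Definition tm_init (x u : seq bool) : tm_config :=
  (tm_start M, [tuple of tape_of (map inl x) :: tape_of (map inl u) ::
                         nseq (tm_work M) (tape_of [::])]).

Definition tm_outcome (x u : seq bool) (t : nat) : option bool :=
  tm_verdict (iter t tm_step (tm_init x u)).1.

End Run.

(* The single polynomial [p] bounds both the length of the certificates and    *)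
(* the running time of the verifier [M].  Since halted configurations are      *)
(* fixed by [tm_step], the outcome after [n] steps is the final one.           *)
Definition in_NP (L : seq bool -> Prop) : Prop :=
  exists (M : turing_machine) (p : {poly nat}),
  forall x : seq bool, let n := (p.[size x])%R in
    (forall u, size u <= n -> tm_outcome M x u n <> None) /\
    (L x <-> exists2 u, size u <= n & tm_outcome M x u n = Some true).

(* The language of a decision problem: the encodings of its yes-instances.    *)
Definition language (I : Type) (enc : I -> seq bool) (yes : I -> Prop) :
    seq bool -> Prop :=
  fun x => exists2 S : I, x = enc S & yes S.

(* Main.v *)
(* A certificate of non-plainness is a triple (a, b, c) of words such that a,
   b, c, ab and bc have finite order, b <> 1, and ac has infinite order.

   Soundness: in a free product of finite groups and infinite cyclic groups, two
   nontrivial torsion elements have a torsion product iff they lie in the same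
   conjugate of a finite factor, and this is a transitive relation.

   Completeness: geodesics in the Cayley graph are the irreducible words and any
   two of them branch as in a tree, up to a bounded error.  Hence the vertex sets
   of cones have bounded edge boundary, and minimal cuts that cross as few other
   minimal cuts as possible form a nested family invariant under the group, which
   separates the ends of every element of infinite order.  Elements fixing a
   vertex of the dual tree are torsion.  If there is no triple as above, then the
   cuts with trivial stabilizer still separate the ends of every element of
   infinite order, so the group acts on the tree dual to these cuts with trivial
   edge stabilizers and finite vertex stabilizers, and is therefore plain.

   Polynomial size and time: a torsion element is conjugate to one of bounded
   length by an initial segment of its own normal form, which allows a triple to
   be conjugated and shortened to linear length; and g is torsion iff the normal
   form of g^N is short for a single N linear in |g|.  Confluence is decided by
   the critical pairs.  The verifier is a term of a small language of programs on
   binary trees whose only loop is bounded iteration; such terms are compiled to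
   multitape machines that use their tapes as stacks. *)

From HB Require Import structures.
From Stdlib Require Import Relations.
From mathcomp Require Import all_boot all_order all_algebra all_fingroup finmap.
From mathcomp Require Import boolp classical_sets cardinality zify.
Require Import Defs.
Set Implicit Arguments.
Unset Strict Implicit.
Unset Printing Implicit Defensive.

(** Why cuts with trivial stabilizer suffice. Let [g] have infinite order and map a cut [C] into
    itself, and suppose that every cut between [g C] and [C] has a nontrivial stabilizer.
    Consecutive cuts share a vertex of the dual tree, so elements stabilizing them have torsion
    product. Without certificates this relation passes along the chain and links an [m <> 1]
    stabilizing [C] to all its conjugates [m_k = g^k m g^-k]. For fixed [m], however, the torsion
    elements whose product with [m] is torsion lie in a ball. So the [m_k] are uniformly short, and
    [m_k g^k = g^k m] bounds the powers of [g], a contradiction. The same ball makes vertex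
    stabilizers finite.

    The passage from the tree to a free product needs no presentation of the group: an element of
    the free product is read off a path in the tree, backtracking does not change it, and the
    universal property shows that this inverts the natural map to the group. An edge may be reversed
    by a group element; it then contributes a factor of order two. *)

Lemma cat_split (X : Type) (s1 s2 t1 t2 : seq X) :
  s1 ++ s2 = t1 ++ t2 -> size s1 <= size t1 ->
  exists d, t1 = s1 ++ d /\ s2 = d ++ t2.
Proof.
elim: s1 t1 => [|a s1 IH] [|b t1] //=; first by move=> -> _; exists [::].
  by move=> -> _; exists (b :: t1).
by case=> <- /IH {}IH /IH [d [-> ->]]; exists d.
Qed.

(** * Rewriting *)

Section Convergence.
Variables (A : Type) (T : relation (seq A)).
Local Notation step := (rw_step T).
Local Notation star := (rw_star T).
Local Notation equiv := (rw_equiv T).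

Definition irreducible (w : seq A) := forall y, ~ step w y.
Definition joinable x y := exists2 z, star x z & star y z.
Definition length_reducing := forall l r, T l r -> size r < size l.

Lemma star_refl x : star x x. Proof. exact: rt_refl. Qed.

Lemma star_trans y x z : star x y -> star y z -> star x z.
Proof. exact: rt_trans. Qed.

Lemma star_ctx u v x y : star x y -> star (u ++ x ++ v) (u ++ y ++ v).
Proof.
elim=> [{}x {}y /(rw_step_cat u v) h|{}x|{}x {}y z _ h1 _ h2].
- exact: rt_step.
- exact: rt_refl.
- exact: rt_trans h1 h2.
Qed.

Lemma star_rule u v l r : T l r -> star (u ++ l ++ v) (u ++ r ++ v).
Proof. by move=> h; apply: rt_step; exists u, v, l, r. Qed.

Lemma star_inv x y : star x y -> x = y \/ exists2 z, step x z & star z y.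
Proof.
move=> /(clos_rt_rt1n _ _ _ _); case=> [|z y' xz zy]; first by left.
by right; exists z => //; apply: clos_rt1n_rt.
Qed.

Lemma irreducible_star x y : irreducible x -> star x y -> x = y.
Proof. by move=> ix /star_inv[//|[z /ix]]. Qed.

Lemma joinable_ctx u v x y : joinable x y -> joinable (u ++ x ++ v) (u ++ y ++ v).
Proof. by case=> z xz yz; exists (u ++ z ++ v); apply: star_ctx. Qed.

Lemma joinable_sym x y : joinable x y -> joinable y x.
Proof. by case=> z; exists z. Qed.

Definition locally_confluent :=
  forall w x y, step w x -> step w y -> joinable x y.

Lemma newman : terminating T -> locally_confluent -> confluent T.
Proof.
move=> wf lc w; elim: (wf w) => {}w _ IH x y /star_inv[<- wy|[x1 wx1 x1x]].
  by exists y => //; apply: rt_refl.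
move=> /star_inv[<-|[y1 wy1 y1y]].
  by exists x; [apply: rt_refl|apply: star_trans x1x; apply: rt_step].
have [z xz yz] := lc _ _ _ wx1 wy1.
have [x2 xx2 zx2] := IH _ wx1 _ _ x1x xz.
have [y2 y2y zy2] := IH _ wy1 _ _ y1y (star_trans yz zx2).
by exists y2 => //; apply: star_trans zy2.
Qed.

Hypothesis reducing : length_reducing.

Lemma step_size x y : step x y -> size y < size x.
Proof. by move=> [u [v [l [r [/reducing Tlr -> ->]]]]]; rewrite !size_cat; lia. Qed.

Lemma reducing_terminating : terminating T.
Proof.
move=> w; have [n] := ubnP (size w); elim: n w => [//|n IH w wn].
by constructor=> y /step_size yw; apply: IH; apply: leq_trans yw _.
Qed.

Lemma star_size x y : star x y -> size y <= size x.
Proof.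
by elim=> [{}x {}y /step_size/ltnW//|{}x //|{}x {}y z _ h1 _ h2]; apply: leq_trans h2 h1.
Qed.

Lemma irreducible_exists w : exists2 w', star w w' & irreducible w'.
Proof.
elim: (reducing_terminating w) => {}w _ IH.
have [[y wy]|iw] := pselect (exists y, step w y).
  have [w' yw' iw'] := IH y wy.
  by exists w' => //; apply: star_trans yw'; apply: rt_step.
by exists w => [|y wy]; [apply: rt_refl|apply: iw; exists y].
Qed.

(** The two kinds of critical pairs: a proper overlap [y] of two left-hand sides, and one left-hand
    side inside another. *)
Definition critical_joinable := forall l1 r1 l2 r2, T l1 r1 -> T l2 r2 ->
  (forall x y z, l1 = x ++ y -> l2 = y ++ z -> y <> [::] ->
     joinable (r1 ++ z) (x ++ r2)) /\
  (forall x z, l1 = x ++ l2 ++ z -> joinable r1 (x ++ r2 ++ z)).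

Lemma critical_pairs : critical_joinable -> locally_confluent.
Proof.
move=> crit w x y [u1 [v1 [l1 [r1 [T1 -> ->]]]]] [u2 [v2 [l2 [r2 [T2 e ->]]]]].
(* By symmetry the redex [l1] may be taken to start first. Once the common prefix is cancelled, the
   redexes are either disjoint, and commute, or form a critical pair in a context. *)
suff gen : forall u1 v1 l1 r1 u2 v2 l2 r2, T l1 r1 -> T l2 r2 ->
    u1 ++ l1 ++ v1 = u2 ++ l2 ++ v2 -> size u1 <= size u2 ->
    joinable (u1 ++ r1 ++ v1) (u2 ++ r2 ++ v2).
  have [h|/ltnW h] := leqP (size u1) (size u2).
    exact: (gen _ _ l1 r1 _ _ l2 r2).
  by apply/joinable_sym/(gen _ _ l2 r2 _ _ l1 r1).
move=> {x y u1 v1 l1 r1 T1 u2 v2 l2 r2 T2 e} u1 v1 l1 r1 u2 v2 l2 r2 T1 T2 e.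
move=> /(cat_split e)[d [-> {}e]].
suff: joinable (r1 ++ v1) (d ++ r2 ++ v2).
  by move=> /(joinable_ctx u1 [::]); rewrite -!catA !cats0.
have [h|/ltnW h] := leqP (size l1) (size d).
  have [f [-> ->]] := cat_split e h; exists (r1 ++ f ++ r2 ++ v2).
    by rewrite !(catA r1 f); apply: star_rule.
  by rewrite -!catA; apply: (star_rule [::] (f ++ r2 ++ v2) T1).
have [f [el1 e2]] := cat_split (esym e) h.
have [f0|f0] := pselect (f = [::]).
  exists (r1 ++ r2 ++ v2).
    by move: e2; rewrite f0 /= => <-; exact: star_rule.
  by move: el1; rewrite f0 cats0 => <-; apply: (star_rule [::] (r2 ++ v2) T1).
have [h2|/ltnW h2] := leqP (size f) (size l2).
  have [z [el2 ->]] := cat_split (esym e2) h2.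
  have := (crit _ _ _ _ T1 T2).1 d f z el1 el2 f0.
  by move=> /(joinable_ctx [::] v2) /=; rewrite -!catA.
have [z [ef ->]] := cat_split e2 h2.
have := (crit _ _ _ _ T1 T2).2 d z; rewrite el1 ef => /(_ erefl).
by move=> /(joinable_ctx [::] v1) /=; rewrite -!catA.
Qed.

Hypothesis confl : confluent T.

Lemma church_rosser x y : equiv x y -> joinable x y.
Proof.
elim=> [{}x {}y h|{}x|{}x {}y _ /joinable_sym//|{}x {}y z _ [u xu yu] _ [v yv zv]].
- by exists y; [apply: rt_step|apply: rt_refl].
- by exists x; apply: rt_refl.
- have [w uw vw] := confl yu yv.
  by exists w; apply: star_trans; eassumption.
Qed.

Lemma irreducible_unique x y :
  irreducible x -> irreducible y -> equiv x y -> x = y.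
Proof.
move=> ix iy /church_rosser[z /(irreducible_star ix) -> /(irreducible_star iy)].
by [].
Qed.

End Convergence.

(** Group operations may reach a goal through convertible but syntactically different structures.
    Elaborating each of them again over [T] lets [lia] see equal lengths as the same atom. *)
Ltac canon_term T e :=
  match e with
  | @mul _ ?x ?y => let f := constr:(fun a b : T => (a * b)%g) in eval cbv beta in (f x y)
  | @inv _ ?x => let f := constr:(fun a : T => (a^-1)%g) in eval cbv beta in (f x)
  | @natexp _ ?x ?n => let f := constr:(fun a : T => (a ^+ n)%g) in eval cbv beta in (f x)
  | @conjg _ ?x ?y => let f := constr:(fun a b : T => (a ^ b)%g) in eval cbv beta in (f x y)
  | @one _ => constr:((1 : T)%g)
  end.
Ltac canon_goal T :=
  repeat match goal with
  | |- context [@mul ?M ?x ?y] =>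
    let e := constr:(@mul M x y) in let e' := canon_term T e in
    tryif constr_eq e e' then fail else change e with e'
  | |- context [@inv ?M ?x] =>
    let e := constr:(@inv M x) in let e' := canon_term T e in
    tryif constr_eq e e' then fail else change e with e'
  | |- context [@natexp ?M ?x ?n] =>
    let e := constr:(@natexp M x n) in let e' := canon_term T e in
    tryif constr_eq e e' then fail else change e with e'
  | |- context [@conjg ?M ?x ?n] =>
    let e := constr:(@conjg M x n) in let e' := canon_term T e in
    tryif constr_eq e e' then fail else change e with e'
  end.
Tactic Notation "canon" constr(T) := canon_goal T.

Ltac revert_arith :=
  repeat match goal with
  | H : is_true _ |- _ => revert H
  | H : @eq nat _ _ |- _ => revert H
  end.
Ltac glia_goal T := revert_arith; canon_goal T; lia.
Tactic Notation "glia" constr(T) := glia_goal T.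

(** * Geometry of normal forms *)

Section CommonPrefix.
Variable A : choiceType.
Implicit Types s t u : seq A.

Fixpoint lcp s t :=
  match s, t with
  | a :: s', b :: t' => if a == b then (lcp s' t').+1 else 0
  | _, _ => 0
  end.

Lemma lcpC s t : lcp s t = lcp t s.
Proof. by elim: s t => [|a s IH] [|b t] //=; rewrite eq_sym; case: eqP => // _; rewrite IH. Qed.

Lemma lcp_sizel s t : lcp s t <= size s.
Proof. by elim: s t => [|a s IH] [|b t] //=; case: eqP => // _; apply: IH. Qed.

Lemma lcp_sizer s t : lcp s t <= size t.
Proof. by rewrite lcpC lcp_sizel. Qed.

Lemma lcp_take s t k : k <= lcp s t -> take k s = take k t.
Proof.
elim: s t k => [|a s IH] [|b t] [|k] //=; case: eqP => // <- /IH ->.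
by [].
Qed.

Lemma lcp_ge s t k : k <= size s -> k <= size t -> take k s = take k t ->
  k <= lcp s t.
Proof.
elim: s t k => [|a s IH] [|b t] [|k] //= ks kt [<- e].
by rewrite eqxx ltnS IH.
Qed.

Lemma lcp_trans s t u : minn (lcp s t) (lcp t u) <= lcp s u.
Proof.
apply: lcp_ge.
- by rewrite geq_min lcp_sizel.
- by rewrite geq_min lcp_sizer orbT.
- by rewrite (@lcp_take s t) ?geq_minl// (@lcp_take t u) ?geq_minr.
Qed.

Lemma lcp_prefix u s t : size u <= lcp (u ++ s) (u ++ t).
Proof. by elim: u => //= a u IH; rewrite eqxx. Qed.

End CommonPrefix.

Lemma nth_flatten_nseq (X : Type) (x0 : X) k (w : seq X) j :
  j < k * size w -> nth x0 (flatten (nseq k w)) j = nth x0 w (j %% size w).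
Proof.
elim: k j => [|k IH] j //; rewrite mulSn /= nth_cat => jk.
have [jw|jw] := ltnP j (size w); first by rewrite modn_small.
rewrite IH; last by lia.
by rewrite -[in RHS](subnK jw) modnDr.
Qed.

Lemma size_flatten_nseq (X : Type) k (w : seq X) :
  size (flatten (nseq k w)) = k * size w.
Proof. by elim: k => //= k IH; rewrite size_cat IH mulSn. Qed.

Section Torsion.
Variable G : groupType.
Local Open Scope group_scope.

Definition torsion (g : G) := exists2 n, (0 < n)%N & g ^+ n = 1.

Lemma torsionJ g x : torsion (g ^ x) <-> torsion g.
Proof.
split=> -[n n0 e]; exists n => //.
  by move: e; rewrite -conjXg => /eqP; rewrite conjg_eq1 => /eqP.
by rewrite -conjXg e conj1g.
Qed.

Lemma torsionV g : torsion g^-1 <-> torsion g.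
Proof.
split=> -[n n0 e]; exists n => //.
  by move: e; rewrite expVgn => /eqP; rewrite invg_eq1 => /eqP.
by rewrite expVgn e invg1.
Qed.

Lemma torsionMC g x : torsion (g * x) -> torsion (x * g).
Proof. by move=> h; apply/(torsionJ _ g^-1); rewrite conjgE invgK !mulgA mulgK. Qed.

Definition witness (a b c : G) := [/\ torsion a, torsion b, torsion c, b <> 1 &
  [/\ torsion (a * b), torsion (b * c) & ~ torsion (a * c)]].

End Torsion.

Section Geometry.
Variables (A : choiceType) (T : relation (seq A)) (h : inverse_closed T).
Hypothesis reducing : length_reducing T.
Hypothesis confl : confluent T.
Variable sigma : nat.
Hypothesis sigmaP : forall l r, T l r -> size l <= sigma.
Local Notation G := (presented h).
Local Notation cls := (word_class h).
Local Notation K := sigma.*2.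
Local Open Scope group_scope.
Implicit Types (g x y z u b c q p : G) (w s t : seq A).

Lemma cls_cat s t : cls (s ++ t) = cls s * cls t.
Proof. by rewrite -presented_mulE. Qed.

Lemma cls_nil : cls [::] = 1. Proof. by []. Qed.

Lemma cls_inv w : cls (word_inv h w) = (cls w)^-1.
Proof.
apply/esym/mulg1_eq; rewrite -cls_cat; exact/word_classP/word_invP.
Qed.

Lemma cls_flatten k w : cls (flatten (nseq k w)) = cls w ^+ k.
Proof. by elim: k => //= k IH; rewrite cls_cat IH expgS. Qed.

Definition nf g : seq A :=
  let: exist2 w _ _ := cid2 (irreducible_exists reducing (generic_quotient.repr g)) in w.

Lemma nf_irr g : irreducible T (nf g).
Proof. by rewrite /nf; case: cid2. Qed.
Arguments nf_irr : clear implicits.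

Lemma nfK g : cls (nf g) = g.
Proof.
rewrite /nf; case: cid2 => w sw _; rewrite -[RHS]word_classK.
exact/esym/word_classP/rw_star_equiv.
Qed.

Lemma clsK w : irreducible T w -> nf (cls w) = w.
Proof.
move=> iw; apply: (irreducible_unique confl) => //; first exact: nf_irr.
by apply/word_classP; rewrite nfK.
Qed.

Lemma nf_star w : rw_star T w (nf (cls w)).
Proof.
have [w' sw iw] := irreducible_exists reducing w.
suff -> : cls w = cls w' by rewrite clsK.
exact/word_classP/rw_star_equiv.
Qed.

Definition len g := size (nf g).

(** Normal forms are geodesics: rewriting never lengthens a word, and every word for an element
    rewrites to its normal form. *)
Lemma size_cls w : len (cls w) <= size w.
Proof. exact: (star_size reducing (nf_star w)). Qed.

Lemma len1 : len 1 = 0.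
Proof. by have := size_cls [::]; rewrite cls_nil; case: (len 1). Qed.

Lemma len_mul g x : len (g * x) <= len g + len x.
Proof. by rewrite -{1}(nfK g) -{1}(nfK x) -cls_cat -size_cat size_cls. Qed.

Lemma len_inv g : len g^-1 = len g.
Proof.
have le y : len y^-1 <= len y.
  by rewrite -{1}(nfK y) -cls_inv (leq_trans (size_cls _))// size_rev size_map.
by apply/eqP; rewrite eqn_leq le -{1}(invgK g) le.
Qed.

Lemma len_mulVl g x : len (g^-1 * x) <= len g + len x.
Proof. by rewrite -(len_inv g) len_mul. Qed.

Lemma len_conj g x : len (g ^ x) <= len g + (len x).*2.
Proof.
rewrite conjgE; have := len_mulVl x (g * x); have := len_mul g x; glia G.
Qed.

Lemma len_conjV g x : len g <= len (g ^ x) + (len x).*2.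
Proof. by rewrite -{1}(conjgK x g) -(len_inv x) len_conj. Qed.

(** If the lengths add up, the concatenation is already irreducible, since any rewriting step would
    shorten it. *)
Lemma nf_add g x : len (g * x) = len g + len x -> nf (g * x) = nf g ++ nf x.
Proof.
move=> e; have := nf_star (nf g ++ nf x); rewrite cls_cat !nfK => /star_inv[->//|].
move=> [y /(step_size reducing) sy /(star_size reducing)].
by move: e sy; rewrite /len size_cat; glia G.
Qed.

Lemma irr_factor s w t : irreducible T (s ++ w ++ t) -> irreducible T w.
Proof. by move=> i y /(rw_step_cat s t)/i. Qed.

Lemma irr_take w i : irreducible T w -> irreducible T (take i w).
Proof. by rewrite -{1}(cat_take_drop i w) => /(@irr_factor [::]). Qed.

Lemma irr_drop w i : irreducible T w -> irreducible T (drop i w).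
Proof. by rewrite -{1}(cat_take_drop i w) -[drop i w]cats0 => /irr_factor; rewrite cats0. Qed.

(* The vertex at distance [i] from 1 on the geodesic from 1 to [g]. *)
Definition pt g i : G := cls (take i (nf g)).

Lemma nf_pt g i : nf (pt g i) = take i (nf g).
Proof. by apply: clsK; apply: irr_take; apply: nf_irr. Qed.

Lemma len_pt g i : i <= len g -> len (pt g i) = i.
Proof. by move=> ig; rewrite /len nf_pt size_takel. Qed.

Lemma pt_pt g i j : i <= j -> pt (pt g j) i = pt g i.
Proof. by move=> ij; rewrite /pt nf_pt take_takel. Qed.

Lemma pt_rest g i : (pt g i)^-1 * g = cls (drop i (nf g)).
Proof. by rewrite -{2}(nfK g) -{1}(cat_take_drop i (nf g)) cls_cat mulKg. Qed.

Lemma len_rest g i : len ((pt g i)^-1 * g) = len g - i.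
Proof. by rewrite pt_rest /len clsK ?size_drop//; apply: irr_drop; apply: nf_irr. Qed.

Lemma len_pt_pt g i j : i <= j <= len g -> len ((pt g i)^-1 * pt g j) = j - i.
Proof.
by case/andP=> ij jg; rewrite -(pt_pt g ij) len_rest len_pt.
Qed.

(** This is the Gromov product up to a bounded error: by [gp_upper] and [gp_thin], twice its value
    is [len g + len x - len (g^-1 * x)] up to [2 K]. As a common prefix length it satisfies the
    ultrametric inequality [gp_trans] exactly. *)
Definition gp g x := lcp (nf g) (nf x).

Lemma gpC g x : gp g x = gp x g. Proof. exact: lcpC. Qed.
Lemma gp_lel g x : gp g x <= len g. Proof. exact: lcp_sizel. Qed.
Lemma gp_ler g x : gp g x <= len x. Proof. exact: lcp_sizer. Qed.
Lemma gp_pt g x i : i <= gp g x -> pt g i = pt x i.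
Proof. by move=> /lcp_take e; rewrite /pt e. Qed.
Lemma gp_trans g x y : minn (gp g x) (gp x y) <= gp g y.
Proof. exact: lcp_trans. Qed.
Lemma gp_self g : gp g g = len g.
Proof. by apply/eqP; rewrite eqn_leq gp_lel; apply: lcp_ge. Qed.
Lemma gp_ptr g i : i <= len g -> gp g (pt g i) = i.
Proof.
move=> ig; apply/eqP; rewrite eqn_leq; apply/andP; split.
  by rewrite -{2}(len_pt ig) gp_ler.
by apply: lcp_ge; rewrite ?nf_pt ?size_takel// take_takel.
Qed.

(* A rewriting step only affects a bounded end of an irreducible prefix. *)
Lemma step_prefix (s t y : seq A) : irreducible T s -> rw_step T (s ++ t) y ->
  exists s1 s2 t', [/\ s = s1 ++ s2, y = s1 ++ t', size s <= size s1 + sigma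
    & size y < size s + size t].
Proof.
move=> is_ st; have := step_size reducing st; rewrite size_cat.
case: st => [x [v [l [r [Tl e ->]]]]] sy.
have [xs|/ltnW xs] := leqP (size x) (size s).
  have [d [es e']] := cat_split (esym e) xs.
  exists x, d, (r ++ v); split=> //.
  rewrite es size_cat; have [dl|/ltnW ld] := leqP (size d) (size l).
    by rewrite leq_add2l (leq_trans dl)//; apply: sigmaP Tl.
  have [f [ed _]] := cat_split e' ld.
  case: (is_ (x ++ r ++ f)); exists x, f, l, r; split=> //.
  by rewrite es ed.
have [d [ex _]] := cat_split e xs.
by exists s, [::], (d ++ r ++ v); split; rewrite ?cats0 ?leq_addr// ex -catA.
Qed.

(** The word for [g] followed by [a] has length [len g + 1], the result at least [len g - 1], and
    every step shortens; so there are at most two steps. Each of them destroys at most [sigma]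
    letters of the surviving prefix, whence [K = 2 sigma]. *)
Lemma gp_letter g a : len g <= gp g (g * cls [:: a]) + K.
Proof.
set g' := g * _; have st : rw_star T (nf g ++ [:: a]) (nf g').
  by have := nf_star (nf g ++ [:: a]); rewrite cls_cat nfK.
have len1g : len g <= len g' + 1.
  rewrite -{1}(mulgK (cls [:: a]) g) (leq_trans (len_mul _ _))// len_inv leq_add2l.
  exact: size_cls.
case/star_inv: st => [e|[y1 st1]].
  rewrite /gp -e; have := lcp_prefix (nf g) [::] [:: a].
  by rewrite cats0 /len; glia G.
have is_ : irreducible T (nf g) by apply: nf_irr.
have [s1 [s2 [t1 [e1 -> l1 z1]]]] := step_prefix is_ st1.
case/star_inv=> [e|[y2 st2]].
  rewrite /gp -e {1}e1; have := lcp_prefix s1 s2 t1; rewrite /len; glia G.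
have is1 : irreducible T s1 by apply: (@irr_factor [::] s1 s2); rewrite -e1.
have [s3 [s4 [t2 [e2 -> l2 z2]]]] := step_prefix is1 st2 => st.
have [e|[y3 /(step_size reducing) z3 /(star_size reducing) z4]] := star_inv st.
  rewrite /gp -e {1}e1 e2 -catA; have := lcp_prefix s3 (s4 ++ s2) t2.
  by rewrite /len; glia G.
by move: z1 z2 z3 z4 len1g; rewrite /len !size_cat /=; glia G.
Qed.

(** The error [K] enters only once, however long [t] is, because [gp_trans] takes a minimum instead
    of adding errors. *)
Lemma gp_word g t : len g <= gp g (g * cls t) + size t + K.
Proof.
elim/last_ind: t => [|t a IH]; first by rewrite mulg1 gp_self; glia G.
rewrite -cats1 cls_cat mulgA size_cat /=; set g' := g * cls t in IH *.
have := gp_letter g' a; have := gp_trans g g' (g' * cls [:: a]).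
have : len g <= len g' + size t.
  by rewrite -{1}(mulgK (cls t) g) (leq_trans (len_mul _ _))// len_inv leq_add2l size_cls.
glia G.
Qed.

Lemma gp_mul g x : len g <= gp g (g * x) + len x + K.
Proof. by have := gp_word g (nf x); rewrite nfK. Qed.

(* A path from [g] that leaves the cone of the vertex at height [k] below [g] *)
(* passes near that vertex.                                                    *)
Lemma cone_exit g t k : gp g (g * cls t) < k <= len g ->
  exists2 j, j <= size t & len (g * cls (take j t)) < k + K.
Proof.
elim/last_ind: t => [|t a IH]; first by rewrite mulg1 gp_self; glia G.
case/andP=> + kg; rewrite -cats1 cls_cat mulgA; set g' := g * cls t => gk.
have [gk'|gk'] := ltnP (gp g g') k.
  have [|j jt lj] := IH; first by rewrite gk'.
  by exists j; rewrite ?size_cat ?takel_cat//; glia G.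
exists (size t); first by rewrite size_cat; glia G.
rewrite take_size_cat// -/g'; have := gp_letter g' a.
by have := gp_trans g g' (g' * cls [:: a]); glia G.
Qed.

(** The geodesic from [g] to [x] leaves the cone of the vertex at height [gp g x + 1] below [g],
    hence meets a vertex [z] of length at most [gp g x + K]. Add the triangle inequalities for the
    two pieces of the geodesic at [z]. *)
Lemma gp_thin g x : len g + len x <= len (g^-1 * x) + (gp g x).*2 + K.*2.
Proof.
have [lg|gl] := leqP (len g) (gp g x).
  have := len_mul g (g^-1 * x); rewrite mulVKg; glia G.
set t := nf (g^-1 * x).
have [|j jt lj] := @cone_exit g t (gp g x).+1.
  by rewrite nfK mulVKg ltnSn gl.
set z := g * _ in lj; have ez : z * cls (drop j t) = x.
  by rewrite -mulgA -cls_cat cat_take_drop nfK mulVKg.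
have := len_mul z (cls (take j t))^-1; rewrite mulgK len_inv.
have := len_mul z (cls (drop j t)); rewrite ez.
have := size_cls (take j t); have := size_cls (drop j t).
rewrite size_drop size_takel//; move: jt; rewrite /t -/(len _); glia G.
Qed.

Lemma gp_upper g x : len (g^-1 * x) + (gp g x).*2 <= len g + len x.
Proof.
set i := gp g x; have e : pt g i = pt x i by apply: gp_pt.
have -> : g^-1 * x = ((pt g i)^-1 * g)^-1 * ((pt x i)^-1 * x).
  by rewrite e invgM invgK -mulgA mulVKg.
have := len_mulVl ((pt g i)^-1 * g) ((pt x i)^-1 * x); rewrite !len_rest.
by have := gp_lel g x; have := gp_ler g x; rewrite -/i; glia G.
Qed.

(** By [nf_add] geodesics are unique, so the geodesic from 1 to [g^-1], translated by [g], runs back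
    along the one from 1 to [g]. *)
Lemma pt_rev g i : i <= len g -> g * pt g^-1 (len g - i) = pt g i.
Proof.
move=> ig; set p := pt g i; have lp : len p = i by rewrite len_pt.
have l1 : len (g^-1 * p) = len g - i by rewrite -len_inv invgM invgK len_rest.
have e : g^-1 = (g^-1 * p) * p^-1 by rewrite mulgK.
have/nf_add ne : len ((g^-1 * p) * p^-1) = len (g^-1 * p) + len p^-1.
  by rewrite -e !len_inv l1 lp subnK.
by rewrite /pt e ne -l1 take_size_cat// nfK mulVKg.
Qed.

(** The hypothesis says that [c^-1] and [c] have a short common prefix. Inductively [c^-n] has a
    longer one with [c^-1], so by the ultrametric inequality it agrees with [c] no further than
    [c^-1] does, and little cancels in [c^n c]. *)
Lemma expg_growth c : len c + K.*2 < len (c * c) ->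
  forall n, len (c ^+ n) < len (c ^+ n.+1).
Proof.
move=> lc; have up := gp_upper c^-1 c; rewrite invgK len_inv in up.
elim=> [|n IH].
  by rewrite expg0 expg1 len1; move: lc up; case: (len c) (gp_lel c^-1 c); glia G.
set x := (c ^+ n.+1)^-1; have lx : len x = len (c ^+ n.+1) by rewrite len_inv.
have := gp_thin x c^-1; have := gp_thin x c.
rewrite invgK -(expgSr c n.+1) (expgSr c n) mulgK len_inv lx -(expgSr c n).
by have := gp_trans c^-1 x c; rewrite (gpC c^-1 x); glia G.
Qed.

Lemma torsion_sqr g : torsion g -> len (g * g) <= len g + K.*2.
Proof.
case=> n n0 gn; rewrite leqNgt; apply/negP => /expg_growth gr.
have: n <= len (g ^+ n) by elim: {n0 gn} n => // n IH; apply: leq_ltn_trans IH (gr n).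
by rewrite gn len1; glia G.
Qed.

Lemma torsion_gp g : torsion g -> len g <= (gp g g^-1).*2 + K.*2.*2.
Proof.
by move=> /torsion_sqr; have := gp_thin g^-1 g; rewrite invgK len_inv gpC; glia G.
Qed.

Lemma torsion_center g : torsion g -> exists2 u, len (g ^ u) <= K.*2.*2.+1 &
  [/\ (len u).*2 <= len g, len g <= (len u).*2 + K.*2.*2.+1,
      u = pt g (len u) & u = pt g^-1 (len u)].
Proof.
move=> /torsion_gp tg; set l := minn (gp g g^-1) (len g)./2.
have lg : l.*2 <= len g by rewrite /l; glia G.
have lu : len (pt g l) = l by rewrite len_pt//; glia G.
have eu : pt g l = pt g^-1 l by apply: gp_pt; rewrite /l geq_minl.
exists (pt g l); last by rewrite lu -eu; split=> //; rewrite /l; glia G.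
(* The midpoint is also an initial segment of [g^-1], so [g] moves it to a vertex of the geodesic
   from 1 to [g], at height [len g - l]. *)
rewrite conjgE; have -> : g * pt g l = pt g (len g - l).
  by rewrite -[RHS]pt_rev ?leq_subr// subKn -?eu//; glia G.
by rewrite len_pt_pt; rewrite /l; glia G.
Qed.

Definition fixC := (16 * K + 3)%N.

(* Two elliptic elements with elliptic product have a common almost fixed     *)
(* vertex.                                                                    *)
Lemma torsion_common b c : torsion b -> torsion c -> torsion (b * c) ->
  exists u, len (b ^ u) <= fixC /\ len (c ^ u) <= fixC.
Proof.
move=> tb tc tbc; have [u lu _] := torsion_center tb.
suff [v [h1 h2]] : exists v, len ((b ^ u) ^ v) <= fixC /\ len ((c ^ u) ^ v) <= fixC.
  by exists (u * v); rewrite !conjgM.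
have {tbc} : torsion (b ^ u * c ^ u) by rewrite -conjMg; apply/torsionJ.
move: {tb tc} (b ^ u) (c ^ u) lu ((torsionJ c u).2 tc) => {u}b {}c lb tc tbc.
have [v lv [v1 v2 v3 v4]] := torsion_center tc; exists v.
split; last by move: lv; rewrite /fixC; glia G.
(* Now [b] is short and [v] is the middle of [c]. Consecutive elements of the list [b v], [g],
   [g^-1], [c^-1], [v] agree up to height [len v] with a bounded error; for [g] and [g^-1] this is
   where torsion of [b c] enters. Hence [b v] is close to [v]. *)
have := torsion_gp tbc; set g := b * c.
have g1 := gp_mul c^-1 b^-1; rewrite -invgM -/g !len_inv in g1.
have g2 : gp c^-1 v = len v by rewrite [X in gp _ X]v4 gp_ptr// len_inv; glia G.
have g3 := gp_thin (b * v) g.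
have e3 : (b * v)^-1 * g = v^-1 * c by rewrite invgM -!mulgA mulKg.
have l3 : len (v^-1 * c) = len c - len v by rewrite [in LHS]v3 len_rest.
rewrite e3 l3 in g3.
have := len_mulVl b (b * v); have := len_mulVl b g; rewrite !mulKg.
have := gp_trans (b * v) g g^-1; have := gp_trans (b * v) g^-1 c^-1.
have := gp_trans (b * v) c^-1 v; have := gp_upper v (b * v).
rewrite conjgE (gpC v) (gpC g^-1 c^-1); have := len_mul b v.
move: g1 g2 g3 lb v1 v2; rewrite /fixC; glia G.
Qed.

(** The elements [u^-1] and [(b u)^-1 = u^-1 b^-1] agree except for at most [len b + K] final
    letters of [u^-1]. By [pt_rev], away from 1 the translate by [b] of the geodesic to [u] is
    therefore the geodesic to [b u]. *)
Lemma pt_mull b u i : len b + K <= i <= len u ->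
  b * pt u i = pt (b * u) (i + len (b * u) - len u).
Proof.
case/andP=> bi iu; set k := (len u - i)%N.
have kg : k <= gp u^-1 (b * u)^-1.
  have := gp_mul u^-1 b^-1; rewrite -invgM !len_inv /k; glia G.
have kbu := leq_trans kg (gp_ler _ _); rewrite len_inv in kbu.
rewrite -(pt_rev iu) -/k (gp_pt kg) mulgA.
rewrite -(@pt_rev (b * u) (i + len (b * u) - len u)); last by glia G.
by congr (_ * pt _ _); glia G.
Qed.

Lemma pt_mulr u q i : i + len q + K <= len u -> pt (u * q) i = pt u i.
Proof. by move=> iu; apply/esym/gp_pt; have := gp_mul u q; glia G. Qed.

(** Because [b u = u q], the geodesic to [u] and its translate by [b] coincide in the middle up to a
    shift by the difference of [len (b * u)] and [len u]. Shift 0 would give a fixed vertex and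
    [b = 1]; otherwise the sign decides between [b] and [b^-1]. A window of [sigma + 1] vertices is
    what [periodic_axis] needs. *)
Lemma translation_window b u q : b * u = u * q -> b <> 1 ->
    5 * len b + len q + K.*2 + sigma < len u ->
  exists c d, [/\ c = b \/ c = b^-1, 0 < d,
    len b + K + sigma + d <= len u &
    forall i, len b + K <= i <= len b + K + sigma -> c * pt u i = pt u (i + d)].
Proof.
move=> e b1 big.
have lbu := len_mul b u; have lub := len_mulVl b (b * u); rewrite mulKg in lub.
have shift i : len b + K <= i -> i + (2 * len b)%N + len q + K <= len u ->
    b * pt u i = pt u (i + len (b * u) - len u).
  move=> bi iu; rewrite pt_mull; last by glia G.
  by rewrite {1}e pt_mulr//; glia G.
have [lt|lt|eq] := ltngtP (len u) (len (b * u)).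
- exists b, (len (b * u) - len u); split; [by left|glia G|glia G|move=> i i1].
  by rewrite shift; [congr pt; glia G|glia G|glia G].
- exists b^-1, (len u - len (b * u)); split; [by right|glia G|glia G|move=> i i1].
  apply: (mulgI b); rewrite mulVKg shift; [congr pt; glia G|glia G|glia G].
- case: b1; apply: (mulIg (pt u (len b + K))); rewrite mul1g shift; [|glia G|glia G].
  by congr pt; glia G.
Qed.

Lemma pt_succ (x0 : A) u j : j < len u -> pt u j.+1 = pt u j * cls [:: nth x0 (nf u) j].
Proof. by move=> ju; rewrite /pt (take_nth x0)// -cats1 cls_cat. Qed.

(* A vertex path translated along itself by [d > 0] is labelled by powers of a *)
(* word all of whose powers are irreducible, since irreducibility is local.    *)
Lemma periodic_axis c u i0 d : 0 < d -> i0 + sigma + d <= len u ->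
    (forall i, i0 <= i <= i0 + sigma -> c * pt u i = pt u (i + d)) ->
  exists w, [/\ c = pt u i0 * cls w * (pt u i0)^-1, size w = d &
    forall k, irreducible T (flatten (nseq k w))].
Proof.
move=> d0 iu sh; set w := take d (drop i0 (nf u)); exists w.
have sw : size w = d by rewrite size_takel// size_drop -/(len u); glia G.
have [x0 _] : exists x0 : A, true.
  by move: iu; rewrite /len; case: (nf u) => [|x0 s _]; [rewrite /=; glia G|exists x0].
split=> //.
  apply: (mulIg (pt u i0)); rewrite mulgVK sh; last by glia G.
  by rewrite /pt takeD cls_cat.
have per j : i0 <= j < i0 + sigma -> nth x0 (nf u) (j + d) = nth x0 (nf u) j.
  move=> ij; have := sh j.+1; rewrite addSn !(pt_succ x0); [|glia G|glia G].
  rewrite mulgA sh; last by glia G.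
  move=> /(_ ltac:(lia))/mulgI e.
  have irr1 i : i < len u -> irreducible T [:: nth x0 (nf u) i].
    move=> iu'; have := @irr_take (nf u) i.+1 (nf_irr u); rewrite (take_nth x0)// -cats1.
    by rewrite -[[:: nth _ _ _]]cats0 => /irr_factor.
  have : nf (cls [:: nth x0 (nf u) j]) = nf (cls [:: nth x0 (nf u) (j + d)]) by rewrite e.
  by rewrite !clsK; [case|apply: irr1; glia G|apply: irr1; glia G].
have perw m : m < d + sigma -> nth x0 (nf u) (i0 + m) = nth x0 w (m %% d).
  elim/ltn_ind: m => m IH md; have [m1|m1] := ltnP m d.
    by rewrite modn_small// nth_take// nth_drop.
  have -> : i0 + m = (i0 + (m - d) + d)%N by glia G.
  rewrite per; last by glia G.
  rewrite IH; [|glia G|glia G].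
  by rewrite -{2}(subnK m1) modnDr.
(* A redex in a power of [w] has length at most [sigma]; moved to its starting position modulo [d],
   it falls into the window, where it would be a factor of the irreducible word [nf u]. *)
move=> k y [s [t [l [r [Tl e _]]]]].
have ls := sigmaP Tl; have ke := congr1 size e.
rewrite size_flatten_nseq sw !size_cat in ke.
have mod_lt : size s %% d < d by rewrite ltn_mod.
have el : l = take (size l) (drop (i0 + size s %% d) (nf u)).
  apply: (@eq_from_nth _ x0).
    by rewrite size_takel// size_drop -/(len u); glia G.
  move=> j jl; rewrite nth_take// nth_drop -addnA perw; last by glia G.
  have := @nth_flatten_nseq _ x0 k w (size s + j).
  rewrite sw e => /(_ ltac:(lia)).
  rewrite nth_cat ltnNge leq_addr /= addKn nth_cat jl => ->.
  by congr nth; rewrite modnDml.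
have := @irr_take _ (size l) (@irr_drop _ (i0 + size s %% d) (nf_irr u)).
by rewrite -el => /(_ r); apply; exists [::], [::], l, r; rewrite !cats0.
Qed.

Definition has_axis g := exists p w, [/\ g = p * cls w * p^-1, w <> [::],
  len p <= len g + K & forall k, irreducible T (flatten (nseq k w))].

(** Linear growth with a constant that depends only on [len g] and not on an unknown axis. This
    makes torsion decidable by a single power, see [torsion_test]. *)
Definition translates g := forall n, n <= len (g ^+ n) + (len g + K).*2.

Lemma conj_expg p x n : (p * x * p^-1) ^+ n = p * x ^+ n * p^-1.
Proof. by have := conjXg x p^-1 n; rewrite !conjgE invgK !mulgA. Qed.

Lemma has_axis_translates g : has_axis g -> translates g.
Proof.
move=> [p [w [e w0 lp irr]]] n.
have e1 : cls w ^+ n = p^-1 * g ^+ n * p.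
  by rewrite e conj_expg !mulgA mulVg mul1g mulgVK.
have : len (cls w ^+ n) = (n * size w)%N.
  by rewrite -cls_flatten /len clsK// size_flatten_nseq.
have : 0 < size w by case: (w) w0.
have := len_mul (p^-1 * g ^+ n) p; have := len_mulVl p (g ^+ n); rewrite -e1.
nia.
Qed.

Lemma translatesV g : translates g^-1 -> translates g.
Proof. by move=> tr n; have := tr n; rewrite expVgn !len_inv. Qed.

Lemma commute_long b u q : b * u = u * q -> b <> 1 ->
    5 * len b + len q + K.*2 + sigma < len u ->
  has_axis b \/ has_axis b^-1.
Proof.
move=> e b1 big; have [c [d [ec d0 lu sh]]] := translation_window e b1 big.
have [w [cw sw irr]] := periodic_axis d0 lu sh.
have : has_axis c; last by case: ec => ->; [left|right].
exists (pt u (len b + K)), w; split=> //.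
  by move=> w0; rewrite w0 in sw; rewrite -sw in d0.
by rewrite len_pt; [case: ec => ->; rewrite ?len_inv|glia G].
Qed.

(** A long power [u = g^n] satisfies [g u = u g], so [commute_long] applies with [b = q = g]. *)
Lemma axis_or_bounded g : (has_axis g \/ has_axis g^-1) \/
  forall n, len (g ^+ n) <= (6 * len g)%N + K.*2 + sigma.
Proof.
have [->|g1] := pselect (g = 1).
  by right=> n; rewrite expg1n len1.
have [[n h1]|nex] := pselect (exists n, 6 * len g + K.*2 + sigma < len (g ^+ n)).
  left; apply: (@commute_long g (g ^+ n) g) => //; last by glia G.
  by rewrite -expgS -expgSr.
by right=> n; rewrite leqNgt; apply/negP => h1; apply: nex; exists n.
Qed.

Lemma axis_translates g : has_axis g \/ has_axis g^-1 -> translates g.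
Proof. by case=> /has_axis_translates// /translatesV. Qed.

Lemma translates_not_torsion g : translates g -> ~ torsion g.
Proof.
move=> tr [n n0 gn]; have := tr (n * (len g + K).*2.+1)%N.
by rewrite expgnA gn expg1n len1; nia.
Qed.

Lemma torsion_commute b u q : torsion b -> b <> 1 -> b * u = u * q ->
  len u <= 5 * len b + len q + K.*2 + sigma.
Proof.
move=> tb b1 e; rewrite leqNgt; apply/negP => /(commute_long e b1).
by move=> /axis_translates/translates_not_torsion.
Qed.

(** At a common almost fixed vertex [u] one has [b u = u (b ^ u)] with [b ^ u] of length at most
    [fixC]. [torsion_commute] thus bounds [len u], and [len c] exceeds [fixC] by at most
    [2 * len u]. *)
Lemma torsion_ball b c : torsion b -> b <> 1 -> torsion c -> torsion (b * c) ->
  len c <= 10 * len b + 3 * fixC + 4 * K + 2 * sigma.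
Proof.
move=> tb b1 tc tbc; have [u [lb lc]] := torsion_common tb tc tbc.
have := @torsion_commute b u (b ^ u) tb b1; rewrite conjgC => /(_ erefl).
by have := len_conjV c u; move: lb lc; rewrite conjgE; glia G.
Qed.

(** Conjugation to a common almost fixed vertex brings [a] and [b] below [fixC = 32 sigma + 3]. Then
    [torsion_ball] gives [len c <= 13 fixC + 4 K + 2 sigma = 426 sigma + 39], within the stated
    bound. *)
Lemma short_witness a b c : witness a b c ->
  exists a b c, witness a b c /\
    [/\ len a <= 598 * sigma + 200, len b <= 598 * sigma + 200 & len c <= 598 * sigma + 200]%N.
Proof.
move=> [ta tb tc b1 [tab tbc tac]].
have [u [la lb]] := torsion_common ta tb tab.
have b1' : b ^ u <> 1 by move=> /eqP; rewrite conjg_eq1 => /eqP.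
have tbc' : torsion (b ^ u * c ^ u) by rewrite -conjMg; apply/torsionJ.
exists (a ^ u), (b ^ u), (c ^ u); split.
  split=> //; rewrite -?conjMg; try exact/torsionJ.
  by split; first [exact/torsionJ | by move=> /torsionJ].
have := torsion_ball ((torsionJ b u).2 tb) b1' ((torsionJ c u).2 tc) tbc'.
by move: la lb; rewrite /fixC; split; glia G.
Qed.

End Geometry.

(** * Nested minimal cuts *)

Section FiniteSets.
Local Open Scope classical_set_scope.

Definition ncard (X : choiceType) (B : set X) : nat := size (fset_set B).

Variable X : choiceType.
Implicit Types B C D U V : set X.

Lemma ncard_sub B C : finite_set C -> B `<=` C -> ncard B <= ncard C.
Proof.
move=> fC BC; have fB := sub_finite_set BC fC; apply: fsubset_leq_card.
by apply/fsubsetP => x; rewrite !in_fset_set// !inE => /BC.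
Qed.

Lemma ncard_set0 B : finite_set B -> ncard B = 0 -> B = set0.
Proof. by move=> fB /cardfs0_eq /fset_set_set0 ->. Qed.

Lemma ncardU B C : finite_set B -> finite_set C ->
  ncard (B `|` C) + ncard (B `&` C) = ncard B + ncard C.
Proof. by move=> fB fC; rewrite /ncard fset_setU// fset_setI// cardfsUI. Qed.

Lemma ncard_disj B C : finite_set B -> finite_set C -> B `&` C = set0 ->
  ncard (B `|` C) = ncard B + ncard C.
Proof.
by move=> fB fC e; have := ncardU fB fC; rewrite e /ncard fset_set0 cardfs0 addn0.
Qed.

Lemma ncard_setU1 x B : finite_set B -> ~ B x -> ncard (x |` B) = (ncard B).+1.
Proof.
move=> fB Bx; rewrite (ncard_disj (finite_set1 x) fB); last first.
  by apply/seteqP; split=> // y [/= ->].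
by rewrite {1}/ncard fset_set1 cardfs1.
Qed.

(** The hypotheses express inclusion of multisets: each element occurs in [U] and [V] together at
    most as often as in [C] and [D]. *)
Lemma ncard_UI U V C D : finite_set C -> finite_set D ->
  U `|` V `<=` C `|` D -> U `&` V `<=` C `&` D ->
  ncard U + ncard V <= ncard C + ncard D.
Proof.
move=> fC fD h1 h2; have fCD : finite_set (C `|` D) by rewrite finite_setU.
have fUV := sub_finite_set h1 fCD.
have [fU fV] : finite_set U /\ finite_set V by move: fUV; rewrite finite_setU.
rewrite -(ncardU fU fV) -(ncardU fC fD) leq_add// ncard_sub//.
exact: finite_setIl.
Qed.

Lemma ncard_UI_lt U V C D x : finite_set C -> finite_set D ->
  U `|` V `<=` C `|` D -> U `&` V `<=` C `&` D ->
  (C `|` D) x -> ~ (U `|` V) x ->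
  ncard U + ncard V < ncard C + ncard D.
Proof.
move=> fC fD h1 h2 cx ux; have fCD : finite_set (C `|` D) by rewrite finite_setU.
have fUV := sub_finite_set h1 fCD.
have [fU fV] : finite_set U /\ finite_set V by move: fUV; rewrite finite_setU.
rewrite -(ncardU fU fV) -(ncardU fC fD) -addSn leq_add//; last first.
  by apply: ncard_sub => //; apply: finite_setIl.
have -> : (ncard (U `|` V)).+1 = ncard (x |` (U `|` V)).
  by rewrite ncard_setU1.
by apply: ncard_sub => // y [->//|/h1].
Qed.

Lemma ncard_inj (Y : choiceType) (f : X -> Y) B :
  injective f -> finite_set B -> ncard (f @` B) = ncard B.
Proof. by move=> fi fB; rewrite /ncard fset_set_image// card_imfset. Qed.

Lemma ncard_uniq (s : seq X) B : uniq s -> finite_set B ->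
  (forall x, x \in s -> B x) -> size s <= ncard B.
Proof.
move=> us fB sB; apply: uniq_leq_size => // x xs.
by rewrite in_fset_set// inE; apply: sB.
Qed.

Lemma finite_nat_bound (B : set nat) : finite_set B ->
  exists N, forall n, B n -> n < N.
Proof.
move=> fB; exists (\sum_(i <- fset_set B) i).+1 => n Bn.
have nB : n \in fset_set B by rewrite in_fset_set// inE.
by rewrite ltnS (big_rem n)//= leq_addr.
Qed.

End FiniteSets.

Section Paths.
Variable X : choiceType.
Local Notation crt := (clos_refl_trans X).

Lemma crt_mono (R R' : relation X) x y : (forall a b, R a b -> R' a b) ->
  crt R x y -> crt R' x y.
Proof.
move=> s; elim=> [{}x {}y /s r|{}x|{}x {}y z _ h1 _ h2]; first exact: rt_step.
  exact: rt_refl.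
exact: rt_trans h1 h2.
Qed.

(** One finite list of edges serves all sets [P] simultaneously; this turns a connecting path into
    finiteness of a family of cuts. *)
Lemma crt_edges (R : relation X) x y : crt R x y ->
  exists l : seq (X * X), (forall e, e \in l -> R e.1 e.2) /\
    forall P : X -> Prop, P x -> ~ P y ->
      exists2 e, e \in l & P e.1 /\ ~ P e.2.
Proof.
elim=> [{}x {}y r|{}x|{}x {}y z _ [l1 [r1 h1]] _ [l2 [r2 h2]]].
- exists [:: (x, y)]; split=> [e|P Px Py]; first by rewrite inE => /eqP ->.
  by exists (x, y); rewrite ?inE.
- by exists [::]; split.
exists (l1 ++ l2); split=> [e|P Px Pz].
  by rewrite mem_cat => /orP[/r1|/r2].
have [Py|Py] := pselect (P y).
  by have [e el h] := h2 P Py Pz; exists e; rewrite ?mem_cat ?el ?orbT.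
by have [e el h] := h1 P Px Py; exists e; rewrite ?mem_cat ?el.
Qed.

Lemma crt_exit (R : relation X) x y (P : X -> Prop) : crt R x y -> P x -> ~ P y ->
  exists a b, [/\ R a b, P a & ~ P b].
Proof.
move=> /crt_edges[l [r h]] Px Py; have [[a b] /r ab [Pa Pb]] := h P Px Py.
by exists a, b.
Qed.

End Paths.

Lemma min_nat (P : nat -> Prop) : (exists n, P n) ->
  exists2 n, P n & forall m, P m -> n <= m.
Proof.
case=> n; elim/ltn_ind: n => n IH Pn.
have [[m mn Pm]|no] := pselect (exists2 m, m < n & P m); first exact: IH Pm.
by exists n => // m Pm; rewrite leqNgt; apply/negP => mn; apply: no; exists m.
Qed.

(** * Edge cuts of a Cayley graph and their uncrossing *)

Section Cuts.
Variables (G : groupType) (S : seq G).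
Hypothesis S_inv : forall s, s \in S -> (s^-1)%g \in S.
Local Open Scope group_scope.
Local Open Scope classical_set_scope.
Implicit Types (A B C D : set G) (x y z g h : G) (p : G * G).

Definition adj x y : Prop := x^-1 * y \in S.

Hypothesis S_gen : forall x y, clos_refl_trans G adj x y.

Lemma adj_sym x y : adj x y -> adj y x.
Proof. by rewrite /adj => /S_inv; rewrite invgM invgK. Qed.

Lemma adj_mull g x y : adj (g * x) (g * y) = adj x y.
Proof. by rewrite /adj invgM -mulgA mulKg. Qed.

Definition bd A : set (G * G) := [set e | [/\ A e.1, ~ A e.2 & adj e.1 e.2]].
Definition fin A := finite_set (bd A).
Definition mu A := ncard (bd A).
Definition conn A := forall x y, A x -> A y ->
  clos_refl_trans G (fun a b => [/\ adj a b, A a & A b]) x y.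

Lemma bdC A : bd (~` A) = (fun e => (e.2, e.1)) @` bd A.
Proof.
apply/seteqP; split=> [[x y] [/= nx /contrapT ny xy]|_ [[x y] [/= Ax Ay xy] <-]].
  by exists (y, x) => //; split=> //; apply: adj_sym.
by split=> //=; apply: adj_sym.
Qed.

Lemma finC A : fin A -> fin (~` A).
Proof. by rewrite /fin bdC; apply: finite_image. Qed.

Lemma muC A : fin A -> mu (~` A) = mu A.
Proof. by move=> fA; rewrite /mu bdC ncard_inj// => -[x y] [x' y'] [-> ->]. Qed.

Lemma finI A B : fin A -> fin B -> fin (A `&` B).
Proof.
move=> fA fB; apply: (@sub_finite_set _ _ (bd A `|` bd B)).
  move=> [x y] [/= [Ax Bx] /not_andP[Ay|By] xy]; [by left|by right].
by rewrite finite_setU.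
Qed.

Lemma mu_submodular A B : fin A -> fin B ->
  mu (A `&` B) + mu (~` A `&` ~` B) <= mu A + mu B.
Proof.
move=> fA fB; rewrite -setCU muC; last first.
  by rewrite -[A `|` B]setCK setCU; apply/finC/finI; apply: finC.
apply: ncard_UI => //.
  move=> [x y] [] [/=].
    by move=> [Ax Bx] /not_andP[Ay|By] xy; [left|right].
  by move=> [Ax|Bx] /not_orP[Ay By] xy; [left|right].
by move=> [x y] [[/= [Ax Bx] _ xy] [_ /= /not_orP[Ay By] _]].
Qed.

Lemma bd_nonempty A x y : A x -> ~ A y -> bd A !=set0.
Proof. by move=> Ax Ay; have [a [b [ab Aa Ab]]] := crt_exit (S_gen x y) Ax Ay; exists (a, b). Qed.

Definition bond k A := [/\ conn A, conn (~` A), fin A & mu A <= k].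

(* A bond containing the edges [R] either is the set of vertices joined to one  *)
(* end of the first edge of [R] by paths that avoid [R], or contains an edge of *)
(* a fixed path that avoids [R] and joins the ends of that edge.                *)
Lemma bonds_through k (R : seq (G * G)) : R <> [::] ->
  finite_set [set A | [/\ uniq R, conn A, conn (~` A), fin A &
    (forall e, e \in R -> bd A e) /\ mu A < size R + k]].
Proof.
elim: k R => [|k IH] [//|[x y] R'] _; set R := _ :: R'.
  (* In the induction [R] gains an edge whenever [k] drops by one. At [k = 0] the distinct boundary
     edges in [R] outnumber the boundary. *)
  apply: (@sub_finite_set _ _ set0) => // A [uR _ _ fA [RA]].
  by rewrite addn0 ltnNge ncard_uniq.
pose av a b := [/\ adj a b, (a, b) \notin R & (b, a) \notin R].
have [xy|nxy] := pselect (clos_refl_trans G av x y).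
  have [l [lR lP]] := crt_edges xy.
  apply: (@sub_finite_set _ _ (\bigcup_(e in [set` l])
      [set A | [/\ uniq (e :: R), conn A, conn (~` A), fin A &
        (forall f, f \in (e :: R) -> bd A f) /\ mu A < size (e :: R) + k]])).
    move=> A [uR cA cC fA [RA mA]].
    have [/= Ax Ay _] : bd A (x, y) by apply: RA; rewrite inE eqxx.
    have [[a b] el [/= Aa Ab]] := lP A Ax Ay; have [ab aR bR] := lR _ el.
    exists (a, b) => //; split=> //; first by rewrite /= aR.
    split; last by move: mA => /=; lia.
    by move=> f; rewrite inE => /orP[/eqP ->|/RA].
  by apply: bigcup_finite => [|e _]; [apply: finite_seq|apply: IH].
apply: (@sub_finite_set _ _ [set [set z | clos_refl_trans G av x z]]).
  move=> A [uR cA cC fA [RA mA]] /=.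
  have [/= Ax Ay _] : bd A (x, y) by apply: RA; rewrite inE eqxx.
  apply/seteqP; split=> z /= => [Az|xz].
    apply: crt_mono (cA _ _ Ax Az) => a b [ab Aa Ab]; split=> //.
      by apply/negP => /RA[].
    by apply/negP => /RA[].
  apply: contrapT => Az; apply: nxy; apply: rt_trans xz _.
  apply: crt_mono (cC _ _ Az Ay) => a b [ab Aa Ab]; split=> //.
    by apply/negP => /RA[].
  by apply/negP => /RA[].
exact: finite_set1.
Qed.

Lemma bonds_edge k e : finite_set [set A | bond k A /\ bd A e].
Proof.
apply: sub_finite_set (@bonds_through k [:: e] _) => // A [[cA cC fA mA] Ae].
by split=> //; split=> // f; rewrite inE => /eqP ->.
Qed.

Lemma bonds_separating k x y : finite_set [set A | [/\ bond k A, A x & ~ A y]].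
Proof.
have [l [lR lP]] := crt_edges (S_gen x y).
apply: (@sub_finite_set _ _ (\bigcup_(e in [set` l]) [set A | bond k A /\ bd A e])).
  move=> A [bA Ax Ay]; have [e el [e1 e2]] := lP A Ax Ay.
  by exists e => //; split=> //; split=> //; apply: lR.
by apply: bigcup_finite => [|e _]; [apply: finite_seq|apply: bonds_edge].
Qed.

Definition cross A B := [/\ A `&` B !=set0, A `&` ~` B !=set0,
  ~` A `&` B !=set0 & ~` A `&` ~` B !=set0].

Lemma cross_sym A B : cross A B -> cross B A.
Proof. by move=> [h1 h2 h3 h4]; split; rewrite setIC. Qed.

Lemma crossCl A B : cross A B -> cross (~` A) B.
Proof. by move=> [h1 h2 h3 h4]; split; rewrite ?setCK. Qed.

Lemma crossCr A B : cross A B -> cross A (~` B).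
Proof. by move=> /cross_sym/crossCl/cross_sym. Qed.

Lemma nested_cases A B : ~ cross A B ->
  [\/ A `<=` B, A `<=` ~` B, ~` A `<=` B | ~` A `<=` ~` B].
Proof.
have sub C D : ~ (C `&` ~` D !=set0) -> C `<=` D.
  by move=> h x Cx; apply: contrapT => Dx; apply: h; exists x.
move=> nc; have [h1|/sub h1] := pselect (A `&` ~` B !=set0); last by constructor 1.
have [h2|h2] := pselect (A `&` B !=set0); last first.
  by constructor 2; apply: sub; rewrite setCK.
have [h3|/sub h3] := pselect (~` A `&` ~` B !=set0); last by constructor 3.
by constructor 4; apply: sub; rewrite setCK => h4; apply: nc; split.
Qed.

(** [B] is connected and meets both sides of [A], so it contains an endpoint of a boundary edge of
    [A]; so does its complement. Hence [B] separates two of finitely many vertices, and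
    [bonds_separating] applies. *)
Lemma crossing_finite k A : fin A -> finite_set [set B | bond k B /\ cross A B].
Proof.
move=> fA; apply: (@sub_finite_set _ _ (\bigcup_(e in bd A `*` bd A)
    [set B | [/\ bond k B, B e.1.1 & ~ B e.2.1]])).
  move=> B [bB [[u [Au Bu]] [u' [Au' Bu']] [v [Av Bv]] [v' [Av' Bv']]]].
  have [cB cC _ _] := bB.
  have [a [b [[ab Ba Bb] Aa Ab]]] := crt_exit (cB _ _ Bu Bv) Au Av.
  have [a' [b' [[ab' Ba' Bb'] Aa' Ab']]] := crt_exit (cC _ _ Bu' Bv') Au' Av'.
  by exists ((a, b), (a', b')).
by apply: bigcup_finite => [|e _]; [apply: finite_setX|apply: bonds_separating].
Qed.

Definition tr h A : set G := [set z | A (h^-1 * z)].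

Lemma trM g h A : tr g (tr h A) = tr (g * h) A.
Proof. by apply/seteqP; split=> z; rewrite /tr /= invgM mulgA. Qed.
Lemma tr1 A : tr 1 A = A.
Proof. by apply/seteqP; split=> z; rewrite /tr /= invg1 mul1g. Qed.
Lemma trK h A : tr h^-1 (tr h A) = A.
Proof. by rewrite trM mulVg tr1. Qed.
Lemma trKV h A : tr h (tr h^-1 A) = A.
Proof. by rewrite trM mulgV tr1. Qed.
Lemma trC h A : tr h (~` A) = ~` tr h A. Proof. by []. Qed.
Lemma tr_inj h : injective (tr h).
Proof. exact: can_inj (trK h). Qed.
Lemma tr_sub h A B : A `<=` B -> tr h A `<=` tr h B.
Proof. by move=> AB z /AB. Qed.
Lemma tr_subE h A B : (tr h A `<=` tr h B) <-> (A `<=` B).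
Proof. by split=> [/(@tr_sub h^-1)|/tr_sub//]; rewrite !trK. Qed.

Lemma bd_tr h A : bd (tr h A) = (fun e => (h * e.1, h * e.2)) @` bd A.
Proof.
apply/seteqP; split=> [[x y] [/= Ax Ay xy]|_ [[x y] [/= Ax Ay xy] <-]].
  exists (h^-1 * x, h^-1 * y) => /=; last by rewrite !mulVKg.
  by split=> //=; rewrite adj_mull.
by split; rewrite /tr /= ?mulKg// adj_mull.
Qed.

Lemma fin_tr h A : fin A -> fin (tr h A).
Proof. by rewrite /fin bd_tr; apply: finite_image. Qed.

Lemma mu_tr h A : fin A -> mu (tr h A) = mu A.
Proof.
by move=> fA; rewrite /mu bd_tr ncard_inj// => -[x y] [x' y'] [/mulgI -> /mulgI ->].
Qed.

Lemma cross_tr h A B : cross A B -> cross (tr h A) (tr h B).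
Proof.
by move=> [[a ha] [b hb] [c hc] [d hd]]; split;
  [exists (h * a)|exists (h * b)|exists (h * c)|exists (h * d)];
  rewrite /tr /setI /setC /= mulKg.
Qed.

(** The ray [x * g ^+ n] finally stays in [A]. A pair [p = (x, g)] stands for the line through [x]
    with these points; [sep A p] says that [A] separates its two ends, and [hasE A p] that [A]
    contains at least one of them. *)
Definition ev A x g := exists N, forall n, N <= n -> A (x * g ^+ n).
Definition sep A p := (ev A p.1 p.2 /\ ev (~` A) p.1 p.2^-1) \/
  (ev (~` A) p.1 p.2 /\ ev A p.1 p.2^-1).
Definition hasE A p := ev A p.1 p.2 \/ ev A p.1 p.2^-1.

Lemma ev_sub A B x g : A `<=` B -> ev A x g -> ev B x g.
Proof. by move=> AB [N h]; exists N => n /h/AB. Qed.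

Lemma evI A B x g : ev A x g -> ev B x g -> ev (A `&` B) x g.
Proof.
by move=> [N h] [M k]; exists (maxn N M) => n; rewrite geq_max => /andP[/h ? /k].
Qed.

Lemma ev_setC A x g : ev A x g -> ev (~` A) x g -> False.
Proof. by move=> h /(evI h)[N /(_ N (leqnn _))[]]. Qed.

Lemma ev_tr h A x g : ev A x g -> ev (tr h A) (h * x) g.
Proof. by move=> [N k]; exists N => n /k; rewrite /tr /= -mulgA mulKg. Qed.

Lemma ev_shift A x g : ev A x g -> ev (tr (x * g * x^-1) A) x g.
Proof.
move=> [N k]; exists N.+1 => -[//|n] /k; rewrite /tr /= !invgM invgK -!mulgA mulKg.
by rewrite expgS mulKg.
Qed.

Lemma ev_nonempty A x g : ev A x g -> A !=set0.
Proof. by case=> N /(_ N (leqnn _)); exists (x * g ^+ N). Qed.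

Lemma sepC A p : sep A p -> sep (~` A) p.
Proof. by rewrite /sep setCK; tauto. Qed.

Lemma sep_tr h A p : sep A p -> sep (tr h A) (h * p.1, p.2).
Proof. by case=> -[h1 h2]; [left|right]; split=> /=; rewrite -?trC; apply: ev_tr. Qed.

Lemma sep_sub A B p : sep A p -> B `<=` A -> hasE B p -> sep B p.
Proof.
move=> s BA; have CA : ~` A `<=` ~` B by apply: subsetC.
by case: s => -[h1 h2] [h3|h3];
  [left; split=> //; exact: ev_sub h2|case: (ev_setC (ev_sub BA h3) h2)
  |case: (ev_setC (ev_sub BA h3) h1)|right; split=> //; exact: ev_sub h1].
Qed.

Lemma sep_hasE A p : sep A p -> hasE A p.
Proof. by case=> -[]; [left|right]. Qed.

Lemma sep_proper A p : sep A p -> A !=set0 /\ ~` A !=set0.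
Proof. by case=> -[/ev_nonempty ? /ev_nonempty]. Qed.

Lemma almost_right_invariant A g : fin A -> finite_set [set x | A x /\ ~ A (x * g)].
Proof.
move=> fA; have : clos_refl_trans G adj 1 g by [].
move=> /(@clos_rt_rtn1 _ _ _ _); elim=> [|y z yz _ IH].
  by apply: (@sub_finite_set _ _ set0) => // x []; rewrite mulg1.
apply: (@sub_finite_set _ _ ([set x | A x /\ ~ A (x * y)] `|`
    (fun x => x * y) @^-1` (fst @` bd A))).
  move=> x [Ax Axz]; have [Ay|Ay] := pselect (A (x * y)); last by left.
  by right; exists (x * y, x * z) => //; split=> //=; rewrite adj_mull.
rewrite finite_setU; split=> //; apply: finite_preimage; last exact: finite_image.
by move=> a b _ _ /mulIg.
Qed.

Lemma expg_inj g : ~ torsion g -> injective (fun n => g ^+ n).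
Proof.
move=> ng m n e; wlog mn : m n e / m <= n.
  by move=> w; case: (leqP m n) => [|/ltnW] /w ->.
apply/eqP; rewrite eqn_leq mn leqNgt; apply/negP => lt; apply: ng.
by exists (n - m)%N; rewrite ?subn_gt0// expgnFr// e mulgV.
Qed.

(** The powers of [g] are distinct, and [A] differs from its right translate by [g] in finitely many
    points, so the ray changes sides only finitely often. *)
Lemma ev_dec A x g : fin A -> ~ torsion g -> ev A x g \/ ev (~` A) x g.
Proof.
move=> fA ng.
have bnd B : fin B -> exists N, forall n, B (x * g ^+ n) -> ~ B (x * g ^+ n.+1) -> n < N.
  move=> fB; have fp : finite_set ((fun n => x * g ^+ n) @^-1` [set y | B y /\ ~ B (y * g)]).
    apply: finite_preimage; last exact: almost_right_invariant.
    by move=> m n _ _ /mulgI/(expg_inj ng).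
  have [N NP] := finite_nat_bound fp; exists N => n h1 h2; apply: NP.
  by split=> //; rewrite -mulgA -expgSr.
have [N NP] := bnd _ fA; have [M MP] := bnd _ (finC fA).
pose L := maxn N M; have [AL|AL] := pselect (A (x * g ^+ L)); [left|right]; exists L.
  move=> n; elim: n => [|n IH]; first by rewrite leqn0 => /eqP <-.
  rewrite leq_eqVlt => /orP[/eqP <-//|Ln]; apply: contrapT => nA.
  by have := NP _ (IH Ln) nA; rewrite ltnNge (leq_trans (leq_maxl _ _) Ln).
move=> n; elim: n => [|n IH]; first by rewrite leqn0 => /eqP <-.
rewrite leq_eqVlt => /orP[/eqP <-//|Ln] nA.
have := MP _ (IH Ln); rewrite /setC /= => /(_ (fun k => k nA)).
by rewrite ltnNge (leq_trans (leq_maxr _ _) Ln).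
Qed.

(** The bound has to be uniform in [x] and [g]: it is what leaves only finitely many orbits of cuts.
    In the application it is the boundary size of cones. *)
Variable k0 : nat.
Hypothesis small_cuts : forall x g, ~ torsion g ->
  exists A, [/\ fin A, sep A (x, g) & mu A <= k0].

Definition minsep A p := [/\ fin A, sep A p &
  forall B, fin B -> sep B p -> mu A <= mu B].

Lemma minsep_exists p : ~ torsion p.2 -> exists A, minsep A p.
Proof.
case: p => x g /= ng; have [n [A [fA sA <-]] nmin] := @min_nat
  (fun n => exists A, [/\ fin A, sep A (x, g) & mu A = n]) (
  let: ex_intro A (And3 fA sA _) := small_cuts x ng in
  ex_intro _ (mu A) (ex_intro _ A (And3 fA sA erefl))).
by exists A; split=> // B fB sB; apply: nmin; exists B.
Qed.

Lemma minsep_mu A p : ~ torsion p.2 -> minsep A p -> mu A <= k0.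
Proof.
case: p => x g /= /(small_cuts x)[B [fB sB kB]] [_ _ /(_ B fB sB)].
by move=> /leq_trans -> .
Qed.

Lemma minsepC A p : minsep A p -> minsep (~` A) p.
Proof.
by move=> [fA sA mA]; split; [exact: finC|exact: sepC|rewrite muC].
Qed.

Lemma minsep_tr h A p : minsep A p -> minsep (tr h A) (h * p.1, p.2).
Proof.
move=> [fA sA mA]; split; [exact: fin_tr|exact: sep_tr|].
move=> B fB /(@sep_tr h^-1) /=; rewrite mulKg -surjective_pairing => sB.
by rewrite mu_tr// -(mu_tr h^-1 fB); apply: mA => //; apply: fin_tr.
Qed.

(* Otherwise one of the two parts of [A] would be a smaller separator. *)
Lemma minsep_conn A p : ~ torsion p.2 -> minsep A p -> conn A.
Proof.
move=> np [fA sA mA] x y Ax Ay; apply: contrapT => nxy.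
pose R := fun a b => [/\ adj a b, A a & A b].
pose A1 := [set z | A z /\ clos_refl_trans G R x z].
pose A2 := [set z | A z /\ ~ clos_refl_trans G R x z].
have A1A : A1 `<=` A by move=> z [].
have A2A : A2 `<=` A by move=> z [].
have bd1 : bd A1 `<=` bd A.
  move=> [a b] [/= [Aa xa] Ab ab]; split=> //= Ab'; apply: Ab; split=> //.
  by apply: rt_trans xa (rt_step _ _ _ _ _).
have bd2 : bd A2 `<=` bd A.
  move=> [a b] [/= [Aa xa] Ab ab]; split=> //= Ab'; apply: Ab; split=> // xb.
  by apply: xa; apply: rt_trans xb (rt_step _ _ _ _ _); split=> //; apply: adj_sym.
have f1 : fin A1 := sub_finite_set bd1 fA.
have f2 : fin A2 := sub_finite_set bd2 fA.
have mu12 : mu A1 + mu A2 <= mu A.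
  rewrite -ncard_disj//; last first.
    by apply/seteqP; split=> [[a b] [[/= [_ h1] _ _] [/= [_ h2] _ _]]|].
  by apply: ncard_sub => // e [/bd1|/bd2].
have mpos B a b : fin B -> B a -> ~ B b -> 0 < mu B.
  move=> fB Ba Bb; rewrite lt0n; apply/eqP => /(ncard_set0 fB) e.
  by have [c] := bd_nonempty Ba Bb; rewrite e.
have A1x : A1 x by split=> //; apply: rt_refl.
have A2y : A2 y by [].
have m1 : 0 < mu A1 by apply: (mpos A1 x y) => // -[].
have m2 : 0 < mu A2.
  by apply: (mpos A2 y x) => // -[_]; apply; apply: rt_refl.
have [h|h] : hasE A1 p \/ hasE A2 p.
  have split_ev g : ~ torsion g -> ev A p.1 g -> ev A1 p.1 g \/ ev A2 p.1 g.
    move=> ng eA; have [|h] := ev_dec p.1 f1 ng; [by left|right].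
    apply: ev_sub (evI eA h) => z [Az /not_andP[|nz]] //.
  have npV : ~ torsion p.2^-1 by move=> /torsionV.
  by case: (sep_hasE sA) => [/(split_ev _ np)|/(split_ev _ npV)] [h|h];
    [left; left|right; left|left; right|right; right].
- by have := mA _ f1 (sep_sub sA A1A h); lia.
- by have := mA _ f2 (sep_sub sA A2A h); lia.
Qed.

Definition mincut A := exists2 p, ~ torsion p.2 & minsep A p.

Lemma mincut_tr h A : mincut A -> mincut (tr h A).
Proof. by move=> [p np mA]; exists (h * p.1, p.2) => //; apply: minsep_tr. Qed.

Lemma mincut_bond A : mincut A -> bond k0 A.
Proof.
move=> [p np mA]; split; first exact: minsep_conn mA.
- exact: minsep_conn (minsepC mA).
- by case: mA.
- exact: minsep_mu mA.
Qed.

Definition crossers A := [set B | mincut B /\ cross A B].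
Definition ncross A := ncard (crossers A).

Lemma crossers_finite A : fin A -> finite_set (crossers A).
Proof.
by move=> fA; apply: sub_finite_set (crossing_finite k0 fA) => B [/mincut_bond].
Qed.

Lemma crossersC A : crossers (~` A) = crossers A.
Proof.
by apply/seteqP; split=> B [mB cB]; split=> //; have := crossCl cB; rewrite ?setCK.
Qed.

Lemma ncross_tr h A : fin A -> ncross (tr h A) = ncross A.
Proof.
move=> fA; rewrite /ncross -(ncard_inj (@tr_inj h) (crossers_finite fA)).
congr ncard; apply/seteqP; split=> [B [mB cB]|_ [B [mB cB] <-]].
  exists (tr h^-1 B); last by rewrite trKV.
  by split; [exact: mincut_tr|rewrite -(trK h A); exact: cross_tr].
by split; [exact: mincut_tr|exact: cross_tr].
Qed.

Lemma corner_nested A B D : cross A B -> ~ cross A D -> ~ cross B D ->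
  ~ cross (A `&` B) D.
Proof.
move=> [_ _ _ [z [nAz nBz]]] nA nB [[a [[Aa Ba] Da]] [b [[Ab Bb] Db]] [c [Xc Dc]] [d [Xd Dd]]].
have [h|h|hA|hA] := nested_cases nA; [by have := h _ Ab|by have := h _ Aa|..];
  (have [h|h|hB|hB] := nested_cases nB; [by have := h _ Bb|by have := h _ Ba|..]).
- by apply: Xd; split; apply: contrapT; [move=> /hA|move=> /hB].
- by have := hB _ nBz; apply; apply: hA.
- by have := hA _ nAz; apply; apply: hB.
- by apply: Xc; split; apply: contrapT; [move=> /hA|move=> /hB].
Qed.

Lemma corner_both A B D : cross (A `&` B) D -> cross (~` A `&` ~` B) D -> cross A D.
Proof.
move=> [[a [[Aa _] Da]] [b [[Ab _] Db]] _ _] [[c [[Ac _] Dc]] [d [[Ad _] Dd]] _ _].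
by split; [exists a|exists b|exists c|exists d].
Qed.

(** A cut crossing one corner crosses [A] or [B], and one crossing both opposite corners crosses
    both [A] and [B]. The inequality is strict because [A] crosses [B] but contains one corner and
    is disjoint from the other. *)
Lemma corner_crossers A B : mincut A -> mincut B -> cross A B ->
  ncross (A `&` B) + ncross (~` A `&` ~` B) < ncross A + ncross B.
Proof.
move=> mA mB cAB; have [_ _ fA _] := mincut_bond mA; have [_ _ fB _] := mincut_bond mB.
have cCC : cross (~` A) (~` B) by apply/crossCl/crossCr.
apply: (@ncard_UI_lt _ _ _ _ _ A); try exact: crossers_finite.
- move=> D [[mD cD]|[mD cD]]; apply: contrapT => /not_orP[hA hB].
    by apply: corner_nested cD => // c; [apply: hA|apply: hB].
  by apply: corner_nested cD => // c; [apply: hA|apply: hB];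
    split=> //; have := crossCl c; rewrite setCK.
- move=> D [[mD c1] [_ c2]]; split; split=> //; first exact: corner_both c1 c2.
  by apply: corner_both; rewrite setIC; [exact: c1|exact: c2].
- by right; split=> //; apply: cross_sym.
- by case=> -[_ [h1 h2 _ _]]; [case: h2 => x [[]]|case: h1 => x [[]]].
Qed.

Definition optcut A p := minsep A p /\ forall B, minsep B p -> ncross A <= ncross B.
Definition cut A := exists2 p, ~ torsion p.2 & optcut A p.

Lemma optcut_exists p : ~ torsion p.2 -> exists A, optcut A p.
Proof.
move=> np; have [A0 mA0] := minsep_exists np.
have [n [A mA <-] nmin] := @min_nat
  (fun n => exists2 A, minsep A p & ncross A = n)
  (ex_intro _ (ncross A0) (ex_intro2 _ _ A0 mA0 erefl)).
by exists A; split=> // B mB; apply: nmin; exists B.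
Qed.

Lemma ncrossC A : ncross (~` A) = ncross A.
Proof. by rewrite /ncross crossersC. Qed.

Lemma optcutC A p : optcut A p -> optcut (~` A) p.
Proof. by move=> [mA oA]; split; [exact: minsepC|rewrite ncrossC]. Qed.

Lemma optcut_tr h A p : optcut A p -> optcut (tr h A) (h * p.1, p.2).
Proof.
move=> [mA oA]; split; first exact: minsep_tr.
move=> B /(@minsep_tr h^-1) /=; rewrite mulKg -surjective_pairing => mB.
have [fA _ _] := mA; have [fB _ _] := mB.
by rewrite (ncross_tr h fA) -[B](trKV h) (ncross_tr h fB); apply: oA.
Qed.

(** If [A] and [B] crossed, the corner in [A] would still separate the ends of [p], and the opposite
    one those of [q]. By submodularity both corners would be minimal, and by [corner_crossers] one
    of them would be crossed by fewer minimal cuts than [A] or [B]. *)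
Lemma optcut_corner A B p q : ~ torsion p.2 -> ~ torsion q.2 ->
  optcut A p -> optcut B q ->
  hasE (A `&` B) p -> hasE (~` A `&` ~` B) q -> ~ cross A B.
Proof.
move=> np nq [mA oA] [mB oB] hp hq cAB.
have [fA sA minA] := mA; have [fB sB minB] := mB.
have fX : fin (A `&` B) by apply: finI.
have fY : fin (~` A `&` ~` B) by apply: finI; apply: finC.
have sX : sep (A `&` B) p by apply: (sep_sub sA _ hp) => x [].
have sY : sep (~` A `&` ~` B) q by apply: (sep_sub (sepC sB) _ hq) => x [].
have := mu_submodular fA fB; have := minA _ fX sX; have := minB _ fY sY => h1 h2 h3.
have mX : minsep (A `&` B) p.
  by split=> // C fC sC; apply: leq_trans (minA C fC sC); lia.
have mY : minsep (~` A `&` ~` B) q.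
  by split=> // C fC sC; apply: leq_trans (minB C fC sC); lia.
have := oA _ mX; have := oB _ mY.
have := @corner_crossers A B (ex_intro2 _ _ p np mA) (ex_intro2 _ _ q nq mB) cAB.
lia.
Qed.

Lemma sep_ends A p : sep A p ->
  exists g, [/\ g = p.2 \/ g = p.2^-1, ev A p.1 g & ev (~` A) p.1 g^-1].
Proof. by case=> -[h1 h2]; [exists p.2|exists p.2^-1]; split; rewrite ?invgK; tauto. Qed.

Lemma optcut_nested A B p q : ~ torsion p.2 -> ~ torsion q.2 ->
  optcut A p -> optcut B q -> ~ cross A B.
Proof.
move=> np nq oA oB cAB; have [[fA sA minA] opA] := oA; have [[fB sB minB] opB] := oB.
have [g [eg gA gnA]] := sep_ends sA; have [k [ek kB knB]] := sep_ends sB.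
have hasE_p C : ev C p.1 g \/ ev C p.1 g^-1 -> hasE C p.
  by rewrite /hasE; case: eg => ->; rewrite ?invgK; tauto.
have hasE_q C : ev C q.1 k \/ ev C q.1 k^-1 -> hasE C q.
  by rewrite /hasE; case: ek => ->; rewrite ?invgK; tauto.
have ng : ~ torsion g by case: eg => -> // /torsionV.
have nk : ~ torsion k by case: ek => -> // /torsionV.
have ngV : ~ torsion g^-1 by move=> /torsionV.
have nkV : ~ torsion k^-1 by move=> /torsionV.
have oAC := optcutC oA; have oBC := optcutC oB.
have c01 : cross (~` A) B by apply: crossCl.
have c10 : cross A (~` B) by apply: crossCr.
have c11 : cross (~` A) (~` B) by apply/crossCl/crossCr.
(* Orient [p] and [q] so that [A] contains the end of [g] and [B] that of [k]. [H1] to [H4] are the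
   four ways in which opposite corners can hold an end of [p] and an end of [q]. *)
have H1 : ev B p.1 g -> ev (~` A) q.1 k^-1 -> False.
  move=> h1 h2; apply: (optcut_corner np nq oA oB) cAB; last first.
    by apply: hasE_q; right; apply: evI.
  by apply: hasE_p; left; apply: evI.
have H2 : ev (~` B) p.1 g -> ev (~` A) q.1 k -> False.
  move=> h1 h2; apply: (optcut_corner np nq oA oBC) c10; last first.
    by apply: hasE_q; left; rewrite setCK; apply: evI.
  by apply: hasE_p; left; apply: evI.
have H3 : ev B p.1 g^-1 -> ev A q.1 k^-1 -> False.
  move=> h1 h2; apply: (optcut_corner np nq oAC oB) c01; last first.
    by apply: hasE_q; right; rewrite setCK; apply: evI.
  by apply: hasE_p; right; apply: evI.
have H4 : ev (~` B) p.1 g^-1 -> ev A q.1 k -> False.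
  move=> h1 h2; apply: (optcut_corner np nq oAC oBC) c11; last first.
    by apply: hasE_q; left; rewrite !setCK; apply: evI.
  by apply: hasE_p; right; apply: evI.
(* In the two configurations left over, each of [A] and [B] separates both pairs. Their boundaries
   then have equal size and [A] is optimal for [q] as well, so the two ends of [q] alone occupy
   opposite corners. *)
have both : sep B p -> sep A q -> optcut A q.
  move=> sBp sAq; have e : mu A = mu B.
    by apply/eqP; rewrite eqn_leq minA// minB.
  have mAq : minsep A q by split=> // C fC sC; rewrite e minB.
  have mBp : minsep B p by split=> // C fC sC; rewrite -e minA.
  by split=> // C mC; apply: leq_trans (opA _ mBp) (opB _ mC).
have seps C r f : ev C r.1 f -> ev (~` C) r.1 f^-1 ->
    f = r.2 \/ f = r.2^-1 -> sep C r.
  by move=> h1 h2 [] e; rewrite /sep; move: h1 h2; rewrite e ?invgK; tauto.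
have H5 : ev B p.1 g -> ev (~` B) p.1 g^-1 -> ev (~` A) q.1 k -> ev A q.1 k^-1 -> False.
  move=> h1 h2 h3 h4; have sBp : sep B p by apply: seps eg.
  have sAq : sep A q by rewrite -(setCK A); apply/sepC/seps; rewrite ?setCK; eassumption.
  have oAq := optcutC (both sBp sAq).
  apply: (optcut_corner nq nq oAq oB) c01; apply: hasE_q.
    by left; apply: evI.
  by right; rewrite setCK; apply: evI.
have H6 : ev (~` B) p.1 g -> ev B p.1 g^-1 -> ev A q.1 k -> ev (~` A) q.1 k^-1 -> False.
  move=> h1 h2 h3 h4; have sAq : sep A q by apply: seps ek.
  have sBp : sep B p by rewrite -(setCK B); apply/sepC/seps; rewrite ?setCK; eassumption.
  apply: (optcut_corner nq nq (both sBp sAq) oB) cAB; apply: hasE_q.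
    by left; apply: evI.
  by right; apply: evI.
have [gB|gB] := ev_dec p.1 fB ng; have [gB'|gB'] := ev_dec p.1 fB ngV;
have [kA|kA] := ev_dec q.1 fA nk; have [kA'|kA'] := ev_dec q.1 fA nkV; tauto.
Qed.

Lemma cut_nested A B : cut A -> cut B -> ~ cross A B.
Proof. by move=> [p np oA] [q nq oB]; apply: optcut_nested oA oB. Qed.

Lemma cutC A : cut A -> cut (~` A).
Proof. by move=> [p np oA]; exists p => //; apply: optcutC. Qed.

Lemma cut_tr h A : cut A -> cut (tr h A).
Proof. by move=> [p np oA]; exists (h * p.1, p.2) => //; apply: optcut_tr. Qed.

Lemma cut_bond A : cut A -> bond k0 A.
Proof. by move=> [p np [mA _]]; apply: mincut_bond; exists p. Qed.

Lemma cut_proper A : cut A -> A !=set0 /\ ~` A !=set0.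
Proof. by move=> [p _ [[_ /sep_proper]]]. Qed.

Lemma cut_sep x g : ~ torsion g -> exists2 A, cut A & sep A (x, g).
Proof.
move=> ng; have [A oA] := @optcut_exists (x, g) ng.
by exists A; [exists (x, g)|case: oA => -[]].
Qed.

Lemma cut_discrete x y : finite_set [set A | [/\ cut A, A x & ~ A y]].
Proof.
by apply: sub_finite_set (bonds_separating k0 x y) => A [/cut_bond bA Ax Ay].
Qed.

(** A boundary edge can be translated to start at 1; there are finitely many such edges and finitely
    many bonds through each. *)
Lemma cut_orbits : exists2 L : set (set G), finite_set L &
  forall A, cut A -> exists h, L (tr h A).
Proof.
exists (\bigcup_(s in [set` S]) [set A | bond k0 A /\ bd A (1, s)]).
  by apply: bigcup_finite => [|e _]; [apply: finite_seq|apply: bonds_edge].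
move=> A cA; have [[x Ax] [y Ay]] := cut_proper cA.
have [[a b] [/= Aa Ab ab]] := bd_nonempty Ax Ay.
exists a^-1, (a^-1 * b) => //; split; first by apply/cut_bond/cut_tr.
by rewrite bd_tr; exists (a, b) => //=; rewrite mulVg.
Qed.

End Cuts.

(** * The tree dual to a nested family of cuts *)

Section NestedFamily.
Variables (G : groupType) (N : set (set G)).
Local Open Scope group_scope.
Local Open Scope classical_set_scope.
Implicit Types (A B C : set G) (o : set (set G)) (g h x y : G).

Hypothesis N_C : forall A, N A -> N (~` A).
Hypothesis N_tr : forall h A, N A -> N (tr h A).
Hypothesis N_nested : forall A B, N A -> N B -> ~ cross A B.
Hypothesis N_proper : forall A, N A -> A !=set0 /\ ~` A !=set0.
Hypothesis N_discrete : forall x y, finite_set [set A | [/\ N A, A x & ~ A y]].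

(* Vertices of the tree dual to [N]: consistent choices of one side of each cut *)
(* that differ from the choice given by [1] for finitely many cuts only.        *)
Record vertex o : Prop := Vertex {
  vertex_sub : o `<=` N;
  vertex_or : forall A, N A -> o A \/ o (~` A);
  vertex_excl : forall A, o A -> ~ o (~` A);
  vertex_up : forall A B, o A -> N B -> A `<=` B -> o B;
  vertex_fin : finite_set [set A | o A /\ ~ A 1] }.

Lemma vertex_eq o o' : vertex o -> vertex o' -> o `<=` o' -> o = o'.
Proof.
move=> vo vo' oo'; apply/seteqP; split=> // A o'A.
have [//|/oo' h] := vertex_or vo (vertex_sub vo' o'A).
by case: (vertex_excl vo' o'A h).
Qed.

Definition v1 : set (set G) := [set A | N A /\ A 1].

Lemma vertex_v1 : vertex v1.
Proof.
split=> [A []//|A NA|A [_ A1] [_]//|A B [_ A1] NB AB|].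
- by have [A1|A1] := pselect (A 1); [left|right; split=> //; apply: N_C].
- by split=> //; apply: AB.
- by apply: (@sub_finite_set _ _ set0) => // A [[]].
Qed.

(* The vertex at the end of the edge [A], oriented towards the side [A]. *)
Definition tov A : set (set G) :=
  [set B | N B /\ (A `<=` B \/ (~` A `<=` B /\ B <> ~` A))].

Lemma tov_self A : N A -> tov A A.
Proof. by move=> NA; split=> //; left. Qed.

Lemma vertex_tov A : N A -> vertex (tov A).
Proof.
move=> NA; have [[a Aa] [a' Aa']] := N_proper NA; split.
- by move=> B [].
- move=> B NB; have NCB := N_C NB.
  have [h|h|h|h] := nested_cases (N_nested NA NB).
  + by left; split=> //; left.
  + by right; split=> //; left.
  + have [e|ne] := pselect (B = ~` A); last by left; split=> //; right.
    by right; split=> //; left; rewrite e setCK.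
  + have [e|ne] := pselect (~` B = ~` A); last by right; split=> //; right.
    by left; split=> //; left; rewrite -(setCK A) -e setCK.
- move=> B [NB h] [_ h']; case: h h' => [h|[h ne]] [h'|[h' ne']].
  + by have := h' a Aa; apply; apply: h.
  + by apply: ne'; apply/seteqP; split=> // x Bx /h.
  + by apply: ne; apply/seteqP; split=> // x Bx /h'.
  + by have := h' a' Aa'; apply; apply: h.
- move=> B C [NB h] NC BC; split=> //; case: h => [h|[h ne]]; [left|right].
    exact: subset_trans BC.
  split; first exact: subset_trans BC.
  by move=> e; apply: ne; apply/seteqP; split=> //; rewrite -e.
- apply: (@sub_finite_set _ _ ([set B | [/\ N B, B a & ~ B 1]] `|`
     [set B | [/\ N B, B a' & ~ B 1]])).
    by move=> B [[NB [h|[h _]]] B1]; [left|right]; split=> //; apply: h.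
  by rewrite finite_setU; split; apply: N_discrete.
Qed.

Lemma tov_flip A B : N A -> tov (~` A) B -> B = ~` A \/ tov A B.
Proof.
move=> NA [NB]; rewrite setCK => h.
have [e|ne] := pselect (B = ~` A); [by left|right; split=> //].
by case: h => [h|[h _]]; [right|left].
Qed.

Definition diffv o o' := [set C | o' C /\ ~ o C].

Lemma diffv_finite o o' : vertex o -> vertex o' -> finite_set (diffv o o').
Proof.
move=> vo vo'; apply: (@sub_finite_set _ _ ([set A | o' A /\ ~ A 1] `|`
   setC @` [set A | o A /\ ~ A 1])).
  move=> C [o'C oC]; have [C1|C1] := pselect (C 1); [right|by left].
  exists (~` C); last by rewrite setCK.
  by split=> //; have [] := vertex_or vo (vertex_sub vo' o'C).
rewrite finite_setU; split; first exact: vertex_fin vo'.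
by apply: finite_image; apply: vertex_fin vo.
Qed.

Lemma maximal_exists (D : set (set G)) C0 : finite_set D -> D C0 ->
  exists2 C, D C & forall X, D X -> C `<=` X -> X = C.
Proof.
move=> fD DC0; pose up C := [set X | D X /\ C `<=` X].
have fup C : finite_set (up C) by apply: sub_finite_set fD => X [].
have [n [C DC <-] nmin] := @min_nat (fun n => exists2 C, D C & ncard (up C) = n)
  (ex_intro _ _ (ex_intro2 _ _ C0 DC0 erefl)).
exists C => // X DX CX; apply: contrapT => XC.
have := nmin _ (ex_intro2 _ _ X DX erefl); rewrite leqNgt => /negP; apply.
have sub : C |` up X `<=` up C.
  by move=> Y [->|[DY XY]]; split=> //; apply: subset_trans XY.
apply: leq_trans (ncard_sub (fup C) sub).
by rewrite ncard_setU1// => -[_ XC']; apply: XC; exact/seteqP.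
Qed.

(** Among the cuts that lie in [o'] but not in [o], a maximal one is the first edge on the way from
    [o] to [o']. *)
Lemma flip_edge o o' C : vertex o -> vertex o' -> diffv o o' C ->
  (forall X, diffv o o' X -> C `<=` X -> X = C) -> o = tov (~` C).
Proof.
move=> vo vo' [o'C oC] maxC; have NC := vertex_sub vo' o'C.
apply: vertex_eq => //; first exact/vertex_tov/N_C.
move=> B oB; have NB := vertex_sub vo oB; split=> //.
have [h|h|h|h] := nested_cases (N_nested NB NC).
- by case: oC; apply: vertex_up oB NC h.
- left; have o'B : o' (~` B) by apply: (vertex_up vo' o'C (N_C NB)); apply: subsetCr.
  rewrite -(maxC (~` B)) ?setCK//; last by apply: subsetCr.
  by split=> // /(vertex_excl vo oB).
- by left; apply: subsetCl.
- right; rewrite setCK; split; first by rewrite -(setCK C) -(setCK B); apply: subsetC.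
  by move=> e; apply: oC; rewrite -e.
Qed.

Fixpoint path o (p : seq (set G)) o' : Prop :=
  match p with
  | [::] => o = o'
  | A :: p' => [/\ N A, tov (~` A) = o & path (tov A) p' o']
  end.

Lemma path_cat o p q o' o'' : path o p o' -> path o' q o'' -> path o (p ++ q) o''.
Proof. by elim: p o => [|A p IH] o /= => [->//|[NA e /IH h] /h]. Qed.

Definition rpath (p : seq (set G)) := rev (map setC p).

Lemma path_rev o p o' : path o p o' -> path o' (rpath p) o.
Proof.
elim: p o => [|A p IH] o /= => [->//|[NA e /IH h]].
rewrite /rpath map_cons rev_cons -cats1; apply: path_cat h _ => /=.
by split; [exact: N_C|rewrite setCK|].
Qed.

(** Connectedness of the tree, by induction on the number of cuts oriented differently by [o] and
    [o']: crossing the edge given by [flip_edge] removes it from the difference and adds none. *)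
Lemma path_exists o o' : vertex o -> vertex o' -> exists p, path o p o'.
Proof.
move=> vo vo'; have [n] := ubnP (ncard (diffv o o')).
elim: n o vo => // n IH o vo lt; have fD := diffv_finite vo vo'.
have [[C0 DC0]|no] := pselect (diffv o o' !=set0); last first.
  exists [::]; apply/esym/vertex_eq => // C o'C; apply: contrapT => oC.
  by apply: no; exists C.
have [C DC maxC] := maximal_exists fD DC0.
have eo := flip_edge vo vo' DC maxC; have [o'C oC] := DC.
have NC := vertex_sub vo' o'C.
have [|p pp] := IH (tov C) (vertex_tov NC); last by exists (C :: p).
rewrite ltnS in lt; apply: leq_trans lt.
have sub : C |` diffv (tov C) o' `<=` diffv o o'.
  move=> X [->//|[o'X tX]]; split=> // oX; move: oX; rewrite eo.
  by case/(tov_flip NC) => // e; apply: (vertex_excl vo' o'C); rewrite -e.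
apply: leq_trans (ncard_sub fD sub).
have fD' : finite_set (diffv (tov C) o') by apply: diffv_finite => //; apply: vertex_tov.
by rewrite ncard_setU1// => -[_]; case; apply: tov_self.
Qed.

Fixpoint reduced (p : seq (set G)) : Prop :=
  match p with
  | A :: p' => (if p' is B :: _ then B <> ~` A else True) /\ reduced p'
  | [::] => True
  end.

(** Consecutive edges that do not backtrack have nested sides, so the sides shrink along the
    path. *)
Lemma path_decreasing A o p o' : path o (A :: p) o' -> reduced (A :: p) ->
  exists B, [/\ N B, tov B = o' & B `<=` A].
Proof.
elim: p A o => [|B p IH] A o /=; first by move=> [NA _ <-] _; exists A; split.
move=> [NA _ [NB e p']] [nb rp].
have pq : path (tov A) (B :: p) o' by split.
have [C [NC eC CB]] := IH B (tov A) pq rp.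
exists C; split=> //; apply: subset_trans CB _.
have : tov (~` B) A by rewrite e; apply: tov_self.
case=> _; rewrite setCK => -[h|[h _]] //.
have : tov A (~` B) by rewrite -e; apply/tov_self/N_C.
case=> _ [h'|[h' _]]; last by rewrite -(setCK A) -(setCK B); apply: subsetC.
case: nb; rewrite (_ : A = ~` B) ?setCK//; exact/seteqP.
Qed.

(** Acyclicity of the tree: the last side [B] of a closed reduced path is contained in the first
    side [A], yet belongs to the start vertex of [A], which no side inside [A] does. *)
Lemma reduced_closed o p : path o p o -> reduced p -> p = [::].
Proof.
case: p => // A p pp rp; have [B [NB eB BA]] := path_decreasing pp rp.
have [NA e _] := pp; have [_ [y Ay]] := N_proper NA.
have : tov (~` A) B by rewrite e -eB; apply: tov_self.
case=> _; rewrite setCK => -[h|[h ne]]; first by case: (Ay); apply/BA/h.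
by case: ne; apply/seteqP.
Qed.

Lemma not_reduced p : ~ reduced p -> exists p1 A p2, p = p1 ++ A :: ~` A :: p2.
Proof.
elim: p => [|A p IH] /=; first by case.
move=> /not_andP[|/IH[p1 [B [p2 ->]]]]; last by exists (A :: p1), B, p2.
by case: p {IH} => [[]//|B p /contrapT ->]; exists [::], A, p.
Qed.

Definition tro h o : set (set G) := [set A | o (tr h^-1 A)].

Lemma troM g h o : tro g (tro h o) = tro (g * h) o.
Proof. by apply/seteqP; split=> A; rewrite /tro /= trM invgM. Qed.
Lemma tro1 o : tro 1 o = o.
Proof. by apply/seteqP; split=> A; rewrite /tro /= invg1 tr1. Qed.
Lemma troK h o : tro h^-1 (tro h o) = o.
Proof. by rewrite troM mulVg tro1. Qed.
Lemma troKV h o : tro h (tro h^-1 o) = o.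
Proof. by rewrite troM mulgV tro1. Qed.
Lemma tro_tr h o A : tro h o (tr h A) = o A.
Proof. by rewrite /tro /= trK. Qed.
Lemma N_trE h A : N (tr h A) <-> N A.
Proof. by split=> [/(@N_tr h^-1)|/N_tr//]; rewrite trK. Qed.

Lemma tov_tr h A : tov (tr h A) = tro h (tov A).
Proof.
apply/seteqP; split=> B0; have [B ->] : exists B, B0 = tr h B by
  exists (tr h^-1 B0); rewrite trKV.
  rewrite tro_tr => -[/N_trE NB k]; split=> //.
  case: k => [/tr_subE|[k ne]]; [by left|right; split; first exact/(tr_subE h)].
  by move=> e; apply: ne; rewrite e.
rewrite tro_tr => -[NB k]; split; first exact: N_tr.
case: k => [k|[k ne]]; [by left; apply/tr_subE|right; split; first exact: (tr_sub k)].
by rewrite -trC => /tr_inj.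
Qed.

Lemma vertex_tro h o : vertex o -> vertex (tro h o).
Proof.
move=> vo; split.
- by move=> A /(vertex_sub vo)/N_trE.
- by move=> A /(@N_tr h^-1)/(vertex_or vo).
- by move=> A /(vertex_excl vo).
- by move=> A B oA NB AB; apply: (vertex_up vo oA (N_tr _ NB)); apply: tr_sub.
apply: (@sub_finite_set _ _ (tr h @` ([set B | o B /\ ~ B 1] `|`
   [set B | [/\ N B, B 1 & ~ B h^-1]]))).
  move=> A [oA A1]; exists (tr h^-1 A); last by rewrite trKV.
  have [B1|B1] := pselect (tr h^-1 A 1); [right|by left].
  split=> //; first exact: (vertex_sub vo).
  by rewrite /tr /= invgK mulgV.
apply: finite_image; rewrite finite_setU; split; first exact: vertex_fin.
exact: N_discrete.
Qed.

Lemma path_tr h o p o' : path o p o' -> path (tro h o) (map (tr h) p) (tro h o').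
Proof.
elim: p o => [|A p IH] o /= => [->//|[NA <- /IH k]].
by split; [exact: N_tr|rewrite -tov_tr|rewrite tov_tr].
Qed.

Lemma sep_expand A g : ev A 1 g -> ev (~` A) 1 g^-1 -> ~ (A `<=` tr g A).
Proof.
move=> [n An] [m Am] sub; apply: (Am m (leqnn m)).
suff : forall k, A (g^-1 ^+ k * g ^+ n).
  by move=> /(_ (m + n)%N); rewrite expgnDr -mulgA (expVgn g n) mulVg mulg1 mul1g.
elim=> [|k /sub]; first by have := An n (leqnn n).
by rewrite /tr /= expgS mulgA.
Qed.

(** Of the four nested positions of [tr g A] and [A], two put an end on the wrong side, and
    expansion is excluded by [sep_expand]. *)
Lemma sep_shift A g : N A -> ev A 1 g -> ev (~` A) 1 g^-1 -> tr g A `<=` A.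
Proof.
move=> NA eA eC; have NgA := N_tr g NA.
have e1 : ev (tr g A) 1 g by have := ev_shift eA; rewrite mul1g invg1 mulg1.
have e2 : ev (~` tr g A) 1 g^-1.
  have [M kM] := eC; exists M => n Mn; rewrite /tr /setC /= mul1g -expgS -(mul1g (_ ^+ _)).
  by apply: kM; apply: leq_trans Mn _.
have [//|h|h|h] := nested_cases (N_nested NgA NA).
- by case: (ev_setC eA (ev_sub h e1)).
- by case: (ev_setC (ev_sub h e2) eC).
- case: (sep_expand eA eC); rewrite -(setCK (tr g A)) -{1}(setCK A).
  exact: subsetC.
Qed.

(** Otherwise a side [C] in [o] is shifted strictly into itself by [k], which is [g] or its inverse.
    All [tr (k ^+ n) C] then lie in the fixed vertex [o], are distinct, and finally miss 1,
    contradicting [vertex_fin]. *)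
Lemma fixed_vertex_ends o A g : vertex o -> tro g o = o -> N A -> ~ torsion g ->
  ~ sep A (1, g).
Proof.
move=> vo go NA ng sA.
have [C [k [oC NC ko eC eC']]] : exists C k, [/\ o C, N C, tro k o = o,
    ev C 1 k & ev (~` C) 1 k^-1].
  have gVo : tro g^-1 o = o by rewrite -{1}go troK.
  have [oA|oA] := vertex_or vo NA; case: sA => /= -[h1 h2].
  - by exists A, g.
  - by exists A, g^-1; rewrite invgK.
  - by exists (~` A), g^-1; rewrite setCK invgK; split=> //; exact: N_C.
  - by exists (~` A), g; rewrite setCK; split=> //; exact: N_C.
have dec := sep_shift NC eC eC'; have nexp := sep_expand eC eC'.
have decn m n : m <= n -> tr (k ^+ n) C `<=` tr (k ^+ m) C.
  move=> /subnK <-; elim: (n - m)%N => // i IH; apply: subset_trans IH.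
  by rewrite addSn expgSr -trM; apply: tr_sub.
have oCn n : o (tr (k ^+ n) C).
  elim: n => [|n IH]; first by rewrite tr1.
  by rewrite expgS -trM -ko tro_tr.
have inj : injective (fun n => tr (k ^+ n) C).
  have lt m n : tr (k ^+ m) C = tr (k ^+ n) C -> ~ m < n.
    move=> e mn; apply: nexp; apply/(tr_subE (k ^+ m)); rewrite trM -expgSr e.
    exact: decn.
  by move=> m n e; case: (ltngtP m n) => // /lt; [move/(_ e)|move/(_ (esym e))].
have fD : finite_set ((fun n => tr (k ^+ n) C) @^-1` [set A | o A /\ ~ A 1]).
  by apply: finite_preimage (vertex_fin vo) => m n _ _ /inj.
have [M MP] := finite_nat_bound fD; have [L LP] := eC'.
have := MP (maxn M L); rewrite ltnNge leq_maxl /= => h; apply/notF/h; split=> //.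
have := LP (maxn M L) (leq_maxr _ _).
by rewrite /tr /= mulg1 expVgn mul1g.
Qed.

End NestedFamily.

(** * A group recovered from its action on the dual tree *)

Section FundamentalGroup.
Variables (G : groupType) (N : set (set G)).
Local Open Scope group_scope.
Local Open Scope classical_set_scope.
Implicit Types (A B C e : set G) (o y : set (set G)) (g h k a b : G).
Local Notation tov := (tov N).
Local Notation v1 := (v1 N).
Local Notation path := (path N).

Hypothesis N_C : forall A, N A -> N (~` A).
Hypothesis N_tr : forall h A, N A -> N (tr h A).
Hypothesis N_nested : forall A B, N A -> N B -> ~ cross A B.
Hypothesis N_proper : forall A, N A -> A !=set0 /\ ~` A !=set0.
Hypothesis N_discrete : forall x x0 : G, finite_set [set A | [/\ N A, A x & ~ A x0]].
Hypothesis N_free : forall A g, N A -> tr g A = A -> g = 1.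

(** [Y] and [E] represent orbits of vertices and of unoriented edges, and [t e] moves a vertex of
    [Y] to the end of [e]. [P] is the prospective free product: [phi] maps it to [G], [iota y]
    includes the stabilizer of [y], and [tP e] is the letter above [t e]. *)
Variables (Y : seq (set (set G))) (E : seq (set G)) (t : set G -> G).
Variables (P : groupType) (phi : P -> G) (iota : set (set G) -> G -> P).
Variable tP : set G -> P.

Hypothesis Y_v1 : v1 \in Y.
Hypothesis Y_inj : forall y y' g, y \in Y -> y' \in Y -> tro g y = y' -> y = y'.
Hypothesis E_start : forall e, e \in E -> tov (~` e) \in Y.
Hypothesis E_end : forall e, e \in E -> tro (t e)^-1 (tov e) \in Y.
Hypothesis E_cover : forall A, N A ->
  exists g e, e \in E /\ (A = tr g e \/ A = tr g (~` e)).
Hypothesis E_inj : forall e e' g, e \in E -> e' \in E ->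
  e' = tr g e \/ e' = tr g (~` e) -> e' = e.
(** A reversed edge takes its reversing element as [t e], and [tP e] is its own inverse. The two
    ways to describe a translate of [e] then give the same label. *)
Hypothesis E_inv : forall e g, e \in E -> ~` e = tr g e -> t e = g /\ tP e * tP e = 1.
Hypothesis E_N : forall e, e \in E -> N e.

Inductive tree_vertex : set (set G) -> Prop :=
| TreeBase : tree_vertex v1
| TreeStep f : f \in E -> t f = 1 -> tP f = 1 -> tree_vertex (tov (~` f)) ->
    tree_vertex (tov f).

Hypothesis Y_tree : forall y, y \in Y -> tree_vertex y.

Hypothesis phi_morph : monoid_morphism phi.
Hypothesis phi_tP : forall e, e \in E -> phi (tP e) = t e.
Hypothesis iota_mul : forall y a b, y \in Y -> tro a y = y -> tro b y = y ->
  iota y (a * b) = iota y a * iota y b.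
Hypothesis phi_iota : forall y a, y \in Y -> tro a y = y -> phi (iota y a) = a.
(** The uniqueness half of the universal property of [P]; it is applied to the composite of [phi]
    and [psi]. *)
Hypothesis P_gen : forall theta : P -> P, monoid_morphism theta ->
  (forall y a, y \in Y -> tro a y = y -> theta (iota y a) = iota y a) ->
  (forall e, e \in E -> theta (tP e) = tP e) -> theta =1 id.

Let phi1 : phi 1 = 1 := phi_morph.1.
Let phiM (a b : P) : phi (a * b) = phi a * phi b := phi_morph.2 a b.

Lemma phiV (a : P) : phi a^-1 = (phi a)^-1.
Proof. by apply/esym/mulg1_eq; rewrite -phiM mulgV. Qed.

Lemma iota1 y : y \in Y -> iota y 1 = 1.
Proof.
move=> Yy; apply: (mulgI (iota y 1)); rewrite mulg1 -iota_mul ?tro1// mulg1.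
by [].
Qed.

(* [A] is a translate of an edge [e] of [E] or of its reverse; its label is the  *)
(* triple of the translating elements attached to its ends and the generator.   *)
Definition label A : set (G * G * P) := [set r | exists e, e \in E /\
  ([/\ A = tr r.1.1 e, r.1.2 = r.1.1 * t e & r.2 = tP e] \/
   [/\ A = tr r.1.2 (~` e), r.1.1 = r.1.2 * t e & r.2 = (tP e)^-1])].

Lemma label_exists A : N A -> exists r, label A r.
Proof.
move=> /E_cover[g [e [Ee [->|->]]]].
  by exists (g, g * t e, tP e), e; split=> //; left.
by exists (g * t e, g, (tP e)^-1), e; split=> //; right.
Qed.

Lemma tr_eq g h A B : tr g A = tr h B -> B = tr (h^-1 * g) A.
Proof. by move=> e; rewrite -trM e trK. Qed.

Lemma label_fun A r r' : label A r -> label A r' -> r = r'.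
Proof.
case: r r' => -[s f] l [[s' f'] l'] [e [Ee /= he]] [e' [Ee' /= he']].
(* The critical case: a translate of an edge that is also a translate of a reversed edge. That edge
   is then reversed by a group element, so [t e1] squares to 1. *)
have mixed g h e1 e2 : e1 \in E -> e2 \in E -> tr g e1 = tr h (~` e2) ->
    [/\ e1 = e2, g = h * t e1, h = g * t e1 & (tP e1)^-1 = tP e1].
  move=> Ee1 Ee2 q; have q1 : ~` e2 = tr (h^-1 * g) e1 by apply: tr_eq q.
  have q2 : e2 = e1.
    by apply: (@E_inj _ _ (h^-1 * g)) => //; right; rewrite trC -q1 setCK.
  rewrite q2 in q1; have [te tt] := E_inv Ee1 q1.
  have t2 : t e1 * t e1 = 1 by rewrite -phi_tP// -phiM tt phi1.
  have gh : g = h * t e1 by rewrite te mulVKg.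
  by split=> //; [rewrite gh -mulgA t2 mulg1|apply: mulg1_eq].
case: he => -[q1 q2 ->]; case: he' => -[q1' q2' ->].
- have q : tr s e = tr s' e' by rewrite -q1.
  have ee : e' = e by apply: (@E_inj _ _ (s'^-1 * s)) => //; left; apply: tr_eq.
  rewrite ee in q q2' *; have ss : s = s'.
    by apply/esym/divg1_eq; apply: (N_free (N_tr s (E_N Ee))); rewrite trM mulgVK -q.
  by rewrite q2 q2' ss.
- have [|ee gh hg ll] := @mixed s f' _ _ Ee Ee'; first by rewrite -q1.
  by rewrite q2' q2 -ee -gh -hg ll.
- have [|ee gh hg ll] := @mixed s' f _ _ Ee' Ee; first by rewrite -q1'.
  by rewrite q2 q2' -ee -gh -hg ll.
- have q : tr f (~` e) = tr f' (~` e') by rewrite -q1.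
  have q' : tr f e = tr f' e' by rewrite -(setCK e) trC q -trC setCK.
  have ee : e' = e by apply: (@E_inj _ _ (f'^-1 * f)) => //; left; apply: tr_eq.
  rewrite ee in q' q2' *; have ff : f = f'.
    by apply/esym/divg1_eq; apply: (N_free (N_tr f (E_N Ee))); rewrite trM mulgVK -q'.
  by rewrite q2 q2' ff.
Qed.

Definition lab A : G * G * P := xget (1, 1, 1) (label A).

Lemma labP A : N A -> label A (lab A).
Proof. by move=> /label_exists h; apply: xgetPex. Qed.

Lemma labE A r : label A r -> lab A = r.
Proof. by move=> h; apply: (@label_fun A) => //; apply: xgetPex; exists r. Qed.

Lemma labC A : N A -> lab (~` A) = ((lab A).1.2, (lab A).1.1, (lab A).2^-1).
Proof.
move=> NA; apply: labE; have [e [Ee h]] := labP NA; exists e; split=> //=.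
case: h => -[h1 h2 h3]; [right|left]; split=> //; rewrite ?h3 ?invgK// {1}h1 trC ?setCK//.
Qed.

Lemma lab_tr g A : N A -> lab (tr g A) = (g * (lab A).1.1, g * (lab A).1.2, (lab A).2).
Proof.
move=> NA; apply: labE; have [e [Ee h]] := labP NA; exists e; split=> //=.
by case: h => -[h1 h2 h3]; [left|right]; split=> //; rewrite -?trM -?h1// h2 mulgA.
Qed.

Lemma lab_start A : N A -> tro ((lab A).1.1)^-1 (tov (~` A)) \in Y.
Proof.
move=> /labP[e [Ee [[h1 h2 h3]|[h1 h2 h3]]]].
  by rewrite {2}h1 -trC (tov_tr N_tr) troK E_start.
rewrite {2}h1 -trC setCK (tov_tr N_tr) h2 troM invgM mulgVK.
exact: E_end.
Qed.

Lemma lab_end A : N A -> tro ((lab A).1.2)^-1 (tov A) \in Y.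
Proof.
by move=> NA; have := lab_start (N_C NA); rewrite labC// setCK.
Qed.

Lemma lab_phi A : N A -> phi (lab A).2 = ((lab A).1.1)^-1 * (lab A).1.2.
Proof.
move=> /labP[e [Ee [[_ -> ->]|[_ -> ->]]]]; first by rewrite phi_tP// mulKg.
by rewrite phiV phi_tP// invgM mulgVK.
Qed.

(** The parameters [h] and [g] bring the start and the end of the path back to [Y]. At each edge,
    the discrepancy between [h] and the element attached to the start of the edge is a stabilizer
    element; it is recorded by [iota], followed by the letter of the edge. *)
Fixpoint Psi o h (p : seq (set G)) g : P :=
  match p with
  | [::] => iota (tro h^-1 o) (h^-1 * g)
  | A :: p' => iota (tro h^-1 o) (h^-1 * (lab A).1.1) * (lab A).2 *
               Psi (tov A) (lab A).1.2 p' g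
  end.

Lemma same_base o h k : tro h^-1 o \in Y -> tro k^-1 o \in Y ->
  tro k^-1 o = tro h^-1 o /\ tro (h^-1 * k) (tro h^-1 o) = tro h^-1 o.
Proof.
move=> Yh Yk; have e : tro k^-1 o = tro h^-1 o.
  by apply: (Y_inj Yk Yh (g := h^-1 * k)); rewrite troM mulgK.
by split=> //; rewrite -{1}e troM mulgK.
Qed.

Lemma Psi_base o h k p g o' : path o p o' -> tro h^-1 o \in Y -> tro k^-1 o \in Y ->
  tro g^-1 o' \in Y -> Psi o h p g = iota (tro h^-1 o) (h^-1 * k) * Psi o k p g.
Proof.
move=> pp Yh Yk Yg; have [ek sk] := same_base Yh Yk.
have step x : tro x^-1 o \in Y -> iota (tro h^-1 o) (h^-1 * x) =
    iota (tro h^-1 o) (h^-1 * k) * iota (tro k^-1 o) (k^-1 * x).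
  move=> Yx; have [_ sx] := same_base Yk Yx; rewrite ek in sx *.
  by rewrite -iota_mul// !mulgA mulgK.
case: p pp => [eo|A p [NA eA pp]] /=; first by apply: step; rewrite eo.
by rewrite (step (lab A).1.1) -?eA ?lab_start// !mulgA.
Qed.

Lemma Psi_cat o h p k o' q g o'' : path o p o' -> path o' q o'' ->
  tro h^-1 o \in Y -> tro k^-1 o' \in Y -> tro g^-1 o'' \in Y ->
  Psi o h (p ++ q) g = Psi o h p k * Psi o' k q g.
Proof.
elim: p o h => [|A p IH] o h /=.
  by move=> -> pq Yh Yk Yg; apply: (Psi_base pq).
move=> [NA eA pp] pq Yh Yk Yg; rewrite (IH (tov A))// ?mulgA//.
exact: lab_end.
Qed.

Lemma mulMVMg x h g : (x * h)^-1 * (x * g) = h^-1 * g.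
Proof. by rewrite invgM -mulgA mulKg. Qed.

Lemma Psi_tr x o h p g o' : path o p o' ->
  Psi (tro x o) (x * h) (map (tr x) p) (x * g) = Psi o h p g.
Proof.
elim: p o h => [|A p IH] o h /=.
  by move=> _; rewrite mulMVMg troM invgM mulgVK.
move=> [NA eA pp]; rewrite lab_tr//= mulMVMg troM invgM mulgVK.
by rewrite (tov_tr N_tr) IH.
Qed.

Lemma Psi_backtrack o h A p g o' : path o (A :: ~` A :: p) o' ->
  tro h^-1 o \in Y -> tro g^-1 o' \in Y ->
  Psi o h (A :: ~` A :: p) g = Psi o h p g.
Proof.
move=> [NA eA [NCA _ pp]] Yh Yg; rewrite /= labC//= mulVg.
rewrite iota1; last exact: lab_end.
rewrite mul1g !mulgA mulgK eA.
by rewrite eA in pp; rewrite -(Psi_base pp)// -eA lab_start.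
Qed.

Lemma Psi_backtrack_cat o h p1 A p2 g o' : path o (p1 ++ A :: ~` A :: p2) o' ->
  tro h^-1 o \in Y -> tro g^-1 o' \in Y ->
  path o (p1 ++ p2) o' /\ Psi o h (p1 ++ A :: ~` A :: p2) g = Psi o h (p1 ++ p2) g.
Proof.
elim: p1 o h => [|B p1 IH] o h.
  move=> pp Yh Yg; split; last exact: Psi_backtrack pp Yh Yg.
  by have [_ eA [_ _]] := pp; rewrite eA.
move=> [NB eB pp] Yh Yg.
have [|h1 h2] := IH _ (lab B).1.2 pp _ Yg; first exact: lab_end.
by split=> //=; rewrite h2.
Qed.

(** Since the graph is a tree, a closed path shrinks to the empty one by removing backtracks, none
    of which changes [Psi]. *)
Lemma Psi_closed o h p g : path o p o -> tro h^-1 o \in Y -> tro g^-1 o \in Y ->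
  Psi o h p g = iota (tro h^-1 o) (h^-1 * g).
Proof.
move=> + Yh Yg; have [n] := ubnP (size p); elim: n p => // n IH p lt pp.
have [rp|/not_reduced[p1 [A [p2 ep]]]] := pselect (reduced p).
  by rewrite (reduced_closed N_C N_proper pp rp).
rewrite ep in lt pp *; have [pp' ->] := Psi_backtrack_cat pp Yh Yg.
by apply: IH => //; move: lt; rewrite !size_cat /=; lia.
Qed.

Lemma Psi_indep o h p q g o' : path o p o' -> path o q o' ->
  tro h^-1 o \in Y -> tro g^-1 o' \in Y -> Psi o h p g = Psi o h q g.
Proof.
move=> pp pq Yh Yg; have pr := path_rev N_C pq.
have c1 : path o (q ++ rpath q) o by apply: path_cat pr.
have c2 : path o' (rpath q ++ p) o' by apply: path_cat pr pp.
have := Psi_cat pq c2 Yh Yg Yg; rewrite (Psi_closed c2 Yg Yg) mulVg iota1// mulg1.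
rewrite catA (Psi_cat c1 pp Yh Yh Yg) (Psi_closed c1 Yh Yh) mulVg iota1// mul1g.
by [].
Qed.

(** Under [phi] the product telescopes: each factor is the quotient of the elements attached to two
    consecutive positions. *)
Lemma phi_Psi o h p g o' : path o p o' -> tro h^-1 o \in Y -> tro g^-1 o' \in Y ->
  phi (Psi o h p g) = h^-1 * g.
Proof.
elim: p o h => [|A p IH] o h /=.
  move=> -> Yh Yg; have [_ s] := same_base Yh Yg; exact: phi_iota.
move=> [NA eA pp] Yh Yg.
have Ys : tro ((lab A).1.1)^-1 o \in Y by rewrite -eA lab_start.
have [_ s] := same_base Yh Ys.
by rewrite !phiM phi_iota// lab_phi// (IH _ _ pp)// ?lab_end// !mulgA !mulgK.
Qed.

Let vv1 : vertex N v1. Proof. exact: vertex_v1. Qed.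

Lemma path_psi g : exists p, path v1 p (tro g v1).
Proof. by apply: path_exists => //; apply: vertex_tro. Qed.

Definition psi g : P := Psi v1 1 (projT1 (cid (path_psi g))) g.

Let Y1 : tro 1^-1 v1 \in Y. Proof. by rewrite invg1 tro1. Qed.
Let Yg g : tro g^-1 (tro g v1) \in Y. Proof. by rewrite troK. Qed.

Lemma psiE g p : path v1 p (tro g v1) -> psi g = Psi v1 1 p g.
Proof. by move=> pp; apply: Psi_indep (projT2 (cid (path_psi g))) pp Y1 (Yg g). Qed.

(** A path to the base vertex moved by [g * k] is a path for [g] followed by the translate by [g] of
    a path for [k]; [Psi] is multiplicative and invariant under translation. *)
Lemma psi_morph : monoid_morphism psi.
Proof.
split; first by rewrite (@psiE 1 [::]) /= ?tro1// mulVg iota1.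
move=> g k; have [p pp] := path_psi g; have [q pq] := path_psi k.
have pgq := path_tr N_tr g pq; rewrite troM in pgq.
rewrite (psiE (path_cat pp pgq)) (Psi_cat pp pgq Y1 (Yg g) (Yg _)).
by rewrite (psiE pp) (psiE pq); have := Psi_tr g 1 k pq; rewrite mulg1 => ->.
Qed.

Lemma psiK : cancel psi phi.
Proof.
move=> g; have [p pp] := path_psi g.
by rewrite (psiE pp) (phi_Psi pp Y1 (Yg g)) invg1 mul1g.
Qed.

(** All labels along edges of the spanning tree are trivial. *)
Lemma tree_path y : tree_vertex y -> y \in Y ->
  exists2 p, path v1 p y & Psi v1 1 p 1 = 1.
Proof.
elim=> [_|f Ef t1 tP1 _ IH Yf].
  by exists [::] => //=; rewrite mulVg iota1.
have [p pp ep] := IH (E_start Ef).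
have pf : path (tov (~` f)) [:: f] (tov f) by split=> //; apply: E_N.
have Y1' o : o \in Y -> tro 1^-1 o \in Y by rewrite invg1 tro1.
exists (p ++ [:: f]); first exact: path_cat pf.
rewrite (Psi_cat pp pf Y1 (Y1' _ (E_start Ef)) (Y1' _ Yf)) ep mul1g /=.
rewrite (@labE f (1, 1, 1)) /=; last by exists f; split=> //; left; rewrite tr1 t1 mulg1.
by rewrite !mulVg invg1 !tro1 (iota1 (E_start Ef)) (iota1 Yf) !mulg1.
Qed.

(** Go to [y] along the spanning tree and return along the translate by [a] of the same path. Only
    the change of representative at [y], from 1 to [a], contributes. *)
Lemma psi_iota y a : y \in Y -> tro a y = y -> psi a = iota y a.
Proof.
move=> Yy ay; have [p pp ep] := tree_path (Y_tree Yy) Yy.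
have Y1y : tro 1^-1 y \in Y by rewrite invg1 tro1.
have Yay : tro a^-1 y \in Y by rewrite -{1}ay troK.
have pr := path_rev N_C pp; have pra := path_tr N_tr a pr; rewrite ay in pra.
rewrite (psiE (path_cat pp pra)) (Psi_cat pp pra Y1 Y1y (Yg a)) ep mul1g.
rewrite (Psi_base pra Y1y Yay (Yg a)) invg1 tro1 mul1g.
have := Psi_tr a 1 1 pr; rewrite !mulg1 ay => ->.
suff -> : Psi y 1 (rpath p) 1 = 1 by rewrite mulg1.
have cl := path_cat pp pr; have := Psi_cat pp pr Y1 Y1y Y1.
by rewrite (Psi_closed cl Y1 Y1) mulVg iota1// ep mul1g.
Qed.

Lemma psi_tP e : e \in E -> psi (t e) = tP e.
Proof.
move=> Ee; set y := tov (~` e); have Yy : y \in Y := E_start Ee.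
set y' := tro (t e)^-1 (tov e); have Yy' : y' \in Y := E_end Ee.
have [p pp ep] := tree_path (Y_tree Yy) Yy.
have [p' pp' ep'] := tree_path (Y_tree Yy') Yy'.
have Y1' o : o \in Y -> tro 1^-1 o \in Y by rewrite invg1 tro1.
have pr := path_rev N_C pp'; have pra := path_tr N_tr (t e) pr.
have ey : tro (t e) y' = tov e by rewrite troKV.
rewrite ey in pra; have pe : path y (e :: map (tr (t e)) (rpath p')) (tro (t e) v1).
  by split=> //; apply: E_N.
rewrite (psiE (path_cat pp pe)) (Psi_cat pp pe Y1 (Y1' _ Yy) (Yg _)) ep mul1g /=.
rewrite (@labE e (1, t e, tP e)) /=; last first.
  by exists e; split=> //; left; rewrite tr1 mul1g.
rewrite mulVg iota1 ?Y1'// mul1g.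
have := Psi_tr (t e) 1 1 pr; rewrite !mulg1 ey => ->.
suff -> : Psi y' 1 (rpath p') 1 = 1 by rewrite mulg1.
have cl := path_cat pp' pr; have := Psi_cat pp' pr Y1 (Y1' _ Yy') Y1.
by rewrite (Psi_closed cl Y1 Y1) mulVg iota1// ep' mul1g.
Qed.

Lemma phiK : cancel phi psi.
Proof.
apply: (@P_gen (psi \o phi)) => [|y a Yy ay|e Ee] /=.
- split=> [|a b] /=; first by rewrite phi1 psi_morph.1.
  by rewrite phiM psi_morph.2.
- by rewrite phi_iota// (psi_iota Yy).
- by rewrite phi_tP// psi_tP.
Qed.

Lemma psi_isomorphic : isomorphic G P.
Proof. by exists psi; [exact: psi_morph|exists phi; [exact: psiK|exact: phiK]]. Qed.

End FundamentalGroup.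

(** * Free products *)

Section FiniteSubgroup.
Variables (G : groupType) (s : seq G).
Local Open Scope group_scope.

Definition subgroup_seq : Prop := [/\ 1 \in s,
  forall a b, a \in s -> b \in s -> a * b \in s & forall a, a \in s -> a^-1 \in s].

Hypothesis hs : subgroup_seq.

(** The closure proof is a parameter of the type so that its group structure can be inferred. *)
Definition fsub of subgroup_seq : Type := seq_sub s.
Local Notation H := (fsub hs).
HB.instance Definition _ := Finite.on H.
HB.instance Definition _ := SubType.on H.

Let sub1 : 1 \in s. Proof. by case: hs. Qed.
Let subM (x y : H) : val x * val y \in s.
Proof. by case: hs => _ h _; apply: h; apply: valP. Qed.
Let subV (x : H) : (val x)^-1 \in s.
Proof. by case: hs => _ _; apply; apply: valP. Qed.

Definition fsub_one : H := Sub 1 sub1.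
Definition fsub_mul (x y : H) : H := Sub (val x * val y) (subM x y).
Definition fsub_inv (x : H) : H := Sub (val x)^-1 (subV x).

Lemma fsub_mulA : associative fsub_mul.
Proof. by move=> x y z; apply: val_inj; rewrite !SubK mulgA. Qed.
Lemma fsub_mul1 : left_id fsub_one fsub_mul.
Proof. by move=> x; apply: val_inj; rewrite !SubK mul1g. Qed.
Lemma fsub_mulV : left_inverse fsub_one fsub_inv fsub_mul.
Proof. by move=> x; apply: val_inj; rewrite !SubK mulVg. Qed.

HB.instance Definition _ := Finite_isGroup.Build H fsub_mulA fsub_mul1 fsub_mulV.

Definition to_fsub (a : G) : H := insubd fsub_one a.

Lemma val_to_fsub a : a \in s -> val (to_fsub a) = a.
Proof. by move=> sa; rewrite /to_fsub val_insubd sa. Qed.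

Lemma to_fsub_val (x : H) : to_fsub (val x) = x.
Proof. by apply: val_inj; rewrite val_to_fsub//; apply: valP. Qed.

Lemma val_fsubM (x y : H) : val (x * y) = val x * val y.
Proof. exact: SubK. Qed.

Lemma val_fsub1 : val (1 : H) = 1.
Proof. exact: SubK. Qed.

Lemma to_fsubM a b : a \in s -> b \in s -> to_fsub (a * b) = to_fsub a * to_fsub b.
Proof.
move=> sa sb; have sab : a * b \in s by case: hs => _ h _; apply: h.
by apply: val_inj; rewrite val_fsubM !val_to_fsub.
Qed.

End FiniteSubgroup.

Section FreeProductUniversal.
Variables (I : choiceType) (K : I -> groupType).
Local Open Scope group_scope.
Local Notation P := (free_product K).
Local Notation tag i x := (Tagged (fun i => K i : Type) (x : K i)).

Definition emb i (x : K i) : P := word_class (@free_product_inverse_closed I K) [:: tag i x].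

Lemma emb_rule l r : free_product_rule l r ->
  word_class (@free_product_inverse_closed I K) l = word_class _ r.
Proof.
move=> h; apply/word_classP/rst_step; exists [::], [::], l, r.
by rewrite /= !cats0.
Qed.

Lemma word_class_cons i (x : K i) w :
  word_class (@free_product_inverse_closed I K) (tag i x :: w) = emb x * word_class _ w.
Proof. by rewrite -cat1s -presented_mulE. Qed.

Lemma embM i (x y : K i) : emb (x * y) = emb x * emb y.
Proof. by rewrite /emb -word_class_cons; apply/esym/emb_rule/FP_mul. Qed.

Lemma emb1 i : emb (1 : K i) = 1.
Proof. by apply: emb_rule; apply: FP_one. Qed.

Lemma free_product_ext (theta : P -> P) : monoid_morphism theta ->
  (forall i (x : K i), theta (emb x) = emb x) -> theta =1 id.
Proof.
move=> [t1 tM] h x; rewrite -(word_classK x); elim: (generic_quotient.repr x) => [|[i y] w IH].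
  exact: t1.
by rewrite word_class_cons tM h IH.
Qed.

Variables (G : groupType) (f : forall i, K i -> G).
Hypothesis f_morph : forall i, monoid_morphism (@f i).

Fixpoint lift_word (w : seq {i : I & K i}) : G :=
  if w is a :: w' then f (tagged a) * lift_word w' else 1.

Lemma lift_cat v w : lift_word (v ++ w) = lift_word v * lift_word w.
Proof. by elim: v => [|a v IH] /=; rewrite ?mul1g// IH mulgA. Qed.

Lemma lift_equiv v w : rw_equiv (@free_product_rule I K) v w -> lift_word v = lift_word w.
Proof.
elim=> [{}v {}w [a [b [l [r [lr -> ->]]]]]|//|{}v {}w _ ->//|{}v {}w x _ -> _ -> //].
rewrite !lift_cat; congr (_ * (_ * _)); case: lr => [i x y|i] /=.
  by rewrite !mulg1 (f_morph i).2.
by rewrite mulg1 (f_morph i).1.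
Qed.

Definition lift (x : P) : G := lift_word (generic_quotient.repr x).

Lemma lift_class w : lift (word_class (@free_product_inverse_closed I K) w) = lift_word w.
Proof. by apply/lift_equiv/(word_classP (@free_product_inverse_closed I K)); rewrite word_classK. Qed.

Lemma lift_morph : monoid_morphism lift.
Proof.
split; first exact: lift_class [::].
move=> x y; rewrite -(word_classK x) -(word_classK y).
have -> : word_class (@free_product_inverse_closed I K) (generic_quotient.repr x) *
   word_class _ (generic_quotient.repr y) =
   word_class _ (generic_quotient.repr x ++ generic_quotient.repr y).
  exact: presented_mulE.
by rewrite !lift_class lift_cat.
Qed.

Lemma lift_emb i (x : K i) : lift (emb x) = f x.
Proof. by rewrite lift_class /= mulg1. Qed.

End FreeProductUniversal.

Section IntegerPowers.
Variable G : groupType.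
Local Open Scope group_scope.
Local Notation Z := (nmodule.Algebra.to_multiplicative int).
Implicit Types (g : G) (z : int).

Definition zpow g (z : int) : G :=
  match z with Posz n => g ^+ n | Negz n => (g ^+ n.+1)^-1 end.

Lemma zpowS g z : zpow g (1 + z)%R = g * zpow g z.
Proof.
case: z => [n|[|n]] /=.
- by rewrite -expgS.
- by rewrite mulgV.
- by rewrite (expgSr g n.+1) invgM mulVKg subn1.
Qed.

Lemma zpowP g z : zpow g (-1 + z)%R = g^-1 * zpow g z.
Proof.
by apply: (mulgI g); rewrite mulVKg -zpowS; congr zpow; lia.
Qed.

Lemma int_ind1 (Q : int -> Prop) : Q 0%R ->
  (forall z, Q z -> Q (1 + z)%R) -> (forall z, Q z -> Q (-1 + z)%R) -> forall z, Q z.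
Proof.
move=> Q0 QS QP [n|n].
  by elim: n => // n /QS; rewrite (_ : (1 + Posz n)%R = Posz n.+1)//; lia.
elim: n => [|n IH]; first exact: (QP 0%R).
by move: (QP _ IH); rewrite (_ : (-1 + Negz n)%R = Negz n.+1)//; lia.
Qed.

Lemma zpow_morph g : monoid_morphism (zpow g : Z -> G).
Proof.
split=> // x y; rewrite -[x * y]/((x : int) + y)%R.
elim/int_ind1: x y => [|x IH|x IH] y; first by rewrite GRing.add0r mul1g.
  by rewrite -GRing.addrA !zpowS IH mulgA.
by rewrite -GRing.addrA !zpowP IH mulgA.
Qed.

Lemma int_morph_ext (f f' : Z -> G) : monoid_morphism f -> monoid_morphism f' ->
  f (1%R : int) = f' (1%R : int) -> f =1 f'.
Proof.
move=> [f1 fM] [f1' fM'] e.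
have eV : f (-1)%R = f' (-1)%R.
  apply: (mulgI (f (1%R : int))); rewrite {2}e -fM -fM'.
  by rewrite -[_ * _]/((1 : int) + -1)%R GRing.addrN -[0%R]/(1 : Z) f1 f1'.
elim/int_ind1 => [|x IH|x IH]; first by rewrite -[0%R]/(1 : Z) f1 f1'.
- by rewrite -[(1 + x)%R]/((1%R : Z) * (x : Z)) fM fM' e IH.
- by rewrite -[(-1 + x)%R]/(((-1)%R : Z) * (x : Z)) fM fM' eV IH.
Qed.

End IntegerPowers.

(** * Orbit representatives and the decomposition as a free product *)

Section FundamentalDomain.
Variables (G : groupType) (N : set (set G)).
Local Open Scope group_scope.
Local Open Scope classical_set_scope.
Implicit Types (A B C e f : set G) (o y : set (set G)) (g h k a b : G).
Local Notation tov := (tov N).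
Local Notation v1 := (v1 N).
Local Notation path := (path N).
Local Notation vertex := (vertex N).

Hypothesis N_C : forall A, N A -> N (~` A).
Hypothesis N_tr : forall h A, N A -> N (tr h A).
Hypothesis N_nested : forall A B, N A -> N B -> ~ cross A B.
Hypothesis N_proper : forall A, N A -> A !=set0 /\ ~` A !=set0.
Hypothesis N_discrete : forall x x0 : G, finite_set [set A | [/\ N A, A x & ~ A x0]].
Hypothesis N_free : forall A g, N A -> tr g A = A -> g = 1.
Variable L : set (set G).
Hypothesis L_finite : finite_set L.
Hypothesis L_orbits : forall A, N A -> exists h, L (tr h A).

Definition same_edge e e' := exists g, e = tr g e' \/ e = tr g (~` e').

Lemma same_edge_sym e e' : same_edge e e' -> same_edge e' e.
Proof.
move=> [g [->|->]]; exists g^-1; first by left; rewrite trK.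
by right; rewrite -trC setCK trK.
Qed.

Fixpoint indep (E : seq (set G)) : Prop :=
  if E is e :: E' then [/\ N e, forall e', e' \in E' -> ~ same_edge e e' & indep E']
  else True.

Lemma indep_N E e : indep E -> e \in E -> N e.
Proof.
by elim: E => // f E IH [Nf _ /IH h]; rewrite in_cons => /orP[/eqP ->|/h].
Qed.

Lemma indep_uniq E : indep E -> uniq E.
Proof.
elim: E => // e E IH [Ne ne /IH uE]; rewrite /= uE andbT.
by apply/negP => /ne; apply; exists 1; left; rewrite tr1.
Qed.

Lemma indep_inj E e e' : indep E -> e \in E -> e' \in E -> same_edge e' e -> e' = e.
Proof.
elim: E => // f E IH [Nf nf /IH h]; rewrite !in_cons.
move=> /orP[/eqP ->|Ee] /orP[/eqP ->|Ee'] //.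
- by move=> /same_edge_sym/(nf _ Ee').
- by move=> /(nf _ Ee).
- exact: h.
Qed.

(** Translating the members of [E] into [L] keeps them distinct. The bound makes the greedy
    extensions in [subtree_max] and [indep_extend] stop. *)
Lemma indep_size E : indep E -> size E <= ncard L.
Proof.
move=> iE; suff [l [ul lL <- _]] : exists l, [/\ uniq l, forall x, x \in l -> L x,
    size l = size E & forall x, x \in l -> exists2 e, e \in E & same_edge x e].
  exact: ncard_uniq.
elim: E iE => [|e E IH]; first by exists [::].
move=> [Ne ne /IH[l [ul lL sl le]]]; have [h Lh] := L_orbits Ne.
exists (tr h e :: l); split=> /=; last 1 first.
- move=> x; rewrite in_cons => /orP[/eqP ->|/le[e' Ee' xe']].
    by exists e; rewrite ?inE ?eqxx//; exists h; left.
  by exists e' => //; rewrite inE Ee' orbT.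
- rewrite ul andbT; apply/negP => /le[e' Ee' [g hg]]; apply: (ne _ Ee').
  by exists (h^-1 * g); case: hg => hg; [left|right]; rewrite -trM -hg trK.
- by move=> x; rewrite in_cons => /orP[/eqP ->|/lL].
- by rewrite sl.
Qed.

(* [Y] is the vertex set of a subtree that meets each orbit of vertices at most *)
(* once, and [F] the list of its edges, oriented away from [v1].               *)
Inductive subtree : seq (set (set G)) -> seq (set G) -> Prop :=
| SubtreeBase : subtree [:: v1] [::]
| SubtreeStep Y F f : subtree Y F -> N f -> tov (~` f) \in Y ->
    (forall y g, y \in Y -> tov f <> tro g y) -> subtree (tov f :: Y) (f :: F).

Lemma subtree_v1 Y F : subtree Y F -> v1 \in Y.
Proof. by elim=> [|Y' F' f _ h _ _ _]; rewrite inE ?eqxx// h orbT. Qed.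

Lemma subtree_vertex Y F y : subtree Y F -> y \in Y -> vertex y.
Proof.
move=> st; elim: st y => [|Y' F' f _ h Nf _ _] y.
  by rewrite mem_seq1 => /eqP ->; apply: vertex_v1.
by rewrite in_cons => /orP[/eqP ->|/h//]; apply: vertex_tov.
Qed.

Lemma subtree_inj Y F y y' g : subtree Y F -> y \in Y -> y' \in Y ->
  tro g y = y' -> y = y'.
Proof.
move=> st; elim: st y y' g => [|Y' F' f _ h Nf _ nf] y y' g.
  by rewrite !mem_seq1 => /eqP -> /eqP ->.
rewrite !in_cons.
move=> /orP[/eqP ->|Yy] /orP[/eqP ->|Yy'] //; last exact: h.
- by move=> e; case: (nf _ g^-1 Yy'); rewrite -e troK.
- by move=> e; case: (nf _ g Yy); rewrite e.
Qed.

Lemma subtree_ends Y F f : subtree Y F -> f \in F ->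
  [/\ N f, tov (~` f) \in Y & tov f \in Y].
Proof.
move=> st; elim: st f => [//|Y' F' f' _ h Nf Yf _] f; rewrite in_cons.
move=> /orP[/eqP ->|/h[h1 h2 h3]]; split=> //; rewrite inE ?eqxx ?Yf ?h2 ?h3 ?orbT//.
Qed.

Lemma subtree_indep Y F : subtree Y F -> indep F.
Proof.
elim=> // Y' F' f st iF Nf Yf nf; split=> // f' Ff' [g].
have [_ h1 h2] := subtree_ends st Ff'.
by case=> e; [apply: (nf _ g h2)|apply: (nf _ g h1)]; rewrite e (tov_tr N_tr).
Qed.

Lemma subtree_max : exists Y F, subtree Y F /\
  forall f, N f -> tov (~` f) \in Y -> exists y g, y \in Y /\ tov f = tro g y.
Proof.
apply: contrapT => no.
suff [Y [F [st sF]]] : exists Y F, subtree Y F /\ size F = (ncard L).+1.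
  by have := indep_size (subtree_indep st); rewrite sF ltnn.
elim: (ncard L).+1 => [|n [Y [F [st sF]]]]; first by exists [:: v1], [::]; split=> //; constructor.
apply: contrapT => nx; apply: no; exists Y, F; split=> // f Nf Yf.
apply: contrapT => nf; apply: nx; exists (tov f :: Y), (f :: F); split=> /=; last by rewrite sF.
by constructor=> // y g Yy e; apply: nf; exists y, g.
Qed.

(** Follow a path from the base vertex; after each edge, translate back to [Y] and use maximality
    for the next edge. *)
Lemma subtree_cover Y F o : subtree Y F ->
  (forall f, N f -> tov (~` f) \in Y -> exists y g, y \in Y /\ tov f = tro g y) ->
  vertex o -> exists y g, y \in Y /\ o = tro g y.
Proof.
move=> st mx vo; have [p] : exists p, path v1 p o by apply: path_exists => //; apply: vertex_v1.
suff gen o' : (exists y g, y \in Y /\ o' = tro g y) -> path o' p o ->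
    exists y g, y \in Y /\ o = tro g y.
  by apply: gen; exists v1, 1; rewrite tro1 (subtree_v1 st).
elim: p o' => [|A p IH] o' [y [g [Yy ->]]] /= => [<-|[NA eA]]; first by exists y, g.
apply: IH; have [|y' [g' [Yy' e']]] := mx (tr g^-1 A) (N_tr _ NA).
  by rewrite -trC (tov_tr N_tr) eA troK.
exists y', (g * g'); split=> //; move: e'; rewrite (tov_tr N_tr) -troM => <-.
by rewrite troKV.
Qed.

Lemma indep_extend (Q : set G -> Prop) F : indep F -> (forall e, e \in F -> Q e) ->
  (forall A, N A -> exists h, Q (tr h A)) ->
  exists E, [/\ indep (E ++ F), forall e, e \in E -> Q e &
    forall A, N A -> exists2 e, e \in E ++ F & same_edge A e].
Proof.
move=> iF QF QA; apply: contrapT => no.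
suff [E [iE _ sE]] : exists E, [/\ indep (E ++ F), forall e, e \in E -> Q e & size E = (ncard L).+1].
  by have := indep_size iE; rewrite size_cat sE; lia.
elim: (ncard L).+1 => [|n [E [iE QE sE]]]; first by exists [::].
apply: contrapT => nx; apply: no; exists E; split=> // A NA.
apply: contrapT => nA; apply: nx; have [h Qh] := QA A NA.
exists (tr h A :: E); split=> /=; last by rewrite sE.
- split=> //; first exact: N_tr.
  move=> e' Ee' [g hg]; apply: nA; exists e' => //; exists (h^-1 * g).
  by case: hg => hg; [left|right]; rewrite -trM -hg trK.
- by move=> e; rewrite in_cons => /orP[/eqP ->|/QE].
Qed.

Hypothesis stab_finite : forall o, vertex o -> finite_set [set g | tro g o = o].

Lemma fundamental_domain : exists Y E F t,
  [/\ subtree Y F, indep E, (forall f, f \in F -> f \in E /\ t f = 1),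
    (forall e, e \in E -> tov (~` e) \in Y /\ tro (t e)^-1 (tov e) \in Y) &
    (forall A, N A -> exists2 e, e \in E & same_edge A e) /\
    (forall e g, e \in E -> ~` e = tr g e -> t e = g)].
Proof.
have [Y [F [st mx]]] := subtree_max.
have QF e : e \in F -> tov (~` e) \in Y by move=> /(subtree_ends st)[].
have [|E [iE QE cE]] := indep_extend (subtree_indep st) QF.
  move=> A NA; have [y [g [Yy ey]]] := subtree_cover st mx (vertex_tov N_C N_nested N_proper N_discrete (N_C NA)).
  by exists g^-1; rewrite -trC (tov_tr N_tr) ey troK.
have start e : e \in E ++ F -> tov (~` e) \in Y by rewrite mem_cat => /orP[/QE|/QF].
(* Choice of [t e]: 1 on tree edges, the reversing element on reversed edges, and otherwise any
   element that brings the end of [e] to [Y]. *)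
have ex e : exists g, e \in E ++ F -> [/\ e \in F -> g = 1, tro g^-1 (tov e) \in Y &
    forall g', ~` e = tr g' e -> g = g'].
  have [EFe|nE] := boolP (e \in E ++ F); last by exists 1.
  have Ne := indep_N iE EFe.
  have inv_end g' : ~` e = tr g' e -> tro g'^-1 (tov e) = tov (~` e).
    move=> eg; rewrite -{1}(setCK e) eg -trC eg trM (tov_tr N_tr) troM.
    by rewrite mulKg -(tov_tr N_tr) -eg.
  have inv_fun g g' : ~` e = tr g e -> ~` e = tr g' e -> g = g'.
    move=> e1 e2; apply/divg1_eq; apply: (N_free (N_tr g' Ne)).
    by rewrite trM mulgVK -e1.
  have [Fe|nF] := boolP (e \in F).
    have [_ h1 h2] := subtree_ends st Fe.
    exists 1 => _; split=> // [|g' /inv_end eg]; first by rewrite invg1 tro1.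
    (* A tree edge cannot be reversed: its two ends would lie in one orbit and hence coincide, and
       that vertex would contain both sides of [e]. *)
    have ee : tov e = tov (~` e) by apply: (subtree_inj st h2 h1 eg).
    have : tov (~` e) (~` e) by apply: tov_self; apply: N_C.
    rewrite -ee => h; case: (vertex_excl (vertex_tov N_C N_nested N_proper N_discrete Ne) (tov_self Ne)).
    by [].
  have [[g eg]|ninv] := pselect (exists g, ~` e = tr g e).
    exists g => _; split=> // [|g']; last exact: inv_fun.
    by rewrite inv_end// start.
  have [y [g [Yy ey]]] := subtree_cover st mx (vertex_tov N_C N_nested N_proper N_discrete Ne).
  exists g => _; split=> // [|g' eg]; first by rewrite ey troK.
  by case: ninv; exists g'.
have [t tP] := choice ex; exists Y, (E ++ F), F, t; split=> //.
- move=> f Ff; have fE : f \in E ++ F by rewrite mem_cat Ff orbT.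
  by split=> //; have [/(_ Ff)] := tP f fE.
- by move=> e Ee; split; [exact: start|have [] := tP e Ee].
- by split=> // e g Ee; have [_ _] := tP e Ee; apply.
Qed.

Lemma plain_of_tree : plain G.
Proof.
have [Y [E [F [t [st iE FE ends [cE invE]]]]]] := fundamental_domain.
(* The factors are the stabilizers of the vertices in [Y], a group [{1, t e}] for each reversed edge
   in [EI], and a copy of the integers for each edge in [EZ]. Tree edges contribute nothing. *)
pose inv e := `[< exists g, ~` e = tr g e >].
pose EI := [seq e <- E | inv e]; pose EZ := [seq e <- E | ~~ inv e && (e \notin F)].
pose st_seq y : seq G := fset_set [set g | tro g y = y].
pose Hs := map st_seq Y ++ map (fun e => [:: 1; t e]) EI.
have st_mem y g : y \in Y -> (g \in st_seq y) = `[< tro g y = y >].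
  move=> Yy; have fy := stab_finite (subtree_vertex st Yy).
  have -> : (g \in st_seq y) = (g \in fset_set [set g | tro g y = y]) by [].
  by rewrite in_fset_set//; apply/idP/asboolP; rewrite in_cons.
have inv2 e : e \in EI -> [/\ e \in E, ~` e = tr (t e) e & t e * t e = 1].
  rewrite mem_filter => /andP[/asboolP[g eg] Ee]; have te := invE _ _ Ee eg.
  split=> //; first by rewrite te.
  apply: (N_free (indep_N iE Ee)); rewrite -trM te -eg trC -eg setCK.
  by [].
have Hs_sub H : H \in Hs -> subgroup_seq H.
  rewrite mem_cat => /orP[/mapP[y Yy ->]|/mapP[e /inv2[_ _ t2] ->]].
    split; first by rewrite st_mem//; apply/asboolP; rewrite tro1.
    - move=> a b; rewrite !st_mem// => /asboolP ea /asboolP eb; apply/asboolP.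
      by rewrite -troM eb.
    - move=> a; rewrite !st_mem// => /asboolP ea; apply/asboolP.
      by rewrite -{1}ea troK.
  split=> [|a b|a]; rewrite ?inE ?eqxx//.
    move=> /orP[]/eqP -> /orP[]/eqP ->; rewrite ?mulg1 ?mul1g ?eqxx ?orbT//.
    by rewrite t2 eqxx.
  move=> /orP[]/eqP ->; first by rewrite invg1 eqxx.
  by rewrite (mulg1_eq t2) eqxx orbT.
have sub_nth (i : 'I_(size Hs)) : subgroup_seq (nth [::] Hs i) by apply/Hs_sub/mem_nth.
pose Fs (i : 'I_(size Hs)) : finGroupType := fsub (sub_nth i).
pose K := @plain_factor (size Hs) (size EZ) Fs; pose P := free_product K.
exists (size Hs), (size EZ), Fs.
pose tz (j : 'I_(size EZ)) := t (nth set0 EZ j).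
pose fl (x : 'I_(size Hs) + 'I_(size EZ)) : K x -> G :=
  match x with inl i => fun a : Fs i => (val (a : fsub (sub_nth i)) : G)
             | inr j => fun z => zpow (tz j) z end.
have fl_morph x : monoid_morphism (fl x).
  case: x => [i|j] /=; last exact: zpow_morph.
  by split=> [|a b]; [exact: val_fsub1|exact: val_fsubM].
pose phi : P -> G := lift fl.
have phi_morph : monoid_morphism phi := lift_morph fl_morph.
pose sub_emb (n : nat) (a : G) : P :=
  if insub n is Some i then @emb _ K (inl i) (to_fsub (sub_nth i) a) else 1.
have sub_embM n a b : n < size Hs -> a \in nth [::] Hs n -> b \in nth [::] Hs n ->
    sub_emb n (a * b) = sub_emb n a * sub_emb n b.
  move=> nH; rewrite /sub_emb insubT => ha hb.
  by rewrite -embM; congr emb; apply: to_fsubM.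
have phi_sub n a : n < size Hs -> a \in nth [::] Hs n -> phi (sub_emb n a) = a.
  move=> nH ha; rewrite /sub_emb insubT /phi (lift_emb fl_morph) /=.
  exact: val_to_fsub.
pose z_emb (n : nat) : P :=
  if insub n is Some j then @emb _ K (inr j) (1%R : int) else 1.
have phi_z n : n < size EZ -> phi (z_emb n) = t (nth set0 EZ n).
  by move=> nE; rewrite /z_emb insubT /phi (lift_emb fl_morph).
pose iota y a := sub_emb (index y Y) a.
pose tP e := if e \in EI then sub_emb (size Y + index e EI) (t e)
             else if e \in EZ then z_emb (index e EZ) else 1.
have szH : size Hs = size Y + size EI by rewrite size_cat !size_map.
have iY y : y \in Y -> index y Y < size Hs /\ nth [::] Hs (index y Y) = st_seq y.
  move=> Yy; have iy : index y Y < size Y by rewrite index_mem.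
  split; first by rewrite szH (leq_trans iy)// leq_addr.
  by rewrite nth_cat size_map iy (nth_map v1)// nth_index.
have iI e : e \in EI -> size Y + index e EI < size Hs /\
    nth [::] Hs (size Y + index e EI) = [:: 1; t e].
  move=> Ie; have ie : index e EI < size EI by rewrite index_mem.
  split; first by rewrite szH ltn_add2l.
  by rewrite nth_cat size_map ltnNge leq_addr /= addKn (nth_map set0)// nth_index.
have nIF f : f \in F -> f \notin EI.
  move=> Ff; apply/negP => /inv2[Ef ef _]; have [_ tf] := FE f Ff.
  have := indep_N iE Ef => Nf; have [[x fx] _] := N_proper Nf.
  by have := fx; rewrite -{1}(tr1 f) -tf -ef; apply.
have uY : uniq Y.
  elim: (st) => // Y' F' f _ uY' _ _ nf /=; rewrite uY' andbT.
  by apply/negP => Yf; apply: (nf _ 1 Yf); rewrite tro1.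
have uE : uniq E := indep_uniq iE.
have FP f : f \in F -> [/\ f \in E, t f = 1 & tP f = 1].
  move=> Ff; have [Ef tf] := FE f Ff; split=> //.
  by rewrite /tP (negbTE (nIF f Ff)) mem_filter Ff andbF.
have tree Y' F' : subtree Y' F' -> (forall f, f \in F' -> f \in F) ->
    forall y, y \in Y' -> tree_vertex N E t tP y.
  elim=> [|Y2 F2 f st' IH Nf Yf nf] F2F y.
    by rewrite mem_seq1 => /eqP ->; constructor.
  rewrite in_cons => /orP[/eqP ->|]; last first.
    by apply: IH => f' Ff'; apply: F2F; rewrite in_cons Ff' orbT.
  have [|Ef tf tPf] := FP f; first by apply: F2F; rewrite in_cons eqxx.
  constructor=> //; apply: IH => // f' Ff'.
  by apply: F2F; rewrite in_cons Ff' orbT.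
apply: (@psi_isomorphic G N N_C N_tr N_nested N_proper N_discrete N_free Y E t P
  phi iota tP) => //.
- exact: subtree_v1 st.
- by move=> y y' g Yy Yy'; apply: subtree_inj st Yy Yy'.
- by move=> e /ends[].
- by move=> e /ends[].
- by move=> A /cE[e Ee [g h]]; exists g, e.
- by move=> e e' g Ee Ee' h; apply: (indep_inj iE) => //; exists g.
- move=> e g Ee eg; split; first exact: invE.
  have Ie : e \in EI by rewrite mem_filter Ee andbT; apply/asboolP; exists g.
  rewrite /tP Ie; have [i1 i2] := iI e Ie; have [_ _ t2] := inv2 e Ie.
  rewrite -sub_embM ?i2 ?inE ?eqxx ?orbT// t2 /sub_emb insubT -[RHS](emb1 K (inl (Ordinal i1))).
  by congr emb; apply: val_inj; rewrite val_to_fsub ?i2 ?inE ?eqxx// val_fsub1.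
- by move=> e /(indep_N iE).
- by move=> y; apply: tree st _ y.
- move=> e Ee; rewrite /tP; case: ifPn => [Ie|nI].
    by have [i1 i2] := iI e Ie; apply: phi_sub; rewrite ?i2 ?inE ?eqxx ?orbT.
  have ninv : ~~ inv e by apply: contra nI => ie; rewrite mem_filter ie.
  case: ifPn => [Ze|]; first by rewrite phi_z ?index_mem// nth_index.
  rewrite mem_filter ninv Ee andbT /= negbK => Fe; have [_ ->] := FE e Fe.
  exact: phi_morph.1.
- move=> y a b Yy ea eb; have [i1 i2] := iY y Yy.
  by apply: sub_embM; rewrite ?i2 ?st_mem//; apply/asboolP.
- by move=> y a Yy ea; have [i1 i2] := iY y Yy; apply: phi_sub; rewrite ?i2 ?st_mem//; apply/asboolP.
(* The generators are checked factor by factor. Index [i] is a vertex stabilizer below [size Y] and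
   a reversed edge from there on. *)
move=> theta tm h1 h2; apply: free_product_ext => // -[i|j] x.
- have [lt|ge] := ltnP i (size Y).
    have Yy : nth v1 Y i \in Y by apply: mem_nth.
    have := h1 (nth v1 Y i) (val x) Yy; rewrite /iota index_uniq//.
    rewrite /sub_emb valK to_fsub_val; apply.
    apply/asboolP; rewrite -st_mem//.
    have <- : nth [::] Hs i = st_seq (nth v1 Y i) by rewrite nth_cat size_map lt (nth_map v1).
    exact: (valP (x : fsub (sub_nth i))).
  pose e := nth set0 EI (i - size Y); have lt : i - size Y < size EI.
    by have := ltn_ord i; rewrite [X in _ < X]szH; lia.
  have Ie : e \in EI by apply: mem_nth.
  have ei : size Y + index e EI = i by rewrite index_uniq ?filter_uniq// subnKC.
  have [Ee _ _] := inv2 e Ie; have := h2 e Ee; rewrite /tP Ie ei /sub_emb valK => ht.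
  have := valP (x : fsub (sub_nth i)).
  have [_ en] := iI e Ie; rewrite ei in en.
  rewrite [X in _ \in X]en !inE => /orP[]/eqP ex.
    have -> : x = 1 by apply: val_inj; rewrite val_fsub1.
    by rewrite emb1 tm.1.
  by rewrite -ex to_fsub_val in ht.
pose e := nth set0 EZ j; have Ze : e \in EZ by apply: mem_nth.
have ej : index e EZ = j by rewrite index_uniq// filter_uniq.
move: (Ze); rewrite mem_filter => /andP[/andP[ninv nF] Ee].
have nI : e \notin EI by rewrite mem_filter negb_and ninv.
have := h2 e Ee; rewrite /tP (negbTE nI) Ze ej /z_emb valK => ht.
have em : monoid_morphism (@emb _ K (inr j)) by split=> [|a b]; [exact: emb1|exact: embM].
apply: (@int_morph_ext P (theta \o @emb _ K (inr j)) (@emb _ K (inr j))) => //=.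
split=> [|a b] /=; first by rewrite em.1 tm.1.
by rewrite em.2 tm.2.
Qed.

End FundamentalDomain.

(** * Groups without certificates are plain *)

Section FiniteSystem.
Variables (A : finType) (T : relation (seq A)) (h : inverse_closed T).
Hypothesis reducing : length_reducing T.
Hypothesis confl : confluent T.
Variable sigma : nat.
Hypothesis sigmaP : forall l r, T l r -> size l <= sigma.
Local Notation G := (presented h).
Local Notation cls := (word_class h).
Local Notation K := sigma.*2.
Local Notation nf := (nf (h := h) reducing).
Local Notation len := (len (h := h) reducing).
Local Notation gp := (gp (h := h) reducing).
Local Open Scope group_scope.
Local Open Scope classical_set_scope.
Implicit Types (g x y z b c : G) (w : seq A) (C D : set G).

Lemma ball_finite n : finite_set [set z : G | len z <= n].
Proof.
apply: (@sub_finite_set _ _ ((fun b : n.-bseq A => cls b) @` setT)).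
  move=> z zn; exists (Bseq zn) => //=; exact: nfK.
by apply: finite_image; apply: finite_finset.
Qed.

Lemma bounded_torsion g B : (forall n, len (g ^+ n) <= B) -> torsion g.
Proof.
move=> bd; apply: contrapT => /expg_inj inj.
have fp : finite_set ((fun n => g ^+ n) @^-1` [set z | len z <= B]).
  by apply: finite_preimage (ball_finite B) => m n _ _ /inj.
by have [M /(_ M)] := finite_nat_bound fp; rewrite ltnn => /(_ (bd M)).
Qed.

(** If the powers of [g] are bounded, then [6 len g + 2 K + sigma] bounds [len (g ^+ n)], and adding
    [2 (len g + K)] still stays below [n]. If [g] has an axis, [translates] says precisely that the
    test fails. *)
Lemma torsion_test g n : 8 * len g + 4 * K + sigma < n ->
  torsion g <-> len (g ^+ n) + (len g + K).*2 < n.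
Proof.
move=> big; split=> [tg|lt].
  have [ax|/(_ n)] := axis_or_bounded reducing confl sigmaP g; last by glia G.
  by case: (translates_not_torsion confl (axis_translates confl ax) tg).
have [/(axis_translates confl)/(_ n)|bd] := axis_or_bounded reducing confl sigmaP g.
  by glia G.
exact: bounded_torsion bd.
Qed.

Definition letters : seq G := [seq cls [:: a] | a <- enum A].

Lemma mem_letters a : cls [:: a] \in letters.
Proof. by apply: map_f; rewrite mem_enum. Qed.

Lemma letters_inv s : s \in letters -> s^-1 \in letters.
Proof.
move=> /mapP[a _ ->]; rewrite -(cls_inv h [:: a]) /word_inv /=.
exact: mem_letters.
Qed.

Lemma letters_gen x y : clos_refl_trans G (adj letters) x y.
Proof.
rewrite -(mulVKg x y) -(nfK reducing (x^-1 * y)); elim/last_ind: (nf _) => [|w a IH].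
  by rewrite cls_nil mulg1; apply: rt_refl.
apply: rt_trans IH (rt_step _ _ _ _ _).
by rewrite /adj -cats1 cls_cat (mulgA x) mulKg mem_letters.
Qed.

(** A left translate of this finite set contains the boundary of any given cone, so its cardinality
    is a bound valid for all cones. *)
Definition shell : set (G * G) :=
  (fun e => (e.1, e.1 * e.2)) @` ([set z : G | len z <= K] `*` [set` letters]).

Lemma shell_finite : finite_set shell.
Proof.
by apply: finite_image; apply: finite_setX; [exact: ball_finite|exact: finite_seq].
Qed.

Definition cone w : set G := [set y | take (size w) (nf y) = w].

(* A vertex of a cone adjacent to the complement is close to the apex. *)
Lemma bd_cone w : bd letters (cone w) `<=`
  (fun e => (cls w * e.1, cls w * e.2)) @` shell.
Proof.
move=> [y y'] [/= Cy Cy' /mapP[a _ ea]].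
have ey' : y' = y * cls [:: a] by rewrite -ea mulVKg.
pose z := cls (drop (size w) (nf y)).
have ey : y = cls w * z by rewrite -{1}(nfK reducing y) -{1}(cat_take_drop (size w) (nf y)) Cy cls_cat.
have lz : len z <= K.
  have := size_cls h reducing confl (drop (size w) (nf y)); rewrite -/z size_drop.
  have := gp_letter reducing confl sigmaP y a; rewrite -ey'.
  have : gp y y' < size w.
    rewrite ltnNge; apply/negP => /lcp_take e; apply: Cy'.
    by rewrite /cone /= -e.
  by rewrite /len; glia G.
exists (z, z * cls [:: a]) => /=; last by rewrite ey' ey mulgA.
by exists (z, cls [:: a]) => //; split=> //=; apply: mem_letters.
Qed.

Definition cutsize := ncard shell.

Lemma cone_fin w : fin letters (cone w).
Proof. by apply: sub_finite_set (@bd_cone w) _; apply: finite_image; apply: shell_finite. Qed.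

Lemma cone_mu w : mu letters (cone w) <= cutsize.
Proof.
rewrite /cutsize -(ncard_inj (f := fun e : G * G => (cls w * e.1, cls w * e.2)) _ shell_finite).
  by apply: ncard_sub (@bd_cone w); apply: finite_image; apply: shell_finite.
by move=> [a b] [c d] [/mulgI -> /mulgI ->].
Qed.

(** Lengths of powers of [U] add exactly, so by [gp_upper] the element [U^-n] has no first letter in
    common with [U]. Thus the cone of [w] contains the forward ray and misses the backward one;
    multiplication by [p^-1] disturbs only bounded ends of the words. *)
Lemma axis_cut x g : has_axis reducing sigma g ->
  exists C, [/\ fin letters C, sep C (x, g) & mu letters C <= cutsize].
Proof.
move=> [p [w [eg w0 _ irr]]]; set U := cls w.
have d0 : 0 < size w by case: (w) w0.
have nfU n : nf (U ^+ n) = flatten (nseq n w) by rewrite -cls_flatten clsK.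
have lenU n : len (U ^+ n) = (n * size w)%N by rewrite /len nfU size_flatten_nseq.
have gn n : (x * p)^-1 * (x * g ^+ n) = U ^+ n * p^-1.
  by rewrite eg conj_expg invgM -!mulgA mulKg mulKg.
have gVn n : (x * p)^-1 * (x * g^-1 ^+ n) = U ^- n * p^-1.
  by rewrite expVgn eg conj_expg !invgM invgK -!mulgA mulKg mulKg.
exists (tr (x * p) (cone w)); split; last first.
- by rewrite mu_tr; [exact: cone_mu|exact: cone_fin].
- left; split; exists (size w + len p + K).+1 => n nN /=.
    rewrite /tr /= gn /cone /=; have := gp_mul reducing confl sigmaP (U ^+ n) p^-1.
    rewrite lenU len_inv// => lb.
    have nd : n <= n * size w by rewrite leq_pmulr.
    have /lcp_take <- : size w <= gp (U ^+ n) (U ^+ n * p^-1) by glia G.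
    rewrite nfU; case: (n) nN => // m _ /=.
    by rewrite take_size_cat.
  rewrite /tr /setC /= gVn /cone /= => e.
  have := gp_mul reducing confl sigmaP (U ^- n) p^-1; rewrite !len_inv// lenU => lb.
  have nd : n <= n * size w by rewrite leq_pmulr.
  have g1 : 1 <= gp (U ^- n) (U ^- n * p^-1) by glia G.
  have g2 : 1 <= gp (U ^- n * p^-1) U.
    have nU : nf U = w by rewrite -(expg1 U) nfU /= cats0.
    apply: leq_trans d0 _; apply: lcp_ge; rewrite ?nU ?take_size//.
    by rewrite -{1}e size_take_min geq_minr.
  have := gp_trans (h := h) reducing (U ^- n) (U ^- n * p^-1) U.
  have := gp_upper reducing confl (U ^- n) U; rewrite invgK -expgSr lenU len_inv// lenU.
  by have := lenU 1%N; have := lenU n.+1; rewrite expg1 => e1; glia G.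
by apply: fin_tr; apply: cone_fin.
Qed.

Lemma sepV C x g : sep C (x, g^-1) -> sep C (x, g).
Proof. by rewrite /sep /= invgK; tauto. Qed.

Lemma small_cuts x g : ~ torsion g ->
  exists C, [/\ fin letters C, sep C (x, g) & mu letters C <= cutsize].
Proof.
move=> ng; have [[|]|bd] := axis_or_bounded reducing confl sigmaP g.
- exact: axis_cut.
- by move=> /(axis_cut x)[C [h1 /sepV h2 h3]]; exists C.
- by case: ng; apply: bounded_torsion bd.
Qed.

Local Notation cut := (cut letters).

Let cutC := cutC letters_inv.
Let cut_tr := cut_tr letters_inv letters_gen small_cuts.
Let cut_nested := cut_nested letters_inv letters_gen small_cuts.
Let cut_proper := @cut_proper G letters.
Let cut_discrete := cut_discrete letters_inv letters_gen small_cuts.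
Let cut_sep := cut_sep small_cuts.

Lemma cut_vertex_torsion o g : vertex cut o -> tro g o = o -> torsion g.
Proof.
move=> vo go; apply: contrapT => ng; have [C cC sC] := cut_sep 1 ng.
exact: (fixed_vertex_ends cutC cut_tr cut_nested vo go cC ng sC).
Qed.

Lemma cut_vertex C : cut C -> vertex cut (tov cut C).
Proof. exact: (vertex_tov cutC cut_nested cut_proper cut_discrete). Qed.

Lemma stab_vertex C g : tr g C = C -> tro g (tov cut C) = tov cut C.
Proof. by move=> e; rewrite -(tov_tr cut_tr) e. Qed.

Lemma stab_torsion C g : cut C -> tr g C = C -> torsion g.
Proof.
move=> cC e; apply: (@cut_vertex_torsion (tov cut C)); last exact: stab_vertex.
exact: cut_vertex.
Qed.

(** A discrepancy between the end vertex of [D] towards [C] and that of [C] towards [D] would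
    produce a cut strictly between the two. *)
Lemma consecutive_vertex C D : cut C -> cut D -> D `<=` C -> D <> C ->
  (forall E, cut E -> D `<=` E -> E `<=` C -> E <> C -> E = D) ->
  tov cut C = tov cut (~` D).
Proof.
move=> cC cD DC neq btw; apply: (vertex_eq (N := cut)).
- exact: cut_vertex.
- by apply/cut_vertex/cutC.
have [[x Cx] [y nCy]] := cut_proper cC.
move=> B [cB hB]; split=> //; rewrite setCK; case: hB => [CB|[CB nB]].
  right; split; first exact: subset_trans CB.
  by move=> e; apply: neq; apply/seteqP; split=> //; rewrite -e.
have [BD|BD|BD|BD] := nested_cases (cut_nested cB cD).
- by case: (nCy); apply/DC/BD/CB.
- have e : ~` B = D.
    apply: btw; [exact: cutC|by apply: subsetCr|by apply: subsetCl|].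
    by move=> e; apply: nB; rewrite -e setCK.
  by left; rewrite -e setCK.
- by left; apply: subsetCl.
- right; split; first by rewrite -(setCK D) -(setCK B); apply: subsetC.
  by move=> e; case: (nCy); apply: DC; rewrite -e; apply: CB.
Qed.

Hypothesis notrans : forall a b c : G, ~ witness a b c.

Lemma torsion_trans a b c : torsion a -> torsion b -> torsion c -> b <> 1 ->
  torsion (a * b) -> torsion (b * c) -> torsion (a * c).
Proof.
by move=> ta tb tc b1 tab tbc; apply: contrapT => nac; apply: (notrans (a := a) (b := b) (c := c)).
Qed.

(** Induction on the number of cuts between [C0] and [C]. For the next cut [D] below [C], with
    stabilizing [k <> 1], both [m] and [k] fix the vertex shared by [C] and [D], so [m * k] is
    torsion; [k * m0] is torsion by induction, and [torsion_trans] eliminates [k]. *)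
Lemma chain_torsion C0 C m0 m : cut C0 -> cut C -> C0 `<=` C ->
  (forall D, cut D -> C0 `<=` D -> D `<=` C -> exists2 k, k <> 1 & tr k D = D) ->
  tr m0 C0 = C0 -> tr m C = C -> torsion (m * m0).
Proof.
move=> cC0 cC C0C st m0C; have [[x C0x] _] := cut_proper cC0.
have [_ [y nCy]] := cut_proper cC.
pose I B := [set D | [/\ cut D, C0 `<=` D & D `<=` B]].
have fI B : B `<=` C -> finite_set (I B).
  move=> BC; apply: sub_finite_set (cut_discrete x y) => D [cD h1 h2]; split=> //.
    exact: h1.
  by move=> Dy; apply: nCy; apply/BC/h2.
have [n] := ubnP (ncard (I C)); elim: n C cC C0C st nCy fI m => // n IH C cC C0C st nCy fI m lt mC.
have [eC|neC] := pselect (C0 = C).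
  apply: (@cut_vertex_torsion (tov cut C)); first exact: cut_vertex.
  by rewrite -troM !stab_vertex// -eC.
have fJ : finite_set [set D | I C D /\ D <> C].
  by apply: sub_finite_set (fI C _) => // D [].
have [|D [[cD C0D DC] nDC] mx] := maximal_exists (C0 := C0) fJ; first by split=> //; split.
have [k k1 kD] := st D cD C0D DC.
have tkm : torsion (m * k).
  have eT : tov cut C = tov cut (~` D).
    by apply: consecutive_vertex => // E cE DE EC nE; apply: mx => //; split=> //; split=> //; exact: subset_trans DE.
  apply: (@cut_vertex_torsion (tov cut C)); first exact: cut_vertex.
  rewrite -troM {1}eT stab_vertex; last by rewrite trC kD.
  by rewrite -eT stab_vertex.
have tk0 : torsion (k * m0).
  apply: (IH D) => //.
  - by move=> E cE h1 h2; apply: st => //; apply: subset_trans DC.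
  - by move=> Dy; apply/nCy/DC.
  - by move=> B BD; apply: fI; apply: subset_trans DC.
  rewrite ltnS in lt; apply: leq_trans lt.
  have sub : C |` I D `<=` I C.
    by move=> E [->//|[cE h1 h2]]; split=> //; apply: subset_trans DC.
  rewrite -(ncard_setU1 (x := C)); [exact: ncard_sub (fI C _) sub|exact: fI|].
  by move=> [_ _ CD]; apply: nDC; apply/seteqP.
apply: (torsion_trans (b := k)) => //.
- exact: stab_torsion mC.
- exact: stab_torsion kD.
- exact: stab_torsion m0C.
Qed.

Definition freecut : set (set G) :=
  [set C | cut C /\ forall g, tr g C = C -> g = 1].

Lemma freecut_sep g : ~ torsion g -> exists2 C, freecut C & sep C (1, g).
Proof.
move=> ng; apply: contrapT => no.
have [C [cC eC eC']] : exists C, [/\ cut C, ev C 1 g & ev (~` C) 1 g^-1].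
  have [C cC [[h1 h2]|[h1 h2]]] := cut_sep 1 ng; [by exists C|exists (~` C)].
  by rewrite setCK; split=> //; apply: cutC.
have gC : tr g C `<=` C by apply: (sep_shift (N := cut)).
have e1 : ev (tr g C) 1 g by have := ev_shift eC; rewrite mul1g invg1 mulg1.
have st D : cut D -> tr g C `<=` D -> D `<=` C -> exists2 k, k <> 1 & tr k D = D.
  move=> cD h1 h2; apply: contrapT => nk; apply: no; exists D.
    by split=> // k kD; apply: contrapT => k1; apply: nk; exists k.
  by left; split; [exact: ev_sub h1 e1|apply: ev_sub (subsetC h2) eC'].
have [//|m m1 mC] := st C cC gC.
(* [mk k] is [g^k m g^-k], which stabilizes the translate of [C] by [g^k]. *)
pose mk k := m ^ (g ^- k).
have mkE k : mk k.+1 = (mk k) ^ g^-1 by rewrite /mk -conjgM -invgM -expgS.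
have tm : torsion m := stab_torsion cC mC.
have mk1 k : mk k <> 1 by move=> /eqP; rewrite conjg_eq1 => /eqP.
have tmk k : torsion (mk k) by apply/torsionJ.
have t01 : torsion (m * mk 1%N).
  apply: (chain_torsion (C0 := tr g C) (C := C)) => //; first exact: cut_tr.
  by rewrite /mk expg1 conjgE invgK trM -!mulgA mulVg mulg1 -trM mC.
have tS k : torsion (mk k * mk k.+1).
  elim: k => [|k IH]; first by rewrite {1}/mk expg0 invg1 conjg1.
  by rewrite mkE (mkE k.+1) -conjMg; apply/torsionJ.
have t0 k : torsion (m * mk k).
  elim: k => [|k IH].
    rewrite /mk expg0 invg1 conjg1 -expg2.
    by have [n n0 en] := tm; exists n => //; rewrite -expgnA mulnC expgnA en expg1n.
  exact: (torsion_trans (b := mk k)).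
(* The constant bounds [len (mk k)] by [torsion_ball] for [m], and then [len (g ^+ k)] by
   [torsion_commute] for [mk k * g ^+ k = g ^+ k * m]. *)
apply: ng; apply: (bounded_torsion (B := 5 * (10 * len m + 3 * fixC sigma + 4 * K + 2 * sigma) + len m + K.*2 + sigma)%N).
move=> k; have e : mk k * g ^+ k = g ^+ k * m.
  by rewrite /mk conjgE invgK -!mulgA mulVg mulg1.
have := torsion_commute reducing confl sigmaP (tmk k) (mk1 k) e.
have := torsion_ball reducing confl sigmaP tm m1 (tmk k) (t0 k).
by glia G.
Qed.

Theorem transitive_plain : plain G.
Proof.
have fC C : freecut C -> freecut (~` C).
  move=> [cC sC]; split=> [|g e]; first exact: cutC.
  by apply: sC; rewrite -(setCK C) trC e.
have ft g C : freecut C -> freecut (tr g C).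
  move=> [cC sC]; split=> [|k e]; first exact: cut_tr.
  have /sC/eqP : tr (k ^ g) C = C by rewrite conjgE -!trM e trK.
  by rewrite conjg_eq1 => /eqP.
have fn C D : freecut C -> freecut D -> ~ cross C D.
  by move=> [cC _] [cD _]; apply: cut_nested.
have fp C : freecut C -> C !=set0 /\ ~` C !=set0 by move=> [cC _]; apply: cut_proper.
have fd x y : finite_set [set C | [/\ freecut C, C x & ~ C y]].
  by apply: sub_finite_set (cut_discrete x y) => C [[]].
have [L fL LO] := cut_orbits letters_inv letters_gen small_cuts.
apply: (@plain_of_tree G freecut fC ft fn fp fd _ L fL).
- by move=> C g [_ sC] /sC.
- by move=> C [cC _]; apply: LO.
move=> o vo; pose H := [set g | tro g o = o].
have tH g : H g -> torsion g.
  move=> go; apply: contrapT => ng; have [C FC sC] := freecut_sep ng.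
  exact: (fixed_vertex_ends fC ft fn vo go FC ng sC).
have HM g k : H g -> H k -> H (g * k) by rewrite /H /= -troM => eg ek; rewrite ek.
(* A vertex stabilizer consists of torsion elements. If it contains some [b <> 1], all of it lies in
   the ball that [torsion_ball] attaches to [b]. *)
have [[b Hb b1]|no] := pselect (exists2 b, H b & b <> 1); last first.
  apply: (@sub_finite_set _ _ [set 1]); last exact: finite_set1.
  by move=> g Hg; apply: contrapT => g1; apply: no; exists g.
apply: sub_finite_set (ball_finite _) => c Hc.
exact: (torsion_ball reducing confl sigmaP (tH _ Hb) b1 (tH _ Hc) (tH _ (HM _ _ Hb Hc))).
Qed.

End FiniteSystem.

(** * Plain groups have no certificates *)

Section ReducedWords.
Variables (I : choiceType) (K : I -> groupType).
Local Open Scope group_scope.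
Local Notation X := {i : I & K i}.
Local Notation letter i x := (Tagged (fun i => K i : Type) (x : K i)).
Local Notation P := (free_product K).
Local Notation cls := (word_class (@free_product_inverse_closed I K)).
Implicit Types (u v w : seq X) (a b : X).

(** The value is 1 for a letter of another factor. *)
Definition comp i a : K i := @tagged_as I (fun i => K i : Type) (letter i 1) a.

Lemma compE i (x : K i) : comp i (letter i x) = x.
Proof. by rewrite /comp /tagged_as; case: eqP => // e; rewrite eq_axiomK. Qed.

Lemma letter_comp i a : tag a = i -> a = letter i (comp i a).
Proof. by case: a => j y /= <-; rewrite compE. Qed.

Definition reduced_word w :=
  sorted (fun a b => tag a != tag b) w && all (fun a => tagged a != 1) w.

Definition ncons i (x : K i) w := if x == 1 then w else letter i x :: w.

(** Van der Waerden's action on reduced words. Applied to the empty word, a reduced word returns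
    itself, so a nonempty one never represents 1. *)
Definition act i (x : K i) w :=
  if w is a :: w' then
    if tag a == i then ncons (x * comp i a) w' else ncons x w
  else ncons x w.

Definition starts_off i w := if w is a :: _ then tag a != i else true.

Lemma act_off i (x : K i) w : starts_off i w -> act x w = ncons x w.
Proof. by case: w => //= a w /negbTE ->. Qed.

Lemma act_on i (x y : K i) w : act x (letter i y :: w) = ncons (x * y) w.
Proof. by rewrite /= eqxx compE. Qed.

Lemma reduced_cons a w :
  reduced_word (a :: w) = [&& tagged a != 1, starts_off (tag a) w & reduced_word w].
Proof.
rewrite /reduced_word; case: w => [|b w] /=; first by rewrite andbT.
rewrite [tag a == _]eq_sym; case: (tag b != _) => //=; last by rewrite andbF.
by rewrite andbCA.
Qed.

Lemma head_cases i w : reduced_word w -> starts_off i w \/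
  exists x w', [/\ w = letter i x :: w', x != 1, starts_off i w' & reduced_word w'].
Proof.
case: w => [|a w]; first by left.
rewrite reduced_cons => /and3P[a1 sw rw].
have [e|] := eqVneq (tag a) i; last by left.
have := letter_comp e; move: (comp i a) => x ea.
by rewrite ea in a1 sw *; right; exists x, w; split.
Qed.

Lemma reduced_ncons i (x : K i) w : reduced_word w -> starts_off i w ->
  reduced_word (ncons x w).
Proof.
by move=> rw sw; rewrite /ncons; case: eqP => // /eqP x1; rewrite reduced_cons /= x1 sw.
Qed.

Lemma reduced_act i (x : K i) w : reduced_word w -> reduced_word (act x w).
Proof.
move=> rw; have [sw|[y [w' [-> y1 sw' rw']]]] := head_cases i rw.
  by rewrite act_off// reduced_ncons.
by rewrite act_on reduced_ncons.
Qed.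

Lemma actM i (x y : K i) w : reduced_word w -> act x (act y w) = act (x * y) w.
Proof.
move=> rw; have [sw|[z [w' [-> z1 sw rw']]]] := head_cases i rw.
  rewrite !(act_off _ sw) [ncons y w]/ncons; case: eqP => [->|y1].
    by rewrite mulg1 act_off.
  by rewrite act_on.
rewrite !act_on [ncons (y * z) w']/ncons; case: eqP => [yz|yz].
  by rewrite act_off// -mulgA yz mulg1.
by rewrite act_on mulgA.
Qed.

Lemma act1 i w : reduced_word w -> act (1 : K i) w = w.
Proof.
move=> rw; have [sw|[z [w' [-> z1 sw rw']]]] := head_cases i rw.
  by rewrite act_off// /ncons eqxx.
by rewrite act_on mul1g /ncons (negbTE z1).
Qed.

Fixpoint act_word w v := if w is a :: w' then act (tagged a) (act_word w' v) else v.

Lemma act_word_cat u w v : act_word (u ++ w) v = act_word u (act_word w v).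
Proof. by elim: u => //= a u ->. Qed.

Lemma reduced_act_word w v : reduced_word v -> reduced_word (act_word w v).
Proof. by move=> rv; elim: w => //= a w IH; apply: reduced_act. Qed.

Lemma act_word_equiv w w' v : rw_equiv (@free_product_rule I K) w w' ->
  reduced_word v -> act_word w v = act_word w' v.
Proof.
move=> e rv; elim: e => [{}w {}w' [a [b [l [r [lr -> ->]]]]]|//|{}w {}w' _ ->//|{}w {}w' x _ -> _ -> //].
rewrite !act_word_cat; congr act_word; have := reduced_act_word b rv.
case: lr => [i x y|i] rb /=; first by rewrite actM.
by rewrite act1.
Qed.

Lemma act_word_reduced w : reduced_word w -> act_word w [::] = w.
Proof.
elim: w => // a w IH; rewrite reduced_cons => /and3P[a1 sw rw] /=.
rewrite IH// act_off// /ncons (negbTE a1).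
by case: (a).
Qed.

Lemma reduced_eq1 w : reduced_word w -> cls w = 1 -> w = [::].
Proof.
move=> rw /word_classP e; rewrite -(act_word_reduced rw).
by rewrite (act_word_equiv e).
Qed.

Lemma reduced_exists (p : P) : exists2 w, reduced_word w & p = cls w.
Proof.
rewrite -(word_classK p); elim: (generic_quotient.repr p) => [|[i x] w [v rv e]].
  by exists [::].
exists (act x v); first exact: reduced_act.
have -> : cls (letter i x :: w) = emb x * cls v by rewrite -e -word_class_cons.
have ncls (y : K i) u : cls (ncons y u) = emb y * cls u.
  rewrite /ncons; case: eqP => [->|_]; first by rewrite emb1 mul1g.
  by rewrite -word_class_cons.
have [sv|[z [v' [-> z1 sv' rv']]]] := head_cases i rv.
  by rewrite act_off// ncls.
by rewrite act_on ncls word_class_cons embM mulgA.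
Qed.

Lemma emb_eq1 i (x : K i) : emb x = 1 -> x = 1.
Proof.
move=> e; apply/eqP; apply: contraT => x1.
have : reduced_word [:: letter i x] by rewrite reduced_cons /= x1.
by move=> /reduced_eq1/(_ e).
Qed.

Lemma reduced_cat w v : reduced_word w -> reduced_word v ->
  (w = [::] \/ v = [::] \/ exists i, starts_off i v /\ exists w' a, w = rcons w' a /\ tag a = i) ->
  reduced_word (w ++ v).
Proof.
elim: w => // a w IH; rewrite reduced_cons cat_cons => /and3P[a1 sw rw] rv h.
rewrite reduced_cons a1 /=; case: w IH sw rw h => [|b w] IH sw rw h.
  case: h => [//|[->//|[i [sv [[|c w'] [d []]]]]]] /=; last by case: w'.
  by case=> -> e; rewrite e sv rv.
move: sw => /= -> /=; apply: IH => //; case: h => [//|[->|]]; first by right; left.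
move=> [i [sv [[|c w'] [d [e di]]]]]; first by case: w e {rw}.
by right; right; exists i; split=> //; case: e => _ e; exists w', d.
Qed.

(** When the first and last letters belong to different factors, all powers of the word are
    reduced. *)
Lemma cyclic_power w a w' b : reduced_word w -> w = a :: w' -> last a w' = b ->
  tag a != tag b -> ~ torsion (cls w : P).
Proof.
move=> rw ew lb ab [n n0 e].
have pw k : reduced_word (flatten (nseq k w)).
  elim: k => // k IH /=; apply: reduced_cat => //; right.
  case: k {IH} => [|k]; [by left|right]; exists (tag b); split; first by rewrite ew.
  exists (belast a w'), b; split=> //; rewrite ew -lb; exact: lastI.
have := reduced_eq1 (pw n); rewrite cls_flatten e => /(_ erefl).
by case: (n) n0 => // k _; rewrite ew.
Qed.

Lemma reduced_rcons w i (x : K i) : reduced_word (rcons w (letter i x)) =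
  [&& reduced_word w, x != 1 & if w is a :: w' then tag (last a w') != i else true].
Proof.
elim: w => [|a w IH]; first by rewrite reduced_cons /= andbT.
rewrite rcons_cons !reduced_cons IH; case: w {IH} => [|b w] /=.
  by rewrite [i == tag a]eq_sym !andbT (andbC (x != 1)) andbA.
by rewrite !andbA.
Qed.

Lemma mul_right w i (x : K i) a : reduced_word (a :: w) -> tag a != i ->
  exists w', reduced_word (a :: w') /\ cls (a :: w) * emb x = cls (a :: w').
Proof.
have cr v (y : K i) : cls (rcons v (letter i y)) = cls v * emb y by rewrite -cats1 cls_cat.
have off v : reduced_word (a :: v) -> tag (last a v) != i ->
    exists w', reduced_word (a :: w') /\ cls (a :: v) * emb x = cls (a :: w').
  move=> rv lv; have [->|x1] := eqVneq x 1; first by exists v; rewrite emb1 mulg1.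
  exists (rcons v (letter i x)); rewrite -rcons_cons reduced_rcons rv x1 lv.
  by rewrite cr.
case/lastP: w => [|w b] rw ai; first exact: off.
have [bi|bi] := eqVneq (tag b) i; last by apply: off => //; rewrite last_rcons.
rewrite (letter_comp bi) -rcons_cons in rw *; move: rw.
rewrite reduced_rcons => /and3P[rw _ lw]; rewrite cr -mulgA -embM.
have [->|z1] := eqVneq (comp i b * x) 1; first by exists w; rewrite emb1 mulg1.
exists (rcons w (letter i (comp i b * x))); rewrite -rcons_cons reduced_rcons rw z1 lw.
by rewrite cr.
Qed.

(** Cyclic reduction: if the first and last letters belong to the same factor, conjugation merges
    them and shortens the word; otherwise [cyclic_power] contradicts torsion. *)
Lemma torsion_emb (b : P) : torsion b -> b <> 1 ->
  exists i (x : K i) (u : P), b = emb x ^ u.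
Proof.
have [w rw ->] := reduced_exists b; have [n] := ubnP (size w).
elim: n w rw => // n IH [|a w] rw lt tb b1; first by case: b1.
case/lastP: w rw lt tb b1 => [|w c] rw lt tb b1.
  by case: a rw lt tb b1 => i x *; exists i, x, 1; rewrite conjg1.
have [ac|ac] := eqVneq (tag a) (tag c); last first.
  by case: (cyclic_power rw erefl (last_rcons _ _ _) ac tb).
case: a ac rw lt tb b1 => i x /= /esym ci; rewrite (letter_comp ci) => rw lt tb b1.
have e : cls (letter i x :: rcons w (letter i (comp i c))) =
    (cls w * emb (comp i c * x)) ^ (emb x)^-1.
  rewrite -cats1 word_class_cons cls_cat conjgE invgK embM !mulgA.
  by rewrite mulgK.
have := rw; rewrite reduced_cons => /and3P[x1 + rwc].
case: w lt rw rwc e tb b1 => [|a w] lt rw rwc e tb b1 /=; first by rewrite eqxx.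
move=> ai; have rw' : reduced_word (a :: w).
  by move: rwc; rewrite reduced_rcons => /andP[].
have [w' [rw2 e2]] : exists w', (reduced_word w' /\ size w' < n) /\
    cls (a :: w) * emb (comp i c * x) = cls w'.
  have [->|y1] := eqVneq (comp i c * x) 1.
    by exists (a :: w); rewrite emb1 mulg1; split=> //; split=> //; move: lt; rewrite /= size_rcons; lia.
  exists (rcons (a :: w) (letter i (comp i c * x))); split; last first.
    by rewrite -cats1 cls_cat.
  split; last by move: lt; rewrite /= !size_rcons; lia.
  by rewrite reduced_rcons rw' y1; move: rwc; rewrite reduced_rcons => /and3P[].
rewrite e e2 in tb b1 *; have [rw3 sw'] := rw2.
have [||j [y [u ->]]] := IH w' rw3 sw'.
- by apply/(torsionJ _ (emb x)^-1).
- by move=> q; apply: b1; rewrite q conj1g.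
by exists j, y, (u * (emb x)^-1); rewrite conjgM.
Qed.

(** Suppose [a] begins outside factor [i]. If it ends in factor [i], [a] is cyclically reduced;
    otherwise [x a] is. Either way [cyclic_power] applies. A first letter [z] in factor [i] is
    removed by conjugation, which replaces [x] by [x ^ z]. *)
Lemma torsion_same_factor i (x : K i) (a : P) : x <> 1 -> torsion a ->
  torsion (emb x * a) -> exists z : K i, a = emb z.
Proof.
move=> /eqP x1 ta txa.
have off (y : K i) b w : y != 1 -> reduced_word (b :: w) -> tag b != i ->
    torsion (cls (b :: w) : P) -> torsion (emb y * cls (b :: w)) -> False.
  move=> y1 rw bi tw; rewrite -word_class_cons.
  have [li|li] := eqVneq (tag (last b w)) i; last first.
    apply: (cyclic_power _ erefl (last_cons _ _ _)) => //=; last by rewrite eq_sym.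
    by rewrite reduced_cons /= y1 bi.
  by move=> _; apply: (cyclic_power rw erefl erefl) tw; rewrite li.
have [w rw ea] := reduced_exists a; rewrite ea in ta txa *.
have [|[z [w' [ew z1 sw' rw']]]] := head_cases i rw.
  case: w rw ta txa {ea} => [|b w] rw ta txa /=; first by exists 1; rewrite emb1.
  by move=> bi; case: (off x b w).
case: w' ew sw' rw' => [|b w'] ew sw' rw'; first by exists z; rewrite ew.
have [w2 [rw2 e2]] := @mul_right _ _ z _ rw' sw'.
have e3 : cls w ^ emb z = cls (b :: w2).
  by rewrite -e2 ew word_class_cons conjgE -mulgA mulKg.
case: (off (x ^ z) b w2) => //.
- by rewrite conjg_eq1.
- by rewrite -e3; apply/torsionJ.
have ez : emb (x ^ z) = emb x ^ emb z.
  have eV : emb z^-1 = (emb z)^-1 by apply/esym/mulg1_eq; rewrite -embM mulgV emb1.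
  by rewrite !conjgE !embM eV.
by rewrite ez -e3 -conjMg; apply/torsionJ.
Qed.

End ReducedWords.

Lemma isomorphic_witness (G H : groupType) (a b c : G) : isomorphic G H ->
  witness a b c -> exists a b c : H, witness a b c.
Proof.
move=> [f [f1 fM] [f' fK fK']] w.
have fX g n : f (g ^+ n)%g = (f g ^+ n)%g.
  by elim: n => // n IH; rewrite !expgS fM IH.
have tf g : torsion (f g) <-> torsion g.
  split=> -[n n0 e]; exists n => //; last by rewrite -fX e.
  by apply: (can_inj fK); rewrite fX e f1.
exists (f a), (f b), (f c); rewrite /witness -!fM; move: w.
move=> [ta tb tc b1 [tab tbc tac]]; split; try exact/tf.
  by move=> e; apply: b1; apply: (can_inj fK); rewrite e f1.
by split; try exact/tf; move=> /tf.
Qed.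

Lemma plain_transitive (G : groupType) : plain G -> forall a b c : G, ~ witness a b c.
Proof.
move=> [n [k [F iso]]] a b c /(isomorphic_witness iso)[{}a [{}b [{}c]]].
move=> [ta tb tc b1 [tab tbc tac]].
have [i [x [u eb]]] := torsion_emb tb b1.
have x1 : x <> 1%g by move=> e; apply: b1; rewrite eb e emb1 conj1g.
have tJ g : torsion g -> torsion (g ^ u^-1)%g by move=> tg; apply/torsionJ.
have ebu : (b ^ u^-1)%g = emb x by rewrite eb conjgK.
have [z ez] : exists z : plain_factor F i, (a ^ u^-1)%g = emb z.
  apply: (torsion_same_factor x1); first exact: tJ.
  by rewrite -ebu -conjMg; apply/tJ/torsionMC.
have [z' ez'] : exists z : plain_factor F i, (c ^ u^-1)%g = emb z.
  apply: (torsion_same_factor x1); first exact: tJ.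
  by rewrite -ebu -conjMg; apply/tJ.
apply: tac; apply/(torsionJ _ u^-1%g); rewrite conjMg ez ez' -embM.
have eX j (y : plain_factor F j) m : emb (y ^+ m)%g = (emb y ^+ m)%g.
  by elim: m => [|m IH]; rewrite ?emb1// !expgS embM IH.
(* A nontrivial torsion element in factor [i] rules out an infinite cyclic factor; in a finite one
   every product is torsion. *)
have tx : torsion x.
  have [m m0 e] := tJ _ tb; exists m => //; apply: emb_eq1.
  by rewrite eX -ebu.
suff [m m0 e] : torsion (z * z')%g by exists m => //; rewrite -eX e emb1.
case: i x x1 z z' tx {eb ebu ez ez'} => [i|j] x x1 z z' [m m0 e].
  by exists #[z * z' : F i]%g; [exact: order_gt0|exact: expg_order].
case: x1; move: e; rewrite /= => e.
have : ((x : int) *+ m = 0)%R by exact: e.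
by move/eqP; rewrite Num.Theory.mulrn_eq0 -leqn0 leqNgt m0 /= => /eqP.
Qed.

(** * Stack programs on Turing machines *)

Local Notation sym := (bool + void)%type.
Local Notation reg := 'I_6.
Local Notation tapes := (reg -> tape sym).
Local Notation reads := (reg -> option sym).
Local Notation actions := (reg -> option sym * move).

(* Machine fragments: [None] as a next state means that the fragment exits. *)
Record frag := Frag {
  fstate : finType;
  fstart : fstate;
  ftrans : fstate -> reads -> option fstate * actions }.

Definition do_acts (tau : tapes) (a : actions) : tapes := fun i => tape_act (tau i) (a i).

Definition fstep (M : frag) (c : option (fstate M) * tapes) : option (fstate M) * tapes :=
  if c.1 is Some q then
    let: (q', a) := ftrans q (fun i => t_cur (c.2 i)) in (q', do_acts c.2 a)
  else c.

Definition exec M (tau tau' : tapes) n :=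
  iter n (@fstep M) (Some (fstart M), tau) = (None, tau').

Lemma iter_exit M n tau : iter n (@fstep M) (None, tau) = (None, tau).
Proof. by elim: n => //= n ->. Qed.

Lemma exec_le M tau tau' n n' : n <= n' -> exec M tau tau' n -> exec M tau tau' n'.
Proof. by move=> /subnK <-; rewrite /exec iterD => ->; rewrite iter_exit. Qed.

Definition idle (r : reads) : actions := fun i => (r i, Stay).

Lemma do_idle tau : do_acts tau (idle (fun i => t_cur (tau i))) = tau.
Proof. by apply/funext => i; rewrite /do_acts /tape_act /=; case: (tau i). Qed.

Definition seqF M1 M2 := @Frag (fstate M1 + fstate M2)%type (inl (fstart M1))
  (fun q r => match q with
   | inl q1 => let: (q', a) := ftrans q1 r in
       (Some (if q' is Some q1' then inl q1' else inr (fstart M2)), a)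
   | inr q2 => let: (q', a) := ftrans q2 r in (omap inr q', a)
   end).

Definition ifF (t : reads -> bool) M1 M2 :=
  @Frag (option (fstate M1 + fstate M2))%type None
  (fun q r => match q with
   | None => (Some (Some (if t r then inl (fstart M1) else inr (fstart M2))), idle r)
   | Some (inl q1) => let: (q', a) := ftrans q1 r in (omap (Some \o inl) q', a)
   | Some (inr q2) => let: (q', a) := ftrans q2 r in (omap (Some \o inr) q', a)
   end).

Definition whileF (t : reads -> bool) M := @Frag (option (fstate M)) None
  (fun q r => match q with
   | None => (if t r then Some (Some (fstart M)) else None, idle r)
   | Some q1 => let: (q', a) := ftrans q1 r in (Some q', a)
   end).

Definition skipF := @Frag unit tt (fun _ r => (None, idle r)).

Lemma fstepE M q tau : @fstep M (Some q, tau) =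
  ((ftrans q (fun i => t_cur (tau i))).1, do_acts tau (ftrans q (fun i => t_cur (tau i))).2).
Proof. by rewrite /fstep /=; case: ftrans. Qed.

(** Simulation of [M] inside [M'], with the exit of [M] redirected to [e]. The number of steps may
    drop, since [M] may have exited before step [n] while [M'] goes on from [e]. *)
Lemma iter_embed M M' (f : fstate M -> fstate M') (e : option (fstate M')) :
  (forall q r, ftrans (f q) r =
     (if (ftrans q r).1 is Some q' then Some (f q') else e, (ftrans q r).2)) ->
  forall n q tau tau', iter n (@fstep M) (Some q, tau) = (None, tau') ->
  exists2 n', n' <= n & iter n' (@fstep M') (Some (f q), tau) = (e, tau').
Proof.
move=> ft; elim=> [//|n IH] q tau tau'; rewrite iterSr fstepE.
have := fstepE (f q) tau; rewrite ft.
case: (ftrans q _) => -[q'|] a /= fe.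
  by move=> /IH[n' n'n hn']; exists n'.+1 => //; rewrite iterSr fe.
by rewrite iter_exit => -[<-]; exists 1%N.
Qed.

Lemma exec_seq M1 M2 tau tau1 tau2 n1 n2 : exec M1 tau tau1 n1 ->
  exec M2 tau1 tau2 n2 -> exec (seqF M1 M2) tau tau2 (n1 + n2).
Proof.
move=> /(iter_embed (M' := seqF M1 M2) (f := inl) (e := Some (inr (fstart M2)))) h1.
move=> /(iter_embed (M' := seqF M1 M2) (f := inr) (e := None)) h2.
have [|n1' l1 e1] := h1; first by move=> q r /=; case: (ftrans q r) => -[].
have [|n2' l2 e2] := h2; first by move=> q r /=; case: (ftrans q r) => -[].
apply: (@exec_le _ _ _ (n2' + n1')); first by rewrite addnC leq_add.
by rewrite /exec iterD e1.
Qed.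

Lemma exec_if t M1 M2 tau tau' n :
  exec (if t (fun i => t_cur (tau i)) then M1 else M2) tau tau' n ->
  exec (ifF t M1 M2) tau tau' n.+1.
Proof.
move=> h; rewrite /exec iterSr fstepE /= do_idle; move: h; case: ifP => _.
  move=> /(iter_embed (M' := ifF t M1 M2) (f := Some \o inl) (e := None))[].
    by move=> q r /=; case: (ftrans q r) => -[].
  by move=> n' /subnK <- e; rewrite iterD e; exact (@iter_exit (ifF t M1 M2) _ _).
move=> /(iter_embed (M' := ifF t M1 M2) (f := Some \o inr) (e := None))[].
  by move=> q r /=; case: (ftrans q r) => -[].
by move=> n' /subnK <- e; rewrite iterD e; exact (@iter_exit (ifF t M1 M2) _ _).
Qed.

Lemma exec_while_done t M tau : t (fun i => t_cur (tau i)) = false ->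
  exec (whileF t M) tau tau 1.
Proof. by rewrite /exec /= /fstep /= do_idle => ->. Qed.

Lemma exec_while_step (t : reads -> bool) M tau tau1 tau2 n1 n2 : t (fun i => t_cur (tau i)) ->
  exec M tau tau1 n1 -> exec (whileF t M) tau1 tau2 n2 ->
  exec (whileF t M) tau tau2 (n1 + n2).+1.
Proof.
move=> ht /(iter_embed (M' := whileF t M) (f := Some) (e := Some None))[].
  by move=> q r /=; case: (ftrans q r) => -[].
move=> n' l e h; apply: (@exec_le _ _ _ (n2 + n').+1); first by rewrite ltnS addnC leq_add2r.
by rewrite /exec iterSr fstepE /= do_idle ht iterD e.
Qed.

(* A tape represents the stack read from its head to the right. *)
Definition rep (t : tape sym) (s : seq bool) :=
  [/\ t_cur t = omap inl (ohead s),
      exists n, t_right t = map (Some \o inl) (behead s) ++ nseq n None &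
      exists m, t_left t = nseq m None].

Local Notation store := (reg -> seq bool).

Definition Rep (tau : tapes) (st : store) := forall i, rep (tau i) (st i).

Variant sexec M (st st' : store) n : Prop := Sexec of forall tau, Rep tau st ->
  exists2 tau', Rep tau' st' & exec M tau tau' n.

Definition get_bit (o : option sym) : option bool :=
  if o is Some (inl b) then Some b else None.

Definition test (t : (reg -> option bool) -> bool) : reads -> bool :=
  fun r => t (fun i => get_bit (r i)).

Lemma test_Rep t tau st : Rep tau st ->
  test t (fun i => t_cur (tau i)) = t (fun i => ohead (st i)).
Proof.
move=> h; congr t; apply/funext => i; have [-> _ _] := h i.
by case: (st i).
Qed.

Lemma sexec_le M st st' n n' : n <= n' -> sexec M st st' n -> sexec M st st' n'.
Proof. by move=> l [h]; split=> tau /h[tau' r e]; exists tau' => //; apply: exec_le e. Qed.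

Lemma sexec_leq M st st' n n' : sexec M st st' n -> n <= n' -> sexec M st st' n'.
Proof. by move=> h l; apply: sexec_le l h. Qed.

Lemma sexec_eq M st st' st'' n : sexec M st st' n -> st' =1 st'' -> sexec M st st'' n.
Proof. by move=> [h] e; split=> tau /h[tau' r k]; exists tau' => // i; rewrite -e. Qed.

Lemma sexec_seq M1 M2 st st1 st2 n1 n2 : sexec M1 st st1 n1 -> sexec M2 st1 st2 n2 ->
  sexec (seqF M1 M2) st st2 (n1 + n2).
Proof.
by move=> [h1] [h2]; split=> tau /h1[tau1 /h2[tau2 r e2] e1]; exists tau2 => //; apply: exec_seq e1 e2.
Qed.

Lemma sexec_if t M1 M2 st st' n :
  sexec (if t (fun i => ohead (st i)) then M1 else M2) st st' n ->
  sexec (ifF (test t) M1 M2) st st' n.+1.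
Proof.
move=> [h]; split=> tau r; have [tau' r' e] := h tau r; exists tau' => //.
by apply: exec_if; rewrite (test_Rep _ r).
Qed.

Lemma sexec_ifT (t : (reg -> option bool) -> bool) M1 M2 st st' n :
  t (fun i => ohead (st i)) -> sexec M1 st st' n -> sexec (ifF (test t) M1 M2) st st' n.+1.
Proof. by move=> e h; apply: sexec_if; rewrite e. Qed.

Lemma sexec_ifN (t : (reg -> option bool) -> bool) M1 M2 st st' n :
  t (fun i => ohead (st i)) = false -> sexec M2 st st' n -> sexec (ifF (test t) M1 M2) st st' n.+1.
Proof. by move=> e h; apply: sexec_if; rewrite e. Qed.

Lemma sexec_while_done t M st : t (fun i => ohead (st i)) = false ->
  sexec (whileF (test t) M) st st 1.
Proof.
by move=> h; split=> tau r; exists tau => //; apply: exec_while_done; rewrite (test_Rep _ r).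
Qed.

Lemma sexec_while_step (t : (reg -> option bool) -> bool) M st st1 st2 n1 n2 : t (fun i => ohead (st i)) ->
  sexec M st st1 n1 -> sexec (whileF (test t) M) st1 st2 n2 ->
  sexec (whileF (test t) M) st st2 (n1 + n2).+1.
Proof.
move=> h [h1] [h2]; split=> tau r; have [tau1 r1 e1] := h1 tau r; have [tau2 r2 e2] := h2 tau1 r1.
by exists tau2 => //; apply: exec_while_step e1 e2; rewrite (test_Rep _ r).
Qed.

Lemma sexec_skip st : sexec skipF st st 1.
Proof. by split=> tau r; exists tau => //; rewrite /exec /= /fstep /= do_idle. Qed.

Definition upd (st : store) k v : store := fun i => if i == k then v else st i.

Definition actF (k : reg) (f : option sym -> option sym * move) :=
  @Frag unit tt (fun _ r => (None, fun i => if i == k then f (r i) else (r i, Stay))).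

Lemma exec_act k f tau : exec (actF k f) tau
  (fun i => if i == k then tape_act (tau i) (f (t_cur (tau i))) else tau i) 1.
Proof.
rewrite /exec /= /fstep /=; congr pair; apply/funext => i; rewrite /do_acts.
by case: eqP => // _; case: (tau i).
Qed.

Definition popF k := actF k (fun _ => (None, Right)).
(** An action writes before it moves, so a push first steps left over the preserved top and then
    writes. *)
Definition pushF k b :=
  seqF (actF k (fun c => (c, Left))) (actF k (fun _ => (Some (inl b), Stay))).

Lemma sexec_pop k st : sexec (popF k) st (upd st k (behead (st k))) 1.
Proof.
split=> tau r; eexists; last exact: exec_act.
move=> i; rewrite /upd; case: eqP => // ->; have [h1 [n h2] [m h3]] := r k.
case: (tau k) h1 h2 h3 => l c rt /= _ -> ->; split=> /=; last by exists m.+1.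
- by case: (st k) => [|b [|b' s]] //=; case: n.
- case: (st k) => [|b [|b' s]] /=; last by exists n.
    by exists n.-1; case: n.
  by exists n.-1; case: n.
Qed.

Lemma sexec_push k b st : sexec (pushF k b) st (upd st k (b :: st k)) 2.
Proof.
split=> tau r; eexists; last by apply: (@exec_seq _ _ _ _ _ 1 1); exact: exec_act.
move=> i; rewrite /upd /=; case: eqP => // ->; have [h1 [n h2] [m h3]] := r k.
case: (tau k) h1 h2 h3 => l c rt /= -> -> ->; split=> //=.
- case: (st k) => [|b' s] /=; last by exists n.
  by exists n.+1.
- by exists m.-1; case: m.
Qed.

(** X is the input, U the certificate, S the main stack of serialized trees, A and B are buffers,
    and C is a counter. *)
Definition rX : reg := @Ordinal 6 0 isT.
Definition rU : reg := @Ordinal 6 1 isT.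
Definition rS : reg := @Ordinal 6 2 isT.
Definition rA : reg := @Ordinal 6 3 isT.
Definition rB : reg := @Ordinal 6 4 isT.
Definition rC : reg := @Ordinal 6 5 isT.

Definition mk x u s a b c : store := fun i => nth [::] [:: x; u; s; a; b; c] i.

Ltac regs :=
  let i := fresh "i" in let lt := fresh "lt" in
  move=> i; case: i => i lt;
  do 6 (case: i lt => [|i] lt; [by rewrite /= /upd /mk /= | ]); by [].

Definition pushes ds b := foldr (fun k M => seqF (pushF k b) M) skipF ds.

Definition nonempty k : (reg -> option bool) -> bool := fun r => r k != None.
Definition top_is k b : (reg -> option bool) -> bool := fun r => r k == Some b.

Definition shift k ds :=
  ifF (test (top_is k true)) (seqF (popF k) (pushes ds true)) (seqF (popF k) (pushes ds false)).
Definition pour k ds := whileF (test (nonempty k)) (shift k ds).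

Fixpoint upds (st : store) ds b : store :=
  if ds is k :: ds' then upds (upd st k (b :: st k)) ds' b else st.

Lemma sexec_pushes ds b st : sexec (pushes ds b) st (upds st ds b) (2 * size ds).+1.
Proof.
elim: ds st => [|k ds IH] st; first exact: sexec_skip.
by rewrite /=; apply: sexec_leq (sexec_seq (sexec_push k b st) (IH _)) _; lia.
Qed.

Lemma sexec_shift k ds b s st : st k = b :: s ->
  sexec (shift k ds) st (upds (upd st k s) ds b) (2 * size ds + 3).
Proof.
move=> e; have h : sexec (seqF (popF k) (pushes ds b)) st (upds (upd st k s) ds b) (2 * size ds + 2).
  apply: (@sexec_le _ _ _ (1 + (2 * size ds).+1)); first lia.
  by apply: sexec_seq (sexec_pushes _ _ _); have := sexec_pop k st; rewrite e.
apply: (@sexec_le _ _ _ (2 * size ds + 2).+1); first lia.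
by apply: sexec_if; rewrite /top_is e /=; case: b h {e}.
Qed.

Lemma pour_step k ds d s st st' st'' n : st k = d :: s ->
  upds (upd st k s) ds d =1 st' -> sexec (pour k ds) st' st'' n ->
  sexec (pour k ds) st st'' (2 * size ds + 3 + n).+1.
Proof.
move=> e e' h; apply: sexec_while_step (sexec_eq (sexec_shift ds e) e') h.
by rewrite /nonempty e.
Qed.

Section Pours.
Variables (x u c : seq bool).

Lemma pourA_S s a b :
  sexec (pour rA [:: rS]) (mk x u s a b c) (mk x u (rev a ++ s) [::] b c) (6 * size a + 1).
Proof.
elim: a s => [|d a IH] s; first exact: sexec_while_done.
rewrite rev_cons cat_rcons; apply: sexec_leq (pour_step (st' := (mk x u (d :: s) a b c)) erefl _ (IH _)) _.
  by regs.
by rewrite /=; lia.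
Qed.

Lemma pourA_SB s a b :
  sexec (pour rA [:: rS; rB]) (mk x u s a b c) (mk x u (rev a ++ s) [::] (rev a ++ b) c) (8 * size a + 1).
Proof.
elim: a s b => [|d a IH] s b; first exact: sexec_while_done.
rewrite rev_cons !cat_rcons; apply: sexec_leq (pour_step (st' := (mk x u (d :: s) a (d :: b) c)) erefl _ (IH _ _)) _.
  by regs.
by rewrite /=; lia.
Qed.

Lemma pourB_A s a b :
  sexec (pour rB [:: rA]) (mk x u s a b c) (mk x u s (rev b ++ a) [::] c) (6 * size b + 1).
Proof.
elim: b a => [|d b IH] a; first exact: sexec_while_done.
rewrite rev_cons cat_rcons; apply: sexec_leq (pour_step (st' := (mk x u s (d :: a) b c)) erefl _ (IH _)) _.
  by regs.
by rewrite /=; lia.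
Qed.

Lemma pourB_S s a b :
  sexec (pour rB [:: rS]) (mk x u s a b c) (mk x u (rev b ++ s) a [::] c) (6 * size b + 1).
Proof.
elim: b s => [|d b IH] s; first exact: sexec_while_done.
rewrite rev_cons cat_rcons; apply: sexec_leq (pour_step (st' := (mk x u (d :: s) a b c)) erefl _ (IH _)) _.
  by regs.
by rewrite /=; lia.
Qed.

Lemma pourB_0 s a b :
  sexec (pour rB [::]) (mk x u s a b c) (mk x u s a [::] c) (4 * size b + 1).
Proof.
elim: b => [|d b IH]; first exact: sexec_while_done.
apply: sexec_leq (pour_step (st' := (mk x u s a b c)) erefl _ IH) _.
  by regs.
by rewrite /=; lia.
Qed.

End Pours.

Lemma pourX_A x u s a b c :
  sexec (pour rX [:: rA]) (mk x u s a b c) (mk [::] u s (rev x ++ a) b c) (6 * size x + 1).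
Proof.
elim: x a => [|d x IH] a; first exact: sexec_while_done.
rewrite rev_cons cat_rcons; apply: sexec_leq (pour_step (st' := (mk x u s (d :: a) b c)) erefl _ (IH _)) _.
  by regs.
by rewrite /=; lia.
Qed.

(** * Programs on binary trees and their compilation *)

Inductive tree := Leaf | Node of tree & tree.

(** A prefix code, so the end of a tree on a stack is found without markers: each [true] adds one
    tree to those still to be read, each [false] completes one. *)
Fixpoint ser t : seq bool :=
  if t is Node l r then true :: ser l ++ ser r else [:: false].

Definition sz t := size (ser t).

Lemma sz_gt0 t : 0 < sz t. Proof. by case: t. Qed.

Lemma szN l r : sz (Node l r) = (sz l + sz r).+1.
Proof. by rewrite /sz /= size_cat. Qed.

Definition sers ts := flatten (map ser ts).

Definition dest (fa fb : bool) : seq reg := nseq fa rA ++ nseq fb rB.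

Definition onto (f : bool) (w a : seq bool) := if f then rev w ++ a else a.

(* Stack C counts the trees that remain to be moved. *)
Definition movesF fa fb := whileF (test (nonempty rC))
  (ifF (test (top_is rS true))
     (seqF (popF rS) (seqF (pushes (dest fa fb) true) (pushF rC true)))
     (seqF (popF rS) (seqF (pushes (dest fa fb) false) (popF rC)))).

Lemma sexec_moves fa fb n ts x u s a b : size (sers ts) = n ->
  sexec (movesF fa fb) (mk x u (sers ts ++ s) a b (nseq (size ts) true))
    (mk x u s (onto fa (sers ts) a) (onto fb (sers ts) b) [::]) (11 * n + 1).
Proof.
elim: n ts a b => [|n IH] [|t ts] a b //; try by case: t.
  by move=> _; rewrite /onto /=; case: fa; case: fb; apply: sexec_while_done.

case: t => [|l r] [sz_ts].
  have h := IH ts (onto fa [:: false] a) (onto fb [:: false] b) sz_ts.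
  have e f (w : seq bool) : onto f (sers (Leaf :: ts)) w = onto f (sers ts) (onto f [:: false] w).
    by case: f => //; rewrite /onto -[sers (Leaf :: ts)]/(false :: sers ts) rev_cons cat_rcons.
  rewrite !e; apply: sexec_leq (sexec_while_step (n1 := 9) _ _ h) _ => //; last lia.
  apply: (@sexec_le _ _ _ 9) => //.
  apply: (@sexec_ifN _ _ _ _ _ 8) => //.
  apply: (@sexec_le _ _ _ (1 + (5 + 1))) => //.
  apply: sexec_seq; first exact: sexec_pop.
  apply: (sexec_seq (n1 := 5)).
    by apply: sexec_leq (sexec_pushes _ _ _) _; case: (fa); case: (fb).
  by apply: sexec_eq (sexec_pop _ _) _; clear -fa fb; case: fa; case: fb; regs.
have h := IH (l :: r :: ts) (onto fa [:: true] a) (onto fb [:: true] b).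
have e : sers (Node l r :: ts) = true :: sers (l :: r :: ts).
  by rewrite /sers /= -catA.
have {}h := h ltac:(by move: sz_ts; rewrite /sers /= !size_cat; lia).
have e' f (w : seq bool) : onto f (sers (Node l r :: ts)) w =
    onto f (sers (l :: r :: ts)) (onto f [:: true] w).
  by rewrite e /onto; case: f => //; rewrite rev_cons cat_rcons.
rewrite !e' e; apply: sexec_leq (sexec_while_step (n1 := 9) _ _ h) _ => //; last lia.
apply: (@sexec_ifT _ _ _ _ _ 8) => //.
apply: (@sexec_le _ _ _ (1 + (5 + 2))) => //.
apply: sexec_seq; first exact: sexec_pop.
apply: (sexec_seq (n1 := 5)).
  by apply: sexec_leq (sexec_pushes _ _ _) _; case: (fa); case: (fb).
by apply: sexec_eq (sexec_push _ _ _) _; clear -fa fb; case: fa; case: fb; regs.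
Qed.

Definition moveF fa fb := seqF (pushF rC true) (movesF fa fb).

Lemma sexec_move fa fb t x u s a b :
  sexec (moveF fa fb) (mk x u (ser t ++ s) a b [::])
    (mk x u s (onto fa (ser t) a) (onto fb (ser t) b) [::]) (11 * sz t + 3).
Proof.
have h := sexec_moves fa fb (ts := [:: t]) x u s a b erefl.
rewrite /sers /= cats0 in h.
apply: (@sexec_le _ _ _ (2 + (11 * sz t + 1))); first lia.
apply: sexec_seq h; apply: sexec_eq (sexec_push _ _ _) _; regs.
Qed.

Definition dropF := moveF false false.
Definition dupF := seqF (moveF true false)
  (seqF (pour rA [:: rS; rB]) (seqF (pour rB [:: rA]) (pour rA [:: rS]))).
Definition swapF := seqF (moveF true false)
  (seqF (moveF false true) (seqF (pour rA [:: rS]) (pour rB [:: rS]))).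

Local Notation stk x u s := (mk x u s [::] [::] [::]).

Lemma sexec_drop t x u s : sexec dropF (stk x u (ser t ++ s)) (stk x u s) (11 * sz t + 3).
Proof. exact: sexec_move. Qed.

Lemma sexec_dup t x u s :
  sexec dupF (stk x u (ser t ++ s)) (stk x u (ser t ++ ser t ++ s)) (31 * sz t + 6).
Proof.
apply: (@sexec_le _ _ _ ((11 * sz t + 3) + ((8 * sz t + 1) + ((6 * sz t + 1) + (6 * sz t + 1))))).
  by lia.
apply: sexec_seq; first exact: sexec_move.
rewrite /onto cats0; have eA := size_rev (ser t).
apply: sexec_seq; first by have := pourA_SB x u [::] s (rev (ser t)) [::]; rewrite eA; apply.
rewrite revK cats0; apply: sexec_seq; first exact: pourB_A.
have := pourA_S x u [::] (ser t ++ s) (rev (ser t)) [::]; rewrite eA revK cats0; exact.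
Qed.

Lemma sexec_swap t1 t2 x u s :
  sexec swapF (stk x u (ser t1 ++ ser t2 ++ s)) (stk x u (ser t2 ++ ser t1 ++ s))
    (17 * (sz t1 + sz t2) + 8).
Proof.
apply: (@sexec_le _ _ _ ((11 * sz t1 + 3) + ((11 * sz t2 + 3) + ((6 * sz t1 + 1) + (6 * sz t2 + 1))))).
  by lia.
apply: sexec_seq; first exact: sexec_move.
apply: sexec_seq; first exact: sexec_move.
rewrite /onto !cats0; apply: sexec_seq.
  by have := pourA_S x u [::] s (rev (ser t1)) (rev (ser t2)); rewrite size_rev; apply.
have := pourB_S x u [::] (ser t1 ++ s) [::] (rev (ser t2)); rewrite revK size_rev revK; exact.
Qed.

Definition pushwF k (w : seq bool) := foldr (fun b M => seqF M (pushF k b)) skipF w.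

Lemma sexec_pushw w x u s a b c :
  sexec (pushwF rS w) (mk x u s a b c) (mk x u (w ++ s) a b c) (2 * size w + 1).
Proof.
elim: w => [|d w IH]; first exact: sexec_skip.
apply: (@sexec_le _ _ _ (2 * size w + 1 + 2)); first by rewrite /=; lia.
apply: sexec_seq IH _; apply: sexec_eq (sexec_push _ _ _) _; regs.
Qed.

Lemma sexec_popS d x u s a b c : sexec (popF rS) (mk x u (d :: s) a b c) (mk x u s a b c) 1.
Proof. apply: sexec_eq (sexec_pop _ _) _; regs. Qed.

Lemma ser_cat_inj t1 t2 s1 s2 : ser t1 ++ s1 = ser t2 ++ s2 -> t1 = t2 /\ s1 = s2.
Proof.
elim: t1 t2 s1 s2 => [|l1 IHl r1 IHr] [|l2 r2] s1 s2 //=; first by case.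
by rewrite -!catA => -[/IHl[-> /IHr[-> ->]]].
Qed.

Lemma ser_inj : injective ser.
Proof. by move=> t1 t2 e; have [] := @ser_cat_inj t1 t2 [::] [::] (congr1 (cat^~ [::]) e). Qed.

HB.instance Definition _ := Equality.copy tree (inj_type ser_inj).

(** The number of rounds of [PIter] is the length of the left component, fixed on entry, so every
    program terminates. Arguments of the wrong shape evaluate to [Leaf], or select the second branch
    of [PIf]. *)
Inductive prog :=
| PId | PCar | PCdr | PEq
| PConst of tree
| PComp of prog & prog
| PPair of prog & prog
| PIf of prog & prog & prog
| PIter of prog.

Definition truth (b : bool) := if b then Node Leaf Leaf else Leaf.

(* A tree is read as the list of its left subtrees along the right spine. *)
Fixpoint spine t := if t is Node _ r then (spine r).+1 else 0.

Fixpoint eval p y := match p with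
  | PId => y
  | PCar => if y is Node l _ then l else Leaf
  | PCdr => if y is Node _ r then r else Leaf
  | PEq => if y is Node l r then truth (l == r) else Leaf
  | PConst t => t
  | PComp p q => eval p (eval q y)
  | PPair p q => Node (eval p y) (eval q y)
  | PIf c p q => if eval c y is Node _ _ then eval p y else eval q y
  | PIter p => if y is Node n z then iter (spine n) (eval p) z else Leaf
  end.

(** [m] bounds the size of the loop counter, which is charged in full in every round although it
    shrinks. *)
Fixpoint icost (f : tree -> tree) (cf : tree -> nat) m k y :=
  if k is k'.+1 then cf y + 40 * m + 17 * (sz y + sz (f y)) + 30 + icost f cf m k' (f y)
  else 0.

Fixpoint cost p y := match p with
  | PId => 1
  | PCar | PCdr => 40 * sz y + 20
  | PEq => 40 * sz y + 60
  | PConst t => 11 * sz y + 2 * sz t + 10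
  | PComp p q => cost q y + cost p (eval q y)
  | PPair p q => 48 * sz y + 17 * sz (eval q y) + 20 + cost q y + cost p y
  | PIf c p q => 31 * sz y + 11 * sz (eval c y) + 20 + cost c y +
      (if eval c y is Node _ _ then cost p y else cost q y)
  | PIter p => if y is Node n z then icost (eval p) (cost p) (sz n) (spine n) z + 10 else 10
  end.

(** Each mismatch leaves one bit on C. The trees agree if C stays empty and nothing remains on B. *)
Definition cmpF := whileF (test (nonempty rA))
  (seqF (ifF (test (fun r => r rA == r rB)) skipF (pushF rC true)) (seqF (popF rA) (popF rB))).

Lemma sexec_cmp x u s a b c : exists2 m, m <= size a /\ (m == 0) = (a == take (size a) b) &
  sexec cmpF (mk x u s a b c) (mk x u s [::] (drop (size a) b) (nseq m true ++ c)) (7 * size a + 1).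
Proof.
elim: a b c => [|d a IH] b c.
  by exists 0; [rewrite take0|rewrite drop0; apply: sexec_while_done].
have [e|ne] := boolP (Some d == ohead b).
  have [m [lm hm] h] := IH (behead b) c; exists m.
    split; first exact: leqW.
    by rewrite hm; case: b e {hm h} => //= d' b /eqP[->]; rewrite eqseq_cons eqxx.
  have -> : drop (size (d :: a)) b = drop (size a) (behead b) by case: b e {hm h}.
  apply: sexec_leq (sexec_while_step (n1 := 4) _ _ h) _ => //; last by rewrite /=; lia.
  apply: (@sexec_seq _ _ _ (mk x u s (d :: a) b c) _ 2 2).
    by apply: (@sexec_ifT _ _ _ _ _ 1) => //; apply: sexec_skip.
  apply: (@sexec_seq _ _ _ (mk x u s a b c) _ 1 1).
    by apply: sexec_eq (sexec_pop _ _) _; regs.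
  by apply: sexec_eq (sexec_pop _ _) _; regs.
have [m [lm hm] h] := IH (behead b) (true :: c); exists m.+1.
  split=> //; by case: b ne {hm h} => //= d' b; rewrite eqseq_cons => /negbTE ne; apply/esym/andP => -[/eqP e]; rewrite e eqxx in ne.
have -> : drop (size (d :: a)) b = drop (size a) (behead b) by case: b ne {hm h}.
have -> : nseq m.+1 true ++ c = nseq m true ++ true :: c by elim: m {hm h lm} => //= m <-.
apply: sexec_leq (sexec_while_step (n1 := 5) _ _ h) _ => //; last by rewrite /=; lia.
apply: (@sexec_seq _ _ _ (mk x u s (d :: a) b (true :: c)) _ 3 2).
  apply: (@sexec_ifN _ _ _ _ _ 2) => //; first exact: negbTE.
  by apply: sexec_eq (sexec_push _ _ _) _; regs.
apply: (@sexec_seq _ _ _ (mk x u s a b (true :: c)) _ 1 1).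
  by apply: sexec_eq (sexec_pop _ _) _; regs.
by apply: sexec_eq (sexec_pop _ _) _; regs.
Qed.

Lemma pourC_0 x u s a b c :
  sexec (pour rC [::]) (mk x u s a b c) (mk x u s a b [::]) (4 * size c + 1).
Proof.
elim: c => [|d c IH]; first exact: sexec_while_done.
apply: sexec_leq (pour_step (st' := mk x u s a b c) erefl _ IH) _.
  by regs.
by rewrite /=; lia.
Qed.

Definition eqF := seqF (moveF true false) (seqF (moveF false true) (seqF cmpF
  (seqF (ifF (test (fun r => (r rC == None) && (r rB == None)))
           (pushwF rS (ser (truth true))) (pushwF rS (ser (truth false))))
        (seqF (pour rB [::]) (pour rC [::]))))).

Lemma sexec_eqF t1 t2 x u s : sexec eqF (stk x u (ser t1 ++ ser t2 ++ s))
  (stk x u (ser (truth (t1 == t2)) ++ s)) (22 * (sz t1 + sz t2) + 20).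
Proof.
have [m [lm hm] h] := sexec_cmp x u s (rev (ser t1)) (rev (ser t2)) [::].
rewrite size_rev -/(sz t1) in lm hm h.
have e : (t1 == t2) = (m == 0) && (drop (sz t1) (rev (ser t2)) == [::]).
  rewrite hm; apply/eqP/andP => [->|[/eqP e1 /eqP e2]].
    by rewrite /sz take_oversize ?drop_oversize ?size_rev.
  by apply/ser_inj/(can_inj revK); rewrite -[RHS](cat_take_drop (sz t1)) e2 cats0.
apply: (@sexec_le _ _ _ ((11 * sz t1 + 3) + ((11 * sz t2 + 3) + ((7 * sz t1 + 1) +
  (8 + ((4 * sz t2 + 1) + (4 * sz t1 + 1))))))).
  by lia.
apply: sexec_seq; first exact: sexec_move.
apply: sexec_seq; first exact: sexec_move.
rewrite /onto !cats0; apply: sexec_seq; first by rewrite cats0 in h; exact: h.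
apply: (@sexec_seq _ _ _ (mk x u (ser (truth (t1 == t2)) ++ s) [::]
   (drop (sz t1) (rev (ser t2))) (nseq m true))).
  apply: (@sexec_if _ _ _ _ _ 7).
  have -> : (ohead (mk x u s [::] (drop (sz t1) (rev (ser t2))) (nseq m true) rC) == None) &&
      (ohead (mk x u s [::] (drop (sz t1) (rev (ser t2))) (nseq m true) rB) == None) = (t1 == t2).
    rewrite e; rewrite /=; case: m {e hm h lm} => //=; by case: drop.
  case: (t1 == t2).
    exact: sexec_leq (sexec_pushw (ser (truth true)) _ _ _ _ _ _) _.
  exact: sexec_leq (sexec_pushw (ser (truth false)) _ _ _ _ _ _) _.
apply: (@sexec_seq _ _ _ (mk x u (ser (truth (t1 == t2)) ++ s) [::] [::] (nseq m true))).
  by apply: sexec_leq (pourB_0 _ _ _ _ _ _) _; rewrite size_drop size_rev -/(sz t2); lia.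
by apply: sexec_leq (pourC_0 _ _ _ _ _ _) _; rewrite size_nseq; lia.
Qed.

Fixpoint compile p : frag := match p with
  | PId => skipF
  | PCar => ifF (test (top_is rS true)) (seqF (popF rS) (seqF swapF dropF)) skipF
  | PCdr => ifF (test (top_is rS true)) (seqF (popF rS) dropF) skipF
  | PEq => ifF (test (top_is rS true)) (seqF (popF rS) eqF) skipF
  | PConst t => seqF dropF (pushwF rS (ser t))
  | PComp p q => seqF (compile q) (compile p)
  | PPair p q => seqF dupF (seqF (compile q) (seqF swapF (seqF (compile p) (pushF rS true))))
  | PIf c p q => seqF dupF (seqF (compile c)
      (ifF (test (top_is rS true)) (seqF dropF (compile p)) (seqF dropF (compile q))))
  | PIter p => ifF (test (top_is rS true))
      (seqF (popF rS) (seqF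
        (whileF (test (top_is rS true))
          (seqF (popF rS) (seqF dropF (seqF swapF (seqF (compile p) swapF)))))
        (popF rS)))
      skipF
  end.

Lemma compileP p y x u s :
  sexec (compile p) (stk x u (ser y ++ s)) (stk x u (ser (eval p y) ++ s)) (cost p y).
Proof.
elim: p y s => [||||t|p IHp q IHq|p IHp q IHq|c IHc p IHp q IHq|p IHp] y s.
- exact: sexec_skip.
- case: y => [|l r] /=.
    by apply: (@sexec_ifN _ _ _ _ _ 59) => //; apply: sexec_leq (sexec_skip _) _.
  rewrite -catA; apply: (@sexec_leq _ _ _ (1 + (17 * (sz l + sz r) + 8 + (11 * sz r + 3))).+1); last by rewrite szN; lia.
  apply: sexec_ifT => //; apply: sexec_seq; first exact: sexec_popS.
  apply: sexec_seq; [exact: sexec_swap|exact: sexec_drop].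
- case: y => [|l r] /=.
    by apply: (@sexec_ifN _ _ _ _ _ 59) => //; apply: sexec_leq (sexec_skip _) _.
  rewrite -catA; apply: (@sexec_leq _ _ _ (1 + (11 * sz l + 3)).+1); last by rewrite szN; lia.
  apply: sexec_ifT => //; apply: sexec_seq; first exact: sexec_popS.
  exact: sexec_drop.
- case: y => [|l r] /=.
    by apply: (@sexec_ifN _ _ _ _ _ 99) => //; apply: sexec_leq (sexec_skip _) _.
  rewrite -catA; apply: (@sexec_leq _ _ _ (1 + (22 * (sz l + sz r) + 20)).+1); last by rewrite szN; lia.
  apply: sexec_ifT => //; apply: sexec_seq; first exact: sexec_popS.
  exact: sexec_eqF.
- apply: (@sexec_leq _ _ _ ((11 * sz y + 3) + (2 * size (ser t) + 1))); last by rewrite /= -/(sz t); lia.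
  apply: sexec_seq; [exact: sexec_drop|exact: sexec_pushw].
- exact: sexec_seq (IHq y s) (IHp _ s).
- apply: (@sexec_leq _ _ _ ((31 * sz y + 6) + (cost q y + (17 * (sz (eval q y) + sz y) + 8 + (cost p y + 2))))); last by rewrite /=; lia.
  apply: sexec_seq; first exact: sexec_dup.
  apply: sexec_seq; first exact: IHq.
  apply: sexec_seq; first exact: sexec_swap.
  apply: sexec_seq; first exact: IHp.
  by apply: sexec_eq (sexec_push _ _ _) _; rewrite /= -catA; regs.
- apply: (@sexec_leq _ _ _ ((31 * sz y + 6) + (cost c y + ((11 * sz (eval c y) + 3 +
     (if eval c y is Node _ _ then cost p y else cost q y)).+1)))); last by rewrite /=; lia.
  apply: sexec_seq; first exact: sexec_dup.
  apply: sexec_seq; first exact: IHc.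
  rewrite [eval (PIf c p q) y]/=; case e: (eval c y) => [|l r].
    apply: sexec_ifN => //; apply: sexec_seq; [exact: (sexec_drop Leaf)|exact: IHq].
  apply: sexec_ifT => //; apply: sexec_seq; [exact: (sexec_drop (Node l r))|exact: IHp].
case: y => [|n z] /=.
  by apply: (@sexec_ifN _ _ _ _ _ 9) => //; apply: sexec_leq (sexec_skip _) _.
(* Only an upper bound on the counter size is kept, so that the induction on the shrinking counter
   leaves the charge per round fixed. *)
rewrite -catA; set m := sz n; have : sz n <= m by [].
move: m => m nm.
apply: (@sexec_leq _ _ _ (1 + (icost (eval p) (cost p) m (spine n) z + 1 + 1)).+1); last by lia.
apply: sexec_ifT => //; apply: sexec_seq; first exact: sexec_popS.
apply: (@sexec_seq _ _ _ (stk x u (false :: ser (iter (spine n) (eval p) z) ++ s))); last first.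
  exact: sexec_popS.
elim: n z nm => [|l _ r IHr] z nm; first exact: sexec_while_done.
rewrite szN in nm; rewrite /= -catA -iterS iterSr.
apply: (@sexec_leq _ _ _ ((1 + (11 * sz l + 3 + (17 * (sz r + sz z) + 8 + (cost p z + (17 * (sz (eval p z) + sz r) + 8))))) + (icost (eval p) (cost p) m (spine r) (eval p z) + 1)).+1); last by lia.
apply: sexec_while_step; [by []| |apply: (IHr _ _)]; last by lia.
apply: sexec_seq; first exact: sexec_popS.
apply: sexec_seq; first exact: sexec_drop.
apply: sexec_seq; first exact: sexec_swap.
apply: sexec_seq; first exact: IHp.
exact: sexec_swap.
Qed.

Definition enc_bits (x : seq bool) : tree := foldr (fun b t => Node (truth b) t) Leaf x.

Lemma sz_enc_bits x : sz (enc_bits x) <= 4 * size x + 1.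
Proof. by elim: x => // b x IH; rewrite /= szN; case: b; rewrite /= ?szN; move: IH; rewrite /sz /=; lia. Qed.

(** Adding a bit in front of a serialized list amounts to pushing [true] for the new [Node] and then
    the code of [truth b]. *)
Definition buildF := whileF (test (nonempty rA))
  (ifF (test (top_is rA true))
     (seqF (pushwF rS [:: true; true; false; false]) (popF rA))
     (seqF (pushwF rS [:: true; false]) (popF rA))).

Lemma sexec_build w t x u s : sexec buildF
  (mk x u (ser (enc_bits t) ++ s) w [::] [::])
  (stk x u (ser (enc_bits (catrev w t)) ++ s)) (12 * size w + 1).
Proof.
elim: w t => [|b w IH] t; first exact: sexec_while_done.
apply: sexec_leq (sexec_while_step (n1 := 11) _ _ (IH (b :: t))) _ => //; last by rewrite /=; lia.
case: b.
  apply: (@sexec_ifT _ _ _ _ _ 10) => //; apply: (@sexec_seq _ _ _ _ _ 9 1).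
    exact: sexec_pushw.
  by apply: sexec_eq (sexec_pop _ _) _; regs.
apply: (@sexec_ifN _ _ _ _ _ 10) => //; apply: (@sexec_leq _ _ _ (5 + 1)) => //; apply: sexec_seq.
  exact: sexec_pushw.
by apply: sexec_eq (sexec_pop _ _) _; regs.
Qed.

(* Moves as many certificate bits to A as the list on S is long. *)
Definition readF := whileF (test (top_is rS true))
  (seqF (popF rS) (seqF dropF
    (ifF (test (top_is rU true)) (shift rU [:: rA])
       (ifF (test (top_is rU false)) (shift rU [:: rA]) skipF)))).

Lemma sexec_read t x u s a : exists u', sexec readF
  (mk x u (ser t ++ s) a [::] [::])
  (mk x u' (false :: s) (rev (take (spine t) u) ++ a) [::] [::]) (20 * sz t).
Proof.
elim: t u a => [|l _ r IHr] u a; first by exists u; rewrite take0; exact: sexec_leq (sexec_while_done _ _) _.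
have h2 : sexec (ifF (test (top_is rU true)) (shift rU [:: rA])
       (ifF (test (top_is rU false)) (shift rU [:: rA]) skipF)) (mk x u (ser r ++ s) a [::] [::])
   (mk x (behead u) (ser r ++ s) (rev (take 1 u) ++ a) [::] [::]) 7.
  case: u => [|d u].
    apply: (@sexec_ifN _ _ _ _ _ 6) => //; apply: (@sexec_ifN _ _ _ _ _ 5) => //.
    exact: sexec_leq (sexec_skip _) _.
  have h : sexec (shift rU [:: rA]) (mk x (d :: u) (ser r ++ s) a [::] [::])
     (mk x u (ser r ++ s) (rev (take 1 (d :: u)) ++ a) [::] [::]) 5.
    by apply: sexec_eq (sexec_shift [:: rA] (erefl : mk x (d :: u) _ _ _ _ rU = d :: u)) _; rewrite /= take0; regs.
  case: d h => h; first by apply: (@sexec_ifT _ _ _ _ _ 6) => //; apply: sexec_leq h _.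
  by apply: (@sexec_ifN _ _ _ _ _ 6) => //; apply: (@sexec_ifT _ _ _ _ _ 5).
have [u' h] := IHr (behead u) (rev (take 1 u) ++ a).
exists u'; have -> : rev (take (spine (Node l r)) u) ++ a =
    rev (take (spine r) (behead u)) ++ rev (take 1 u) ++ a.
  by rewrite catA -rev_cat; case: u {h h2} => //= d u; rewrite take0.
apply: sexec_leq (sexec_while_step (n1 := 1 + ((11 * sz l + 3) + 7)) _ _ h) _ => //; last by rewrite szN; have := sz_gt0 l; lia.
rewrite /= -catA; apply: sexec_seq; first exact: sexec_popS.
apply: sexec_seq h2; exact: sexec_move.
Qed.

(** * From fragments to verifying machines *)

Section FragMachine.
Variable M : frag.

(** After the exit one more step inspects the top of S, where the code of a [Node] begins with
    [true] and that of [Leaf] with [false]. This step is the reason for the strict bound in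
    [run_tm_outcome]. *)
Definition run_tm : turing_machine := {|
  tm_state := (fstate M + option bool)%type;
  tm_aux := void; tm_work := 4;
  tm_start := inl (fstart M);
  tm_verdict := fun q => if q is inr o then o else None;
  tm_trans := fun q rd =>
    match q with
    | inl q1 => let: (q', a) := ftrans q1 (tnth rd) in
        (if q' is Some q2 then inl q2 else inr None, [tuple a i | i < 6])
    | inr _ => (inr (Some (tnth rd rS == Some (inl true))), [tuple idle (tnth rd) i | i < 6])
    end |}.

Definition conf (q : tm_state run_tm) (tau : 'I_6 -> tape sym) : tm_config run_tm :=
  (q, [tuple tau i | i < 6]).

Lemma step_conf q tau : tm_step (conf (inl q) tau) =
  conf (if (ftrans q (fun i => t_cur (tau i))).1 is Some q2 then inl q2 else inr None)
    (do_acts tau (ftrans q (fun i => t_cur (tau i))).2).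
Proof.
rewrite /tm_step /=.
have -> : tnth (map_tuple (@t_cur _) (conf (inl q) tau).2) = (fun i => t_cur (tau i)).
  by apply/funext => i; rewrite tnth_map tnth_mktuple.
case: (ftrans q (fun i => t_cur (tau i))) => q' a; congr pair; apply: eq_from_tnth => i.
by rewrite !tnth_mktuple.
Qed.

Lemma iter_conf n q tau tau' : iter n (@fstep M) (Some q, tau) = (None, tau') ->
  exists2 n', n' <= n & iter n' (@tm_step run_tm) (conf (inl q) tau) = conf (inr None) tau'.
Proof.
elim: n q tau => [//|n IH] q tau; rewrite iterSr fstepE.
case e: (ftrans q _).1 => [q'|].
  move=> /IH[n' ln h]; exists n'.+1 => //.
  by rewrite iterSr step_conf e.
by rewrite iter_exit => -[<-]; exists 1%N; rewrite //= step_conf e.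
Qed.

Lemma run_tm_outcome x u st k n : sexec M (stk x u [::]) st k -> k < n ->
  tm_outcome run_tm x u n = Some (ohead (st rS) == Some true).
Proof.
move=> [h]; pose tau0 : 'I_6 -> tape sym := tnth (tm_init run_tm x u).2.
have rep0 (w : seq bool) : rep (tape_of (map inl w) : tape sym) w.
  split; first by case: w.
    by exists 0; case: w => //= b w; rewrite cats0 -map_comp.
  by exists 0.
have r0 : Rep tau0 (stk x u [::]).
  have e : Rep (fun i => nth (tape_of [::]) [:: tape_of (map inl x); tape_of (map inl u); tape_of [::]; tape_of [::]; tape_of [::]; tape_of [::]] i) (stk x u [::]).
    move=> i; case: i => i lt; do 6 (case: i lt => [|i] lt; [first [exact: (rep0 x) | exact: (rep0 u) | exact: (rep0 [::])] | ]); by [].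
  move=> i; rewrite /tau0 (tnth_nth (tape_of [::])); exact: e.
have [tau' r' e] := h tau0 r0; have [n' ln e'] := iter_conf e.
have e1 : iter n'.+1 (@tm_step run_tm) (tm_init run_tm x u) =
    conf (inr (Some (ohead (st rS) == Some true))) tau'.
  have -> : tm_init run_tm x u = conf (inl (fstart M)) tau0.
    by rewrite /conf /tau0; congr pair; apply: eq_from_tnth => i; rewrite tnth_mktuple.
  rewrite iterS e' /tm_step /=; congr pair; last first.
    apply: eq_from_tnth => i; rewrite !tnth_mktuple /idle tnth_map tnth_mktuple /tape_act /=.
    by case: (tau' i).
  congr (inr (Some _)); rewrite tnth_map tnth_mktuple; have [-> _ _] := r' rS.
  by case: (st rS) => [|[]].
move=> ln'; rewrite /tm_outcome -(subnK (leq_ltn_trans ln ln')) iterD e1.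
have halt m : iter m (@tm_step run_tm) (conf (inr (Some (ohead (st rS) == Some true))) tau') =
    conf (inr (Some (ohead (st rS) == Some true))) tau'.
  by elim: m => // m IH; rewrite iterS IH.
by rewrite halt.
Qed.

End FragMachine.

Section Machine.
Variables (r v : prog).

(** The tree computed by [r] serves only as a length. Cutting the certificate to this length before
    running [v] makes the running time independent of the certificate's length. *)
Definition wholeF :=
  seqF (pour rX [:: rA]) (seqF (pushF rS false) (seqF buildF (seqF dupF (seqF (compile r)
  (seqF readF (seqF (popF rS) (seqF (pushF rS false) (seqF buildF
  (seqF (pushF rS true) (compile v)))))))))).

Definition bound x := spine (eval r (enc_bits x)).
Definition answer x u := eval v (Node (enc_bits (take (bound x) u)) (enc_bits x)).
Definition duration x u := 200 * size x + 200 + cost r (enc_bits x) +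
  40 * sz (eval r (enc_bits x)) + cost v (Node (enc_bits (take (bound x) u)) (enc_bits x)).

Lemma spine_le t : spine t <= sz t.
Proof. by elim: t => // l _ r' IH; rewrite szN /=; lia. Qed.

Lemma sexec_whole x u : exists u', sexec wholeF (stk x u [::])
  (stk [::] u' (ser (answer x u))) (duration x u).
Proof.
have [u' h] := sexec_read (eval r (enc_bits x)) [::] u (ser (enc_bits x)) [::].
exists u'; rewrite cats0 in h; set w := take (bound x) u.
have lw : size w <= sz (eval r (enc_bits x)).
  by rewrite size_take_min; apply: leq_trans (geq_minl _ _) (spine_le _).
have lx := sz_enc_bits x.
apply: (@sexec_leq _ _ _ ((6 * size x + 1) + (2 + ((12 * size x + 1) + (
  (31 * sz (enc_bits x) + 6) + (cost r (enc_bits x) + (20 * sz (eval r (enc_bits x)) + (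
  1 + (2 + ((12 * size w + 1) + (2 + cost v (Node (enc_bits w) (enc_bits x))))))))))))); last first.
  by rewrite /duration -/w; lia.
apply: sexec_seq; first exact: pourX_A.
apply: (@sexec_seq _ _ _ (mk [::] u [:: false] (rev x) [::] [::])).
  by apply: sexec_eq (sexec_push _ _ _) _; rewrite /= cats0; regs.
apply: sexec_seq.
  by have := sexec_build (rev x) [::] [::] u [::]; rewrite size_rev; exact.
rewrite -/(rev _) revK; apply: sexec_seq; first exact: sexec_dup.
apply: sexec_seq; first exact: compileP.
rewrite cats0; apply: sexec_seq; first exact: h.
apply: sexec_seq; first exact: sexec_popS.
apply: (@sexec_seq _ _ _ (mk [::] u' (false :: ser (enc_bits x)) (rev w) [::] [::])).
  by apply: sexec_eq (sexec_push _ _ _) _; rewrite /=; regs.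
apply: sexec_seq.
  by have := sexec_build (rev w) [::] [::] u' (ser (enc_bits x)); rewrite size_rev; exact.
rewrite -/(rev _) revK.
apply: (@sexec_seq _ _ _ (stk [::] u' (ser (Node (enc_bits w) (enc_bits x))))).
  by apply: sexec_eq (sexec_push _ _ _) _; rewrite /=; regs.
by have := @compileP v (Node (enc_bits w) (enc_bits x)) [::] u' [::]; rewrite !cats0; exact.
Qed.

Definition tm_of := run_tm wholeF.

Lemma tm_of_outcome x u n : duration x u < n ->
  tm_outcome tm_of x u n = Some (answer x u != Leaf).
Proof.
have [u' h] := sexec_whole x u; move=> /(run_tm_outcome h) ->.
by rewrite [mk _ _ _ _ _ _ _]/=; case: (answer x u).
Qed.

End Machine.

Definition polyb (f : nat -> nat) := exists c k, forall n, f n <= c * n.+1 ^ k.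

Lemma poly_eval c k n : ((c%:P * ('X + 1) ^+ k : {poly nat})%R.[n])%R = c * n.+1 ^ k.
Proof.
by rewrite hornerM hornerC horner_exp hornerD hornerX hornerC !natrE addn1.
Qed.

Lemma NP_intro (r v : prog) (q : nat -> nat) (L : seq bool -> Prop) : polyb q ->
  (forall x, sz (eval r (enc_bits x)) <= q (size x)) ->
  (forall x, cost r (enc_bits x) <= q (size x)) ->
  (forall x u, size u <= bound r x -> cost v (Node (enc_bits u) (enc_bits x)) <= q (size x)) ->
  (forall x, L x <-> exists2 u, size u <= bound r x &
     eval v (Node (enc_bits u) (enc_bits x)) != Leaf) ->
  in_NP L.
Proof.
move=> [c [k qP]] r_sz r_cost v_cost Lx.
(* [duration] is at most [42 q + 200 |x| + 200], since [40 sz] and the two costs contribute 42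
   copies of [q]; the term 500 absorbs the linear part strictly. *)
exists (tm_of r v), (((c * 42 + 500)%N%:P * ('X + 1) ^+ k.+1)%R) => x; rewrite poly_eval; cbv zeta.
set n := _ * _ ^ _.
have ln : 42 * q (size x) + 200 * size x + 200 < n.
  have := qP (size x); rewrite /n expnS; have : 0 < (size x).+1 ^ k by rewrite expn_gt0.
  by move: (_ ^ k) (q _) => m p; nia.
have out u : tm_outcome (tm_of r v) x u n = Some (answer r v x u != Leaf).
  apply: tm_of_outcome; rewrite /duration; apply: leq_ltn_trans ln.
  have := r_sz x; have := r_cost x; have := v_cost x (take (bound r x) u).
  by rewrite size_take_min geq_minl => /(_ isT); lia.
have bn : bound r x <= n by apply: leq_trans (spine_le _) _; have := r_sz x; lia.
split=> [u _|]; first by have -> := out u.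
rewrite Lx; split=> [[u lu hu]|[u lu]]; last have -> := out u => -[hu].
  by exists u; [exact: leq_trans lu bn|have -> := out u; rewrite /answer take_oversize ?hu].
(* A longer certificate may be replaced by its truncation, the only part that the machine reads. *)
by exists (take (bound r x) u); rewrite ?size_take_min ?geq_minl.
Qed.

(** * Polynomial-time functions *)

Class code (X : Type) := Code { enc : X -> tree; enc_inj : injective enc }.

(** Unary, so that a number can itself serve as a loop counter, see [spine_nat]. *)
Definition enc_nat n := iter n (Node Leaf) Leaf.
Definition enc_seq X (cX : code X) (s : seq X) := foldr (fun x t => Node (enc x) t) Leaf s.
Definition enc_pair X Y (cX : code X) (cY : code Y) (p : X * Y) := Node (enc p.1) (enc p.2).

Lemma truth_inj : injective truth. Proof. by case=> -[]. Qed.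

Lemma enc_nat_inj : injective enc_nat.
Proof. by elim=> [|m IH] [|n] //= [/IH ->]. Qed.

Lemma enc_seq_inj X (cX : code X) : injective (enc_seq cX).
Proof. by elim=> [|x s IH] [|y t] //= [e /IH ->]; rewrite (enc_inj e). Qed.

Lemma enc_pair_inj X Y (cX : code X) (cY : code Y) : injective (enc_pair cX cY).
Proof. by move=> [x y] [x' y'] [e e']; rewrite (enc_inj e) (enc_inj e'). Qed.

#[global] Instance code_bool : code bool := Code truth_inj.
#[global] Instance code_nat : code nat := Code enc_nat_inj.
#[global] Instance code_seq X (cX : code X) : code (seq X) := Code (enc_seq_inj (cX := cX)).
#[global] Instance code_pair X Y (cX : code X) (cY : code Y) : code (X * Y) :=
  Code (enc_pair_inj (cX := cX) (cY := cY)).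

Definition wt X {cX : code X} (x : X) := sz (enc x).

Lemma enc_pairE X Y (cX : code X) (cY : code Y) (x : X) (y : Y) : Node (enc x) (enc y) = enc (x, y).
Proof. by []. Qed.

Lemma wt_gt0 X (cX : code X) (x : X) : 0 < wt x. Proof. exact: sz_gt0. Qed.
Lemma wt_pair X Y (cX : code X) (cY : code Y) (x : X) (y : Y) : wt (x, y) = (wt x + wt y).+1.
Proof. exact: szN. Qed.
Lemma wt_cons X (cX : code X) (x : X) s : wt (x :: s) = (wt x + wt s).+1.
Proof. exact: szN. Qed.
Lemma wt_nil X (cX : code X) : wt ([::] : seq X) = 1. Proof. by []. Qed.
Lemma wt_nat n : wt n = (2 * n).+1.
Proof. by elim: n => // n; rewrite /wt [enc _]/= szN => ->; rewrite /sz /=; lia. Qed.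
Lemma wt_bool (b : bool) : wt b <= 3. Proof. by case: b. Qed.
Lemma wt_cat X (cX : code X) (s t : seq X) : wt (s ++ t) + 1 = wt s + wt t.
Proof. by elim: s => [|x s IH]; rewrite ?wt_nil /= ?wt_cons; lia. Qed.
Lemma size_lt_wt X (cX : code X) (s : seq X) : size s < wt s.
Proof. by elim: s => // x s IH; rewrite wt_cons /=; lia. Qed.

(** Monotonicity is included because composing time bounds replaces an argument by an upper
    bound. *)
Definition poly q := {homo q : m n / m <= n} /\ polyb q.

Lemma poly_const c : poly (fun=> c).
Proof. by split=> //; exists c, 0 => n; rewrite expn0 muln1. Qed.

Lemma poly_id : poly id.
Proof. by split=> //; exists 1, 1 => n; rewrite expn1 mul1n. Qed.

Lemma polyD f g : poly f -> poly g -> poly (fun n => f n + g n).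
Proof.
move=> [mf [c [k hf]]] [mg [d [l hg]]]; split=> [m n le|]; first by rewrite leq_add ?mf ?mg.
exists (c + d), (k + l) => n; rewrite mulnDl leq_add //.
  by apply: leq_trans (hf n) _; rewrite leq_mul2l leq_pexp2l ?leq_addr ?orbT.
by apply: leq_trans (hg n) _; rewrite leq_mul2l leq_pexp2l ?leq_addl ?orbT.
Qed.

Lemma polyM f g : poly f -> poly g -> poly (fun n => f n * g n).
Proof.
move=> [mf [c [k hf]]] [mg [d [l hg]]]; split=> [m n le|]; first by rewrite leq_mul ?mf ?mg.
by exists (c * d), (k + l) => n; rewrite expnD mulnACA leq_mul.
Qed.

Lemma poly_comp f g : poly f -> poly g -> poly (fun n => f (g n)).
Proof.
move=> [mf [c [k hf]]] [mg [d [l hg]]]; split=> [m n le|]; first by rewrite mf ?mg.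
exists (c * d.+1 ^ k), (l * k) => n; apply: leq_trans (hf _) _.
rewrite -mulnA leq_mul2l expnM -expnMn; apply/orP; right.
case: k {hf} => // k; rewrite leq_exp2r //.
have := hg n; have : 0 < n.+1 ^ l by rewrite expn_gt0.
by move: (_ ^ l) (g n) => a b; nia.
Qed.

Ltac polys := repeat first [exact: poly_id | exact: poly_const | assumption | apply: polyD | apply: polyM].

Section Ptime.
Context {X Y Z : Type} {cX : code X} {cY : code Y} {cZ : code Z}.

Definition ptime (f : X -> Y) := exists p, exists2 q, poly q &
  forall x : X, eval p (enc x) = enc (f x) /\ cost p (enc x) <= q (wt x).

Definition pbound (s : X -> nat) := exists2 q, poly q & forall x, s x <= q (wt x).
End Ptime.

Lemma sz_iter f cf m k y : (forall z, sz (f z) <= cf z + sz z) ->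
  sz (iter k f y) <= icost f cf m k y + sz y.
Proof. by move=> h; elim: k y => // k IH y; rewrite iterSr /=; have := IH (f y); have := h y; lia. Qed.

(** A program cannot build more than it pays for. Hence the output size of a polynomial-time
    function is polynomial without a separate argument. *)
Lemma sz_eval p y : sz (eval p y) <= cost p y + sz y.
Proof.
elim: p y => [||||t|p IHp q IHq|p IHp q IHq|c IHc p IHp q IHq|p IHp] y.
- by rewrite leq_addl.
- by case: y => //= l r; rewrite szN; lia.
- by case: y => //= l r; rewrite szN; lia.
- by case: y => //= l r; rewrite szN; case: eqP; rewrite /= ?szN /sz /=; lia.
- by rewrite /=; lia.
- by have := IHq y; have := IHp (eval q y); rewrite /=; lia.
- by have := IHq y; have := IHp y; rewrite /= szN; lia.
- by rewrite /=; case: (eval c y) => [|l r]; [have := IHq y|have := IHp y]; lia.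
case: y => [|n z] //=; have := sz_iter (sz n) (spine n) z IHp; rewrite szN; lia.
Qed.

Section Closure.
Variables (X Y Z : Type) (cX : code X) (cY : code Y) (cZ : code Z).
Implicit Types (f : X -> Y).

Lemma ptime_wt f : ptime f -> pbound (fun x => wt (f x)).
Proof.
move=> [p [q pq h]]; exists (fun n => q n + n); first exact: polyD poly_id.
by move=> x; have [e l] := h x; rewrite /wt -e; apply: leq_trans (sz_eval _ _) _; rewrite leq_add2r.
Qed.

Lemma ptime_ext f g : f =1 g -> ptime f -> ptime g.
Proof. by move=> e [p [q pq h]]; exists p, q => // x; rewrite -e. Qed.

Lemma pbound_const c : pbound (fun _ : X => c).
Proof. by exists (fun=> c) => //; apply: poly_const. Qed.

Lemma pboundD (s t : X -> nat) : pbound s -> pbound t -> pbound (fun x => s x + t x).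
Proof.
by move=> [q pq h] [q' pq' h']; exists (fun n => q n + q' n); [exact: polyD|move=> x; apply: leq_add].
Qed.

Lemma pboundM (s t : X -> nat) : pbound s -> pbound t -> pbound (fun x => s x * t x).
Proof.
by move=> [q pq h] [q' pq' h']; exists (fun n => q n * q' n); [exact: polyM|move=> x; apply: leq_mul].
Qed.

End Closure.

Section Combinators.
Context {X Y Z : Type} {cX : code X} {cY : code Y} {cZ : code Z}.
Implicit Types (f : X -> Y).

Lemma ptime_id : ptime (fun x : X => x).
Proof. by exists PId, (fun=> 1); [exact: poly_const|]. Qed.

Lemma ptime_const (y : Y) : ptime (fun _ : X => y).
Proof.
exists (PConst (enc y)), (fun n => 11 * n + (2 * wt y + 10)).
  by polys.
by move=> x; rewrite /= /wt; split=> //; lia.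
Qed.

Lemma ptime_comp (g : Y -> Z) f : ptime g -> ptime f -> ptime (fun x => g (f x)).
Proof.
move=> [p [q pq h]] pf; have [q2 pq2 h2] := ptime_wt pf; case: pf => p' [q' pq' h'].
exists (PComp p p'), (fun n => q' n + q (q2 n)); first exact/polyD/poly_comp.
move=> x; have [e l] := h' x; have [e' l'] := h (f x); rewrite /= e e'; split=> //.
by apply: leq_add l (leq_trans l' _); case: pq => + _; apply.
Qed.

Lemma ptime_pair f (g : X -> Z) : ptime f -> ptime g ->
  ptime (fun x => (f x, g x)).
Proof.
move=> [p [q pq h]] pg; have [q2 pq2 h2] := ptime_wt pg; case: pg => p' [q' pq' h'].
exists (PPair p p'), (fun n => 48 * n + 17 * q2 n + 20 + q' n + q n).
  by polys.
move=> x; have [e l] := h x; have [e' l'] := h' x; rewrite /= e e'; split=> //.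
have := h2 x; rewrite /wt in l l' *; lia.
Qed.

End Combinators.

Section Intro.
Context {X Y Z : Type} {cX : code X} {cY : code Y} {cZ : code Z}.

Lemma ptime_intro p (f : X -> Y) (T : X -> nat) : (forall x : X, eval p (enc x) = enc (f x)) ->
  pbound T -> (forall x : X, cost p (enc x) <= T x) -> ptime f.
Proof.
move=> e [q pq h] l; exists p, q => // x; split=> //; exact: leq_trans (l x) (h x).
Qed.

Lemma ptime_elim (f : X -> Y) : ptime f -> exists p, exists2 q, poly q &
  (forall x : X, eval p (enc x) = enc (f x)) /\ (forall x : X, cost p (enc x) <= q (wt x)).
Proof. by move=> [p [q pq h]]; exists p, q => //; split=> x; have [] := h x. Qed.

Lemma pbound_poly q (s : X -> nat) : poly q -> pbound s -> pbound (fun x => q (s x)).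
Proof.
move=> pq [q' pq' h]; exists (fun n => q (q' n)); first exact: poly_comp.
by move=> x; case: pq => + _; apply.
Qed.

Lemma pbound_wt : pbound (fun x : X => wt x).
Proof. by exists id => //; apply: poly_id. Qed.

(** Functions with the same code are interchangeable: pairing, consing and the successor are all the
    program [PPair]. *)
Lemma ptime_recode (f : X -> Y) (g : X -> Z) : (forall x, enc (f x) = enc (g x)) -> ptime g -> ptime f.
Proof. by move=> e [p [q pq h]]; exists p, q => // x; rewrite e. Qed.

End Intro.

Ltac pbounds := repeat match goal with
  | |- pbound (fun _ => ?c) => exact (pbound_const _ c)
  | |- pbound (fun x => wt x) => exact pbound_wt
  | |- pbound (fun x => @?s x + @?t x) => refine (@pboundD _ _ s t _ _)
  | |- pbound (fun x => @?s x * @?t x) => refine (@pboundM _ _ s t _ _)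
  | h : poly ?q |- pbound (fun x => ?q (@?s x)) => refine (@pbound_poly _ _ q s h _)
  | _ => assumption
  end.

Section Basic.
Context {X Y Z : Type} {cX : code X} {cY : code Y} {cZ : code Z}.

Lemma ptime_fst (f : X -> Y * Z) : ptime f -> ptime (fun x => (f x).1).
Proof.
apply: (ptime_comp (g := fst)).
by apply: (ptime_intro (p := PCar) (T := fun p => 40 * wt p + 20)) => //; pbounds.
Qed.

Lemma ptime_snd (f : X -> Y * Z) : ptime f -> ptime (fun x => (f x).2).
Proof.
apply: (ptime_comp (g := snd)).
by apply: (ptime_intro (p := PCdr) (T := fun p => 40 * wt p + 20)) => //; pbounds.
Qed.

Lemma ptime_cons (f : X -> Y) (s : X -> seq Y) : ptime f -> ptime s -> ptime (fun x => f x :: s x).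
Proof. by move=> pf ps; apply: ptime_recode (ptime_pair pf ps). Qed.

Lemma ptime_behead (s : X -> seq Y) : ptime s -> ptime (fun x => behead (s x)).
Proof.
apply: (ptime_comp (g := behead)).
apply: (ptime_intro (p := PCdr) (T := fun p => 40 * wt p + 20)) => //; last by pbounds.
by case.
Qed.

Lemma ptime_S (f : X -> nat) : ptime f -> ptime (fun x => (f x).+1).
Proof. by move=> pf; apply: ptime_recode (ptime_pair (ptime_const false) pf). Qed.

Lemma ptime_pred (f : X -> nat) : ptime f -> ptime (fun x => (f x).-1).
Proof.
apply: (ptime_comp (g := predn)).
apply: (ptime_intro (p := PCdr) (T := fun p => 40 * wt p + 20)) => //; last by pbounds.
by case.
Qed.

Lemma ptime_if (c : X -> bool) (f g : X -> Y) : ptime c -> ptime f -> ptime g ->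
  ptime (fun x => if c x then f x else g x).
Proof.
move=> /ptime_elim[p [q pq [e l]]] /ptime_elim[p1 [q1 pq1 [e1 l1]]] /ptime_elim[p2 [q2 pq2 [e2 l2]]].
apply: (ptime_intro (p := PIf p p1 p2) (T := fun x => 31 * wt x + 53 + q (wt x) + (q1 (wt x) + q2 (wt x)))).
- by move=> x; rewrite /= e; case: (c x); rewrite /= ?e1 ?e2.
- by pbounds.
move=> x; rewrite /= e; have := l x; have := l1 x; have := l2 x; have := wt_bool (c x); rewrite /wt.
by case: (c x); rewrite /=; lia.
Qed.

Lemma ptime_matchl (l : X -> seq Y) (n : X -> Z) (F : X -> Y -> seq Y -> Z) :
  ptime l -> ptime n -> ptime (fun p : X * (Y * seq Y) => F p.1 p.2.1 p.2.2) ->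
  ptime (fun x => if l x is y :: s then F x y s else n x).
Proof.
move=> pl; have [ql pql hl] := ptime_wt pl; move: pl.
move=> /ptime_elim[p [q pq [e b]]] /ptime_elim[p1 [q1 pq1 [e1 b1]]] /ptime_elim[p2 [q2 pq2 [e2 b2]]].
apply: (ptime_intro (p := PIf p (PComp p2 (PPair PId p)) p1)
   (T := fun x => 100 * wt x + 60 + 30 * ql (wt x) + 2 * q (wt x) +
      (q1 (wt x) + q2 (1 + (wt x + ql (wt x)))))).
- move=> x; rewrite /= e; case lx: (l x) => [|y s] /=; first exact: e1.
  by rewrite -(e2 (x, (y, s))).
- pbounds.
move=> x; rewrite /= e; have := b x; have := b1 x; have := hl x; rewrite /wt.
case lx: (l x) => [|y s]; first by rewrite [enc _]/=; lia.
rewrite [enc (_ :: _)]/= => h1 h2 h3.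
have : cost p2 (Node (enc x) (Node (enc y) (enc s))) <=
  q2 (sz (Node (enc x) (Node (enc y) (enc s)))) := b2 (x, (y, s)).
have : q2 (sz (Node (enc x) (Node (enc y) (enc s)))) <= q2 (1 + (sz (enc x) + ql (sz (enc x)))).
  by case: pq2 => + _; apply; move: h1; rewrite !szN /=; lia.
by move: h1; rewrite /= !szN /=; lia.
Qed.

End Basic.

Lemma icostS f cf m k y : icost f cf m k.+1 y =
  cf y + 40 * m + 17 * (sz y + sz (f y)) + 30 + icost f cf m k (f y).
Proof. by []. Qed.

Section Iteration.
Context {X Y C : Type} {cX : code X} {cY : code Y} {cC : code C}.

(** The bound [s] on all intermediate values is essential, as repeated doubling would otherwise be
    allowed. The parameter [x] is carried along beside the state. *)
Lemma ptime_iter_bounded (c : X -> C) (g : X -> Y) (F : X -> Y -> Y) (s : X -> nat) :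
  ptime c -> ptime g -> ptime (fun p : X * Y => F p.1 p.2) -> pbound s ->
  (forall x i, i <= spine (enc (c x)) -> wt (iter i (F x) (g x)) <= s x) ->
  ptime (fun x => iter (spine (enc (c x))) (F x) (g x)).
Proof.
move=> pc pg pF ps hs; have [qc pqc hc] := ptime_wt pc; have [qg pqg hg] := ptime_wt pg.
move: pc pg pF => /ptime_elim[p [q pq [e b]]] /ptime_elim[p1 [q1 pq1 [e1 b1]]].
move=> /ptime_elim[p2 [q2 pq2 [e2 b2]]].
pose B (x : X) := 1 + (@wt X cX x + s x).
pose D (x : X) := 200 * B x + 40 * qc (@wt X cX x) + q2 (B x) + 200.
have pB : pbound B by rewrite /B; pbounds.
have pD : pbound D by rewrite /D; pbounds.
pose step := PPair PCar p2.
have eF (x : X) (a : Y) : eval step (enc (x, a)) = enc (x, F x a).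
  by change (Node (enc x) (eval p2 (enc (x, a))) = Node (enc x) (enc (F x a))); rewrite (e2 (x, a)).
  have costF (x : X) i a : i < spine (enc (c x)) -> a = iter i (F x) (g x) ->
    cost step (enc (x, a)) + 40 * sz (enc (c x)) + 17 * (wt (x, a) + wt (x, F x a)) + 30 <= D x.
  move=> li ea; have ha : wt a <= s x by rewrite ea; apply: hs; exact: ltnW.
  have ha' : wt (F x a) <= s x by rewrite ea -iterS hs.
  have c2 : cost p2 (enc (x, a)) <= q2 (B x).
    apply: leq_trans (b2 (x, a)) _; case: pq2 => + _; apply.
    by rewrite wt_pair /B; lia.
  have -> : cost step (enc (x, a)) =
      48 * wt (x, a) + 17 * wt (F x a) + 20 + cost p2 (enc (x, a)) + (40 * wt (x, a) + 20).
    change (cost step (enc (x, a))) with (48 * wt (x, a) + 17 * sz (eval p2 (enc (x, a))) + 20 +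
      cost p2 (enc (x, a)) + (40 * wt (x, a) + 20)).
    by rewrite (e2 (x, a)).
  have := hc x; rewrite !wt_pair /D /B -/(wt (c x)); move: ha ha' c2; rewrite /B.
  by move: (q2 _) (cost p2 _) => ? ?; lia.
have costI (x : X) k i : i + k <= spine (enc (c x)) ->
    icost (eval step) (cost step) (sz (enc (c x))) k (enc (x, iter i (F x) (g x))) <= k * D x /\
    iter k (eval step) (enc (x, iter i (F x) (g x))) = enc (x, iter (i + k) (F x) (g x)).
  elim: k i => [|k IH] i; first by rewrite addn0.
  rewrite addnS -addSn => l; have [h1 h2] := IH i.+1 l.
  rewrite iterSr eF -[F x (iter _ _ _)]/(iter i.+1 (F x) (g x)) h2; split=> //.
  have := costF x i _ ltac:(lia) erefl; rewrite icostS eF mulSn => h; apply: leq_add h _; exact: h1.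
apply: (ptime_intro (p := PComp PCdr (PComp (PIter step) (PPair p (PPair PId p1))))
  (T := fun x => qc (wt x) * D x + 300 * B x + 300 * qg (wt x) + q (wt x) + q1 (wt x) + 300)).
- move=> x; rewrite [LHS]/= e e1; have [_ h] := costI x (spine (enc (c x))) 0 (leqnn _).
  by move: h; rewrite add0n [iter 0 _ _]/= => h; rewrite enc_pairE h.
- by pbounds.
move=> x; have [h1 h2] := costI x (spine (enc (c x))) 0 (leqnn _).
rewrite [cost _ _]/= e e1 enc_pairE.
rewrite [iter 0 _ _]/= in h1 h2; rewrite h2.
have := b x; have := b1 x; have := hc x; have := hg x; have := hs x _ (leqnn _).
have : spine (enc (c x)) * D x <= qc (wt x) * D x.
  by rewrite leq_mul2r; apply/orP; right; apply: leq_trans (spine_le _) (hc x).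
rewrite add0n -!enc_pairE !szN /B /wt.
by move: h1; move: (icost _ _ _ _ _) (_ * D x) (_ * D x) => *; lia.
Qed.

End Iteration.

Ltac ptime_proj := repeat first [exact: ptime_id | apply: ptime_fst | apply: ptime_snd].

Section Library.
Context {X Y A : Type} {cX : code X} {cY : code Y} {cA : code A}.

Lemma spine_nat (n : nat) : spine (enc n) = n.
Proof. by elim: n => //= n ->. Qed.

Lemma spine_seq (s : seq Y) : spine (enc s) = size s.
Proof. by elim: s => //= y s ->. Qed.

Lemma ptime_iter (n : X -> nat) (g : X -> Y) (F : X -> Y -> Y) (s : X -> nat) :
  ptime n -> ptime g -> ptime (fun p : X * Y => F p.1 p.2) -> pbound s ->
  (forall x y, wt (F x y) <= wt y + s x) ->
  ptime (fun x => iter (n x) (F x) (g x)).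
Proof.
move=> pn pg pF ps hs.
apply: (ptime_ext (f := fun x => iter (spine (enc (n x))) (F x) (g x))) => [x|].
  by rewrite spine_nat.
apply: (ptime_iter_bounded (s := fun x => wt (g x) + wt (n x) * s x)) => //.
  by apply: pboundD (ptime_wt pg) (pboundM (ptime_wt pn) ps).
move=> x i; rewrite spine_nat => lin.
apply: (@leq_trans (wt (g x) + i * s x)); last by rewrite leq_add2l leq_mul2r wt_nat; lia.
elim: i {lin} => [|i IH]; rewrite ?addn0 // iterS.
by apply: leq_trans (hs _ _) _; rewrite mulSn; lia.
Qed.

(** The loop state pairs the unread part of the list with the accumulator. As each element adds at
    most [s (x, y)], the accumulator stays polynomial. *)
Lemma ptime_foldl (l : X -> seq Y) (g : X -> A) (F : X -> A -> Y -> A) (s : X * Y -> nat) :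
  ptime l -> ptime g -> ptime (fun p : X * (A * Y) => F p.1 p.2.1 p.2.2) -> pbound s ->
  (forall x a y, wt (F x a y) <= wt a + s (x, y)) ->
  ptime (fun x => foldl (F x) (g x) (l x)).
Proof.
move=> pl pg pF [q pq hq] hs.
pose G (x : X) (p : seq Y * A) := if p.1 is y :: l' then (l', F x p.2 y) else p.
have iterG i x l0 a : iter i (G x) (l0, a) = (drop i l0, foldl (F x) a (take i l0)).
  elim: i l0 a => [|i IH] [|y l0] a; rewrite ?iterSr //=; last by rewrite -IH.
  by rewrite {2}/G /= IH.
have wt_fold (x : X) a l0 L : wt l0 <= L -> wt (foldl (F x) a l0) <= wt a + size l0 * q (wt x + L).
  elim: l0 a => [|y l0 IH] a; first by rewrite addn0.
  rewrite wt_cons => hL; apply: leq_trans (IH _ _) _; first lia.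
  rewrite [size _]/= mulSn addnA leq_add2r; apply: leq_trans (hs _ _ _) _; rewrite leq_add2l.
  by apply: leq_trans (hq _) _; case: pq => + _; apply; rewrite wt_pair; lia.
set (b := fun x : X => 1 + wt (l x) + (wt (g x) + wt (l x) * q (wt x + wt (l x)))).
apply: (ptime_ext (f := fun x => (iter (spine (enc (l x))) (G x) (l x, g x)).2)) => [x|].
  by rewrite spine_seq iterG take_size.
apply: ptime_snd; apply: (ptime_iter_bounded (F := G) (s := b)) => //.
- exact: ptime_pair.
- pose n (p : X * (seq Y * A)) := p.2; pose l' (p : X * (seq Y * A)) := p.2.1.
  apply: (ptime_matchl (l := l') (n := n) (F := fun p y s => (s, F p.1 p.2.2 y))).
  + by apply/ptime_fst/ptime_snd/ptime_id.
  + by apply/ptime_snd/ptime_id.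
  apply: ptime_pair; first by apply/ptime_snd/ptime_snd/ptime_id.
  apply: (ptime_comp (g := fun p : X * (A * Y) => F p.1 p.2.1 p.2.2)
    (f := fun p : (X * (seq Y * A)) * (Y * seq Y) => (p.1.1, (p.1.2.2, p.2.1)))) => //.
  by do 2?apply: ptime_pair; ptime_proj.
- have pwl := ptime_wt pl; have pwg := ptime_wt pg; rewrite /b.
  have pb : pbound (fun x => q (@wt X cX x + wt (l x))).
    by apply: (pbound_poly pq); pbounds.
  by pbounds.
move=> x i; rewrite spine_seq iterG /b wt_pair => _.
have : wt (drop i (l x)) <= wt (l x).
  by have := wt_cat cY (take i (l x)) (drop i (l x)); rewrite cat_take_drop; have := wt_gt0 (code_seq cY) (take i (l x)); lia.
have : wt (take i (l x)) <= wt (l x).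
  by have := wt_cat cY (take i (l x)) (drop i (l x)); rewrite cat_take_drop; have := wt_gt0 (code_seq cY) (drop i (l x)); lia.
move=> /wt_fold => /(_ x (g x)) h h'.
have : size (take i (l x)) * q (wt x + wt (l x)) <= wt (l x) * q (wt x + wt (l x)).
  rewrite leq_mul2r; apply/orP; right; rewrite size_take_min.
  by have := size_lt_wt cY (l x); lia.
lia.
Qed.

End Library.

Section Library2.
Context {X Y A : Type} {cX : code X} {cY : code Y} {cA : code A}.

Lemma ptime_rev (l : X -> seq Y) : ptime l -> ptime (fun x => rev (l x)).
Proof.
move=> pl; apply: (ptime_ext (f := fun x => foldl (fun a y => y :: a) [::] (l x))) => [x|].
  by rewrite -[l x in LHS]revK foldl_rev; elim: (rev _) => //= y s ->.
apply: (ptime_foldl (F := fun _ a y => y :: a) (s := fun p => wt p)) => //.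
- exact: ptime_const.
- by apply: ptime_cons; [apply/ptime_snd/ptime_snd/ptime_id|apply/ptime_fst/ptime_snd/ptime_id].
- exact: pbound_wt.
by move=> x a y; rewrite wt_cons wt_pair; lia.
Qed.

Lemma ptime_foldr (l : X -> seq Y) (g : X -> A) (F : X -> Y -> A -> A) (s : X * Y -> nat) :
  ptime l -> ptime g -> ptime (fun p : X * (A * Y) => F p.1 p.2.2 p.2.1) -> pbound s ->
  (forall x y a, wt (F x y a) <= wt a + s (x, y)) ->
  ptime (fun x => foldr (F x) (g x) (l x)).
Proof.
move=> pl pg pF ps hs.
apply: (ptime_ext (f := fun x => foldl (fun a y => F x y a) (g x) (rev (l x)))) => [x|].
  by rewrite foldl_rev.
by apply: (ptime_foldl (F := fun x a y => F x y a) (s := s)) => //; apply: ptime_rev.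
Qed.

End Library2.

Section Library3.
Context {X Y A : Type} {cX : code X} {cY : code Y} {cA : code A}.

Lemma ptime_cat (l l' : X -> seq Y) : ptime l -> ptime l' -> ptime (fun x => l x ++ l' x).
Proof.
move=> pl pl'; apply: (ptime_ext (f := fun x => foldr cons (l' x) (l x))) => [x|].
  by elim: (l x) => //= y s ->.
apply: (ptime_foldr (F := fun _ y a => y :: a) (s := fun p => wt p)) => //.
- by apply: ptime_cons; ptime_proj.
- exact: pbound_wt.
by move=> x a y; rewrite wt_cons wt_pair; lia.
Qed.

Lemma ptime_neg (b : X -> bool) : ptime b -> ptime (fun x => ~~ b x).
Proof. by move=> pb; apply: ptime_if => //; apply: ptime_const. Qed.

Lemma ptime_and (b b' : X -> bool) : ptime b -> ptime b' -> ptime (fun x => b x && b' x).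
Proof. by move=> pb pb'; apply: ptime_if => //; apply: ptime_const. Qed.

Lemma ptime_or (b b' : X -> bool) : ptime b -> ptime b' -> ptime (fun x => b x || b' x).
Proof. by move=> pb pb'; apply: ptime_if => //; apply: ptime_const. Qed.

End Library3.

Section Library4.
Context {X Y A : Type} {cX : code X} {cY : code Y} {cA : code A}.

Lemma ptime_has (l : X -> seq Y) (P : X -> Y -> bool) : ptime l ->
  ptime (fun p : X * Y => P p.1 p.2) -> ptime (fun x => has (P x) (l x)).
Proof.
move=> pl pP; apply: (ptime_ext (f := fun x => foldr (fun y b => P x y || b) false (l x))) => [x|].
  by elim: (l x) => //= y s ->.
apply: (ptime_foldr (F := fun x y b => P x y || b) (s := fun=> 3)) => //.
- exact: ptime_const.
- apply: ptime_or; last by ptime_proj.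
  apply: (ptime_comp (g := fun p : X * Y => P p.1 p.2) (f := fun p : X * (bool * Y) => (p.1, p.2.2))) => //.
  by apply: ptime_pair; ptime_proj.
- exact: pbound_const.
by move=> x y a; apply: leq_trans (wt_bool _) _; rewrite leq_addl.
Qed.

Lemma ptime_all (l : X -> seq Y) (P : X -> Y -> bool) : ptime l ->
  ptime (fun p : X * Y => P p.1 p.2) -> ptime (fun x => all (P x) (l x)).
Proof.
move=> pl pP; apply: (ptime_ext (f := fun x => ~~ has (fun y => ~~ P x y) (l x))) => [x|].
  by rewrite -all_predC; apply: eq_all => y /=; rewrite negbK.
by apply: ptime_neg; apply: ptime_has => //; apply: (ptime_neg (b := fun p : X * Y => P p.1 p.2)).
Qed.

Lemma ptime_size (l : X -> seq Y) : ptime l -> ptime (fun x => size (l x)).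
Proof.
move=> pl; apply: (ptime_ext (f := fun x => foldr (fun _ n => n.+1) 0 (l x))) => [x|].
  by elim: (l x) => //= y s ->.
apply: (ptime_foldr (F := fun _ _ n => n.+1) (s := fun=> 2)) => //.
- exact: ptime_const.
- by apply: ptime_S; ptime_proj.
- exact: pbound_const.
by move=> x y a; rewrite !wt_nat; lia.
Qed.

Lemma ptime_add (m n : X -> nat) : ptime m -> ptime n -> ptime (fun x => m x + n x).
Proof.
move=> pm pn; apply: (ptime_ext (f := fun x => iter (m x) succn (n x))) => [x|].
  by rewrite iter_succn addnC.
apply: (ptime_iter (F := fun _ => succn) (s := fun=> 2)) => //.
- by apply: ptime_S; ptime_proj.
- exact: pbound_const.
by move=> x y; rewrite !wt_nat; lia.
Qed.

Lemma ptime_sub (m n : X -> nat) : ptime m -> ptime n -> ptime (fun x => m x - n x).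
Proof.
move=> pm pn; apply: (ptime_ext (f := fun x => iter (n x) predn (m x))) => [x|].
  by elim: (n x) => [|k IH]; rewrite ?subn0 //= IH subnS.
apply: (ptime_iter (F := fun _ => predn) (s := fun=> 2)) => //.
- by apply: ptime_pred; ptime_proj.
- exact: pbound_const.
by move=> x y; rewrite !wt_nat; lia.
Qed.

End Library4.

Section Library6.
Context {X Y A : Type} {cX : code X} {cY : code Y} {cA : code A}.

Lemma ptime_mul (m n : X -> nat) : ptime m -> ptime n -> ptime (fun x => m x * n x).
Proof.
move=> pm pn; apply: (ptime_ext (f := fun x => iter (m x) (addn (n x)) 0)) => [x|].
  by rewrite iter_addn_0 mulnC.
apply: (ptime_iter (F := fun x => addn (n x)) (s := fun x => wt (n x))) => //.
- exact: ptime_const.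
- by apply: ptime_add; [apply: (ptime_comp (g := n)) => //|]; ptime_proj.
- exact: ptime_wt.
by move=> x y; rewrite !wt_nat; lia.
Qed.

Lemma ptime_drop (n : X -> nat) (l : X -> seq Y) : ptime n -> ptime l -> ptime (fun x => drop (n x) (l x)).
Proof.
move=> pn pl; apply: (ptime_ext (f := fun x => iter (n x) behead (l x))) => [x|].
  by rewrite drop_behead.
apply: (ptime_iter (F := fun _ => behead) (s := fun=> 0)) => //.
- by apply: ptime_behead; ptime_proj.
- exact: pbound_const.
by move=> x [|y s]; rewrite ?wt_cons /= ?wt_nil; lia.
Qed.

Lemma ptime_take (n : X -> nat) (l : X -> seq Y) : ptime n -> ptime l -> ptime (fun x => take (n x) (l x)).
Proof.
move=> pn pl; apply: (ptime_ext (f := fun x => rev (drop (size (l x) - n x) (rev (l x))))) => [x|].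
  by rewrite -rev_take revK.
by apply: ptime_rev; apply: ptime_drop; [apply: ptime_sub => //; apply: ptime_size|apply: ptime_rev].
Qed.

Lemma ptime_head (y0 : Y) (l : X -> seq Y) : ptime l -> ptime (fun x => head y0 (l x)).
Proof.
move=> pl; apply: (ptime_matchl (n := fun _ => y0) (F := fun _ y _ => y)) => //; first exact: ptime_const.
by ptime_proj.
Qed.

End Library6.

Section Library7.
Context {X : Type} {Y : eqType} {cX : code X} {cY : code Y}.

Lemma ptime_eq (f g : X -> Y) : ptime f -> ptime g -> ptime (fun x => f x == g x).
Proof.
move=> pf pg; have := ptime_pair pf pg; apply: (ptime_comp (g := fun p : Y * Y => p.1 == p.2)).
apply: (ptime_intro (p := PEq) (T := fun p => 40 * wt p + 60)) => //; last by pbounds.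
by move=> [a b]; rewrite /= (inj_eq enc_inj).
Qed.

End Library7.

Lemma ptime_mem X (Y : eqType) (cX : code X) (cY : code Y) (f : X -> Y) (l : X -> seq Y) : ptime f -> ptime l -> ptime (fun x => f x \in l x).
Proof.
move=> pf pl; apply: (ptime_ext (f := fun x => has (fun y => y == f x) (l x))) => [x|].
  exact: has_pred1.
by apply: ptime_has => //; apply: ptime_eq; [|apply: (ptime_comp (g := f)) => //]; ptime_proj.
Qed.

Lemma ptime_leq X (cX : code X) (m n : X -> nat) : ptime m -> ptime n -> ptime (fun x => m x <= n x).
Proof. by move=> pm pn; apply: ptime_eq; [apply: ptime_sub|apply: ptime_const]. Qed.

(** Decreasing order suits iteration: the next entry is the size of the list so far. *)
Definition below n : seq nat := iter n (fun s => size s :: s) [::].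

Lemma belowE n : below n = rev (iota 0 n).
Proof.
elim: n => // n IH; rewrite /below iterS -/(below n) IH -addn1 iotaD rev_cat /=.
by rewrite size_rev size_iota.
Qed.

Lemma mem_below n i : (i \in below n) = (i < n).
Proof. by rewrite belowE mem_rev mem_iota add0n. Qed.

(** * The verifier *)

Section Norm.
Variable A : eqType.
Implicit Types (rs : seq (seq A * seq A)) (w : seq A).

(** [acc] is the result from the other positions. The original [w] is always the word rewritten, so
    [reduce] makes at most one step. *)
Definition reduce_at rs w i acc : seq A :=
  foldr (fun lr acc => if take (size lr.1) (drop i w) == lr.1
    then take i w ++ lr.2 ++ drop (size lr.1) (drop i w) else acc) acc rs.

Definition reduce rs w : seq A := foldr (fun i acc => reduce_at rs w i acc) w (below (size w)).

(** Each effective round shortens the word, so [size w] rounds reach an irreducible one. *)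
Definition norm rs w := iter (size w) (reduce rs) w.

(** The two kinds of critical pairs at offset [i] in the left-hand side of [p]: its suffix from [i]
    is a prefix of the other left-hand side, or contains that side as a prefix. *)
Definition confluent_at rs p q i :=
  (~~ (take (size (drop i p.1)) q.1 == drop i p.1) ||
    (norm rs (p.2 ++ drop (size (drop i p.1)) q.1) == norm rs (take i p.1 ++ q.2))) &&
  (~~ (take (size q.1) (drop i p.1) == q.1) ||
    (norm rs p.2 == norm rs (take i p.1 ++ q.2 ++ drop (size q.1) (drop i p.1)))).

Definition confluentb rs :=
  all (fun p => all (fun q => all (fun i => confluent_at rs p q i) (below (size p.1))) rs) rs.

Definition invertibleb rs (L : seq A) :=
  all (fun a => has (fun b => norm rs [:: a; b] == [::]) L) L.

Definition power w n := iter n (cat w) [::].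

(** This is [torsion_test] with [M] in place of [sigma]: there [4 K + sigma] is [9 M], and [K] is
    [2 * M]. *)
Definition torsionb M rs w :=
  size (norm rs (power w (8 * size (norm rs w) + 9 * M + 1))) + 2 * (size (norm rs w) + 2 * M)
    < 8 * size (norm rs w) + 9 * M + 1.

Definition witnessb M rs a b c :=
  [&& torsionb M rs a, torsionb M rs b, torsionb M rs c, ~~ (norm rs b == [::]),
      torsionb M rs (a ++ b), torsionb M rs (b ++ c) & ~~ torsionb M rs (a ++ c)].

Section Spec.
Variable rs : seq (seq A * seq A).
Hypothesis reducing : all (fun lr => size lr.2 < size lr.1) rs.
Let T : relation (seq A) := fun l r => (l, r) \in rs.

Lemma reduce_atP w i acc : (exists2 t, reduce_at rs w i acc = t & rw_step T w t) \/
  reduce_at rs w i acc = acc /\ forall l r, T l r -> take (size l) (drop i w) <> l.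
Proof.
rewrite /T; elim: rs => [|[l r] rs' IH]; first by right.
rewrite [reduce_at _ _ _ _]/=; case: eqP => [e|ne].
  left; eexists; first by []; exists (take i w), (drop (size l) (drop i w)), l, r.
  by rewrite mem_head -[X in _ ++ X ++ _]e !cat_take_drop.
case: IH => [[t e [u [v [l' [r' [h e1 e2]]]]]]|[e h]].
  left; exists t => //; exists u, v, l', r'; split=> //.
  by rewrite in_cons h orbT.
right; split=> // l' r'; rewrite in_cons => /orP[/eqP[-> _]|]; [exact: ne|exact: h].
Qed.

Lemma reduceP w : rw_step T w (reduce rs w) \/ reduce rs w = w /\ irreducible T w.
Proof.
suff [[t -> h]|[-> h]] : (exists2 t, reduce rs w = t & rw_step T w t) \/ reduce rs w = w /\
    forall i, i \in below (size w) -> forall l r, T l r -> take (size l) (drop i w) <> l.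
- by left.
- right; split=> // y [u [v [l [r [Tlr e _]]]]].
  apply: (h (size u) _ l r Tlr); last by rewrite e drop_size_cat // take_size_cat.
  rewrite mem_below e !size_cat; have := allP reducing _ Tlr; rewrite /=; lia.
rewrite /reduce; elim: (below _) => [|i s [[t e h]|[e h]]] /=; first by right.
  have [[t' e' h']|[e' h']] := reduce_atP w i (foldr (fun i => reduce_at rs w i) w s).
    by left; exists t'.
  by left; exists t; rewrite // e'.
have [[t' e' h']|[e' h']] := reduce_atP w i (foldr (fun i => reduce_at rs w i) w s).
  by left; exists t'.
right; split; first by rewrite e'.
by move=> j; rewrite in_cons => /orP[/eqP->|/h].
Qed.

Lemma reducingT : length_reducing T. Proof. by move=> l r /(allP reducing). Qed.

Lemma normP w : rw_star T w (norm rs w) /\ irreducible T (norm rs w).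
Proof.
have h k : rw_star T w (iter k (reduce rs) w) /\
    (irreducible T (iter k (reduce rs) w) \/ size (iter k (reduce rs) w) + k <= size w).
  elim: k => [|k [IH1 IH2]] /=.
    by split; [exact: star_refl|right; rewrite addn0].
  have [h|[-> h]] := reduceP (iter k (reduce rs) w); last by split=> //; left.
  split; first by apply: star_trans IH1 _; apply: rt_step.
  case: IH2 => [/(_ _ h)//|IH2]; right; have := step_size reducingT h; lia.
have [h1 [h2|h2]] := h (size w); split=> // y s; have := step_size reducingT s.
by move: h2; rewrite -/(norm rs w); lia.
Qed.

Lemma joinable_norm x y : norm rs x = norm rs y -> joinable T x y.
Proof.
move=> e; exists (norm rs x); first by have [] := normP x.
by rewrite e; have [] := normP y.
Qed.

Lemma norm_joinable x y : confluent T -> rw_equiv T x y -> norm rs x = norm rs y.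
Proof.
move=> confl exy; have [sx ix] := normP x; have [sy iy] := normP y.
apply: (irreducible_unique confl ix iy).
apply: rst_trans (rst_sym _ _ _ _ (rw_star_equiv sx)) _.
exact: rst_trans exy (rw_star_equiv sy).
Qed.

Lemma norm_irreducible w : irreducible T w -> norm rs w = w.
Proof. by move=> iw; have [/(irreducible_star iw)] := normP w. Qed.

(** Comparing outputs of [norm] makes sense before confluence is known: equal outputs always give
    joinability, and the converse is needed only when the system is confluent. *)
Lemma confluentbP : confluent T <-> confluentb rs.
Proof.
split=> [confl|/allP h].
  apply/allP => -[l1 r1] h1; apply/allP => -[l2 r2] h2; apply/allP => i _.
  have s1 u v : rw_equiv T (u ++ l1 ++ v) (u ++ r1 ++ v).
    by apply: rst_step; exists u, v, l1, r1.
  have s2 u v : rw_equiv T (u ++ l2 ++ v) (u ++ r2 ++ v).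
    by apply: rst_step; exists u, v, l2, r2.
  apply/andP; split; rewrite -implybE; apply/implyP => /eqP /= e; apply/eqP/norm_joinable => //.
    apply: rst_trans (rst_sym _ _ _ _ (s1 [::] _)) _.
    have := s2 (take i l1) [::]; rewrite !cats0 -[l2 in take i l1 ++ l2](cat_take_drop (size (drop i l1))) e.
    by rewrite catA cat_take_drop.
  have := rst_sym _ _ _ _ (s1 [::] [::]); rewrite /= !cats0 => s1'; apply: rst_trans s1' _.
  have := s2 (take i l1) (drop (size l2) (drop i l1)).
  by rewrite -[l2 in take i l1 ++ l2 ++ _]e !cat_take_drop.
apply: newman (reducing_terminating reducingT) (critical_pairs _).
move=> l1 r1 l2 r2 h1 h2; have /allP/(_ _ h2)/allP {}h := h _ h1.
have pos l r : T l r -> 0 < size l by move=> /reducingT; lia.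
split=> [x y z e1 e2 ny|x z e1].
  have := h (size x); rewrite mem_below /= e1 size_cat /confluent_at /=.
  have : 0 < size y by case: y ny {e1 e2}.
  move=> y0; rewrite -addn1 leq_add2l => /(_ y0) /andP[+ _].
  by rewrite drop_size_cat // e2 take_size_cat // eqxx drop_size_cat // take_size_cat //= => /eqP/joinable_norm.
have := h (size x); rewrite mem_below /= e1 !size_cat /confluent_at /=.
have l0 := pos _ _ h2; move=> /(_ ltac:(lia)) /andP[_].
by rewrite drop_size_cat // take_size_cat // eqxx drop_size_cat // take_size_cat //= => /eqP/joinable_norm.
Qed.

End Spec.
End Norm.

Section Naturality.
Variables (A B : eqType) (f : A -> B).
Hypothesis f_inj : injective f.
Implicit Types (rs : seq (seq A * seq A)) (w : seq A).
Let F := map f.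
Let FF (lr : seq A * seq A) := (F lr.1, F lr.2).

Let F_inj : injective F. Proof. exact: inj_map. Qed.

(** The verifier computes with numbers as letters, whereas the group lives over an ordinal type; all
    tests are invariant under injective renaming. *)
Lemma map_reduce rs w : reduce (map FF rs) (F w) = F (reduce rs w).
Proof.
rewrite /reduce size_map; elim: (below _) => //= i s ->; move: (foldr _ _ _) => acc.
rewrite /reduce_at; elim: rs => //= -[l r] rs -> /=.
rewrite size_map -map_drop -map_take (inj_eq F_inj); case: ifP => // _.
by rewrite /F !map_cat map_take !map_drop.
Qed.

Lemma map_norm rs w : norm (map FF rs) (F w) = F (norm rs w).
Proof. by rewrite /norm size_map; elim: (size w) => //= k ->; rewrite map_reduce. Qed.

Lemma map_confluentb rs : confluentb (map FF rs) = confluentb rs.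
Proof.
rewrite /confluentb all_map; apply: eq_all => p /=; rewrite all_map; apply: eq_all => q /=.
rewrite size_map; apply: eq_all => i; rewrite /confluent_at /= /F.
by rewrite !size_map -!map_drop -!map_take -!map_cat !map_norm !(inj_eq F_inj) !size_map.
Qed.

Lemma map_invertibleb rs L : invertibleb (map FF rs) (F L) = invertibleb rs L.
Proof.
rewrite /invertibleb all_map; apply: eq_all => a /=; rewrite has_map; apply: eq_has => b /=.
by rewrite -[[:: f a; f b]]/(F [:: a; b]) map_norm; case: norm.
Qed.

Lemma map_power w n : power (F w) n = F (power w n).
Proof. by rewrite /power; elim: n => //= n ->; rewrite /F map_cat. Qed.

Lemma map_torsionb M rs w : torsionb M (map FF rs) (F w) = torsionb M rs w.
Proof. by rewrite /torsionb map_norm !size_map map_power map_norm size_map. Qed.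

Lemma map_witnessb M rs a b c :
  witnessb M (map FF rs) (F a) (F b) (F c) = witnessb M rs a b c.
Proof.
rewrite /witnessb /F -!map_cat !map_torsionb map_norm.
by case: (norm rs b).
Qed.

End Naturality.

(** * Decoding of bit strings *)

Definition unary k := rcons (nseq k true) false.

(* A bit string ending with 0 is a list of unary numbers; the number 0 closes a
   word and k + 1 stands for the letter k. *)
Definition blocks (x : seq bool) : seq nat :=
  foldr (fun (b : bool) acc => if b then (head 0 acc).+1 :: behead acc else 0 :: acc) [::] x.

Definition words (ns : seq nat) : seq (seq nat) :=
  foldr (fun k acc => if k == 0 then [::] :: acc else (k.-1 :: head [::] acc) :: behead acc)
    [::] ns.

(** The first component holds the word left unpaired when the number of words is odd. *)
Definition pairs A (ws : seq A) : seq A * seq (A * A) :=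
  foldr (fun w p => if p.1 is r :: _ then ([::], (w, r) :: p.2) else ([:: w], p.2))
    ([::], [::]) ws.

Definition flat_word (w : seq nat) := rcons (map succn w) 0.

Lemma blocksK ns : blocks (flatten (map unary ns)) = ns.
Proof.
elim: ns => //= n ns; rewrite /blocks foldr_cat => ->; rewrite /unary -cats1 foldr_cat /=.
have : forall m, foldr (fun (b : bool) acc => if b then (head 0 acc).+1 :: behead acc else 0 :: acc)
  (m :: ns) (nseq n true) = m + n :: ns by elim: n => [|n IH] m /=; rewrite ?addn0 // IH addnS.
exact.
Qed.

(** The default [true] excludes the empty string, which encodes no system. *)
Lemma blocksP x : last true x = false ->
  x = flatten (map unary (blocks x)) /\ blocks x <> [::].
Proof.
elim: x => // b [|b' x] IH; first by case: b.
have blocks_cons a y : blocks (a :: y) =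
  if a then (head 0 (blocks y)).+1 :: behead (blocks y) else 0 :: blocks y by [].
move=> /IH[e ne]; rewrite {1}e (blocks_cons b); move: (blocks (b' :: x)) ne => [|n ns] // _.
by case: b; split.
Qed.

Lemma wordsK ws : words (flatten (map flat_word ws)) = ws.
Proof.
elim: ws => //= w ws; rewrite /words foldr_cat => ->; rewrite /flat_word -cats1 foldr_cat /=.
have : forall v, foldr (fun k acc => if k == 0 then [::] :: acc else (k.-1 :: head [::] acc) :: behead acc)
  (v :: ws) (map succn w) = (w ++ v) :: ws by elim: w => [|k w IH] v //=; rewrite IH.
by move=> ->; rewrite cats0.
Qed.

Lemma wordsP ns : last 0 ns = 0 -> ns = flatten (map flat_word (words ns)).
Proof.
suff h : last 0 ns = 0 -> ns = flatten (map flat_word (words ns)) /\ (ns <> [::] -> words ns <> [::]).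
  by move=> /h[].
elim: ns => // k [|k' ns] IH; first by move=> /= ->.
have words_cons a y : words (a :: y) =
  if a == 0 then [::] :: words y else (a.-1 :: head [::] (words y)) :: behead (words y) by [].
move=> /IH[e ne]; rewrite {1}e (words_cons k).
by move: (words (k' :: ns)) (ne ltac:(by [])) => [|w ws] // _; case: k.
Qed.

Lemma pairsK A (rs : seq (A * A)) : pairs (flatten [seq [:: lr.1; lr.2] | lr <- rs]) = ([::], rs).
Proof. by elim: rs => //= -[l r] rs; rewrite /pairs => ->. Qed.

Lemma pairsP A (ws : seq A) : (pairs ws).1 = [::] ->
  ws = flatten [seq [:: lr.1; lr.2] | lr <- (pairs ws).2].
Proof.
have : ws = (pairs ws).1 ++ flatten [seq [:: lr.1; lr.2] | lr <- (pairs ws).2] /\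
    size (pairs ws).1 <= 1.
  elim: ws => //= w ws [e l]; case: (pairs ws) e l => -[|r [|? ?]] rs //= e _.
    by split=> //; rewrite -e.
  by split=> //; rewrite -e.
by move=> [e _] e'; rewrite {1}e e'.
Qed.

(** A letter [i] is encoded as the unary number [i + 1] and the end of a word as the unary number 0,
    so the whole encoding is one list of unary numbers. *)
Lemma encode_unary n (rs : seq (seq nat * seq nat)) :
  rcons (nseq n true) false ++ encode_rules rs =
  flatten (map unary (n :: flatten (map flat_word (flatten [seq [:: lr.1; lr.2] | lr <- rs])))).
Proof.
have enc_w w : encode_word w = flatten (map unary (flat_word w)).
  by elim: w => //= k w IH; rewrite encode_word_cons IH.
rewrite /=; congr cat; rewrite /encode_rules; elim: rs => //= -[l r] rs IH.
by rewrite !map_cat !flatten_cat -IH !enc_w catA.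
Qed.

Ltac pt := cbv beta; repeat match goal with
  | |- ptime (fun _ => ?c) => refine (ptime_const c)
  | |- ptime (fun x => x) => refine ptime_id
  | |- ptime fst => refine (ptime_fst (f := fun x => x) _)
  | |- ptime snd => refine (ptime_snd (f := fun x => x) _)
  | |- ptime (fun x => (@?f x, @?g x)) => refine (ptime_pair (f := f) (g := g) _ _)
  | |- ptime (fun x => (@?f x).1) => refine (ptime_fst (f := f) _)
  | |- ptime (fun x => (@?f x).2) => refine (ptime_snd (f := f) _)
  | |- ptime (fun x => @?f x :: @?g x) => refine (ptime_cons (f := f) (s := g) _ _)
  | |- ptime (fun x => @?f x ++ @?g x) => refine (ptime_cat (l := f) (l' := g) _ _)
  | |- ptime (fun x => behead (@?f x)) => refine (ptime_behead (s := f) _)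
  | |- ptime (fun x => head ?d (@?f x)) => refine (ptime_head d (l := f) _)
  | |- ptime (fun x => rev (@?f x)) => refine (ptime_rev (l := f) _)
  | |- ptime (fun x => size (@?f x)) => refine (ptime_size (l := f) _)
  | |- ptime (fun x => take (@?n x) (@?f x)) => refine (ptime_take (n := n) (l := f) _ _)
  | |- ptime (fun x => drop (@?n x) (@?f x)) => refine (ptime_drop (n := n) (l := f) _ _)
  | |- ptime (fun x => (@?f x) + (@?g x)) => refine (ptime_add (m := f) (n := g) _ _)
  | |- ptime (fun x => (@?f x) * (@?g x)) => refine (ptime_mul (m := f) (n := g) _ _)
  | |- ptime (fun x => (@?f x) <= (@?g x)) => refine (ptime_leq (m := f) (n := g) _ _)
  | |- ptime (fun x => (@?f x).+1) => refine (ptime_S (f := f) _)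
  | |- ptime (fun x => (@?f x).-1) => refine (ptime_pred (f := f) _)
  | |- ptime (fun x => ~~ (@?f x)) => refine (ptime_neg (b := f) _)
  | |- ptime (fun x => (@?f x) && (@?g x)) => refine (ptime_and (b := f) (b' := g) _ _)
  | |- ptime (fun x => (@?f x) || (@?g x)) => refine (ptime_or (b := f) (b' := g) _ _)
  | |- ptime (fun x => (@?f x) == (@?g x)) => refine (ptime_eq (f := f) (g := g) _ _)
  | |- ptime (fun x => if _ then _ else _) => apply ptime_if
  | |- ptime (fun x => has (@?P x) (@?l x)) => refine (ptime_has (P := P) (l := l) _ _); cbv beta
  | |- ptime (fun x => all (@?P x) (@?l x)) => refine (ptime_all (P := P) (l := l) _ _); cbv beta
  | _ => assumption
  end.

Lemma ptime_below X (cX : code X) (n : X -> nat) : ptime n -> ptime (fun x => below (n x)).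
Proof.
move=> pn.
apply: (ptime_ext (f := fun x => iter (spine (enc (n x))) (fun s => size s :: s) [::])) => [x|].
  by rewrite spine_nat.
apply: (ptime_iter_bounded (F := fun _ s => size s :: s) (g := fun _ => [::])
  (s := fun x => wt (n x) * (wt (n x) + wt (n x) + 2) + 1)) => //.
- by pt.
- by pt.
- by have pw := ptime_wt pn; pbounds.
move=> x i; rewrite spine_nat => le_i.
have [h sz_i] : wt (below i) <= i * (2 * i + 2) + 1 /\ size (below i) = i.
  elim: i {le_i} => // i [IH sz_i]; rewrite /below iterS -/(below i) /= sz_i; split=> //.
  rewrite wt_cons wt_nat; nia.
apply: leq_trans h _; rewrite wt_nat; nia.
Qed.

Notation word := (seq nat).
Notation rules := (seq (seq nat * seq nat)).

Lemma wt_take X (cX : code X) (s : seq X) i : wt (take i s) <= wt s.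
Proof.
have := wt_cat cX (take i s) (drop i s); rewrite cat_take_drop.
have := wt_gt0 (code_seq cX) (drop i s); lia.
Qed.

Lemma wt_drop X (cX : code X) (s : seq X) i : wt (drop i s) <= wt s.
Proof.
have := wt_cat cX (take i s) (drop i s); rewrite cat_take_drop.
have := wt_gt0 (code_seq cX) (take i s); lia.
Qed.

Lemma wt_reduce_at (rs : rules) (w : word) i acc L :
  wt acc <= wt w + L -> wt rs <= L -> wt (reduce_at rs w i acc) <= wt w + L.
Proof.
move=> hacc; elim: rs => //= -[l r] rs IH; rewrite wt_cons wt_pair => hL; case: eqP => _ /=.
  have := wt_cat code_nat (take i w) (drop i w); rewrite cat_take_drop.
  have := wt_cat code_nat (take i w) (r ++ drop (size l) (drop i w)).
  have := wt_cat code_nat r (drop (size l) (drop i w)).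
  have := wt_drop code_nat (drop i w) (size l); lia.
by apply: IH; lia.
Qed.

Lemma wt_reduce (rs : rules) (w : word) : wt (reduce rs w) <= wt w + wt rs.
Proof.
by rewrite /reduce; elim: (below _) => [|i s IH] /=; [rewrite leq_addr|exact: wt_reduce_at].
Qed.

Lemma ptime_reduce X (cX : code X) (rs : X -> rules) (w : X -> word) :
  ptime rs -> ptime w -> ptime (fun x => reduce (rs x) (w x)).
Proof.
move=> prs pw; apply: (ptime_comp (g := fun p : rules * word => reduce p.1 p.2)
  (f := fun x => (rs x, w x))); last by pt.
apply: (ptime_foldr (l := fun p : rules * word => below (size p.2))
  (F := fun p i acc => reduce_at p.1 p.2 i acc)
  (s := fun p => wt p)).
- by apply: ptime_below; pt.
- by pt.
- apply: (ptime_foldr (l := fun p : (rules * word) * (word * nat) => p.1.1)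
    (F := fun p (lr : word * word) acc => if take (size lr.1) (drop p.2.2 p.1.2) == lr.1
      then take p.2.2 p.1.2 ++ lr.2 ++ drop (size lr.1) (drop p.2.2 p.1.2) else acc)
    (s := fun p => 2 * wt p)).
  + by pt.
  + by pt.
  + by pt.
  + by pbounds.
  move=> [[rs1 w1] [a i]] [l r] acc; rewrite /= !wt_pair; case: eqP => _; last by lia.
  have := wt_cat code_nat (take i w1) (r ++ drop (size l) (drop i w1)).
  have := wt_cat code_nat r (drop (size l) (drop i w1)).
  have := wt_drop code_nat (drop i w1) (size l).
  have := wt_drop code_nat w1 i; have := wt_take code_nat w1 i; lia.
- exact: pbound_wt.
move=> [rs1 w1] i acc; rewrite !wt_pair.
by apply: leq_trans (@wt_reduce_at rs1 w1 i acc (wt acc + wt rs1) _ _) _; rewrite /=; lia.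
Qed.

Lemma ptime_norm X (cX : code X) (rs : X -> rules) (w : X -> word) :
  ptime rs -> ptime w -> ptime (fun x => norm (rs x) (w x)).
Proof.
move=> prs pw; apply: (ptime_iter (n := fun x => size (w x)) (F := fun x => reduce (rs x))
  (s := fun x => wt (rs x))) => //.
- by pt.
- by apply: ptime_reduce; [apply: (ptime_comp (g := rs)) => //|]; pt.
- exact: ptime_wt.
by move=> x y; exact: wt_reduce.
Qed.

Ltac ptn := pt; repeat (first [apply: ptime_norm | apply: ptime_below]; pt).

Lemma ptime_confluentb : ptime (fun rs : rules => confluentb rs).
Proof. by rewrite /confluentb /confluent_at; ptn. Qed.

Lemma ptime_invertibleb : ptime (fun p : rules * word => invertibleb p.1 p.2).
Proof. by rewrite /invertibleb; ptn. Qed.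

Lemma ptime_power X (cX : code X) (w : X -> word) (n : X -> nat) :
  ptime w -> ptime n -> ptime (fun x => power (w x) (n x)).
Proof.
move=> pw pn; apply: (ptime_iter (F := fun x => cat (w x)) (s := fun x => wt (w x))) => //.
- by pt.
- by pt; apply: (ptime_comp (g := w)) => //; pt.
- exact: ptime_wt.
by move=> x y; rewrite addnC -(wt_cat code_nat) leq_addr.
Qed.

Lemma ptime_torsionb X (cX : code X) (M : X -> nat) (rs : X -> rules) (w : X -> word) :
  ptime M -> ptime rs -> ptime w -> ptime (fun x => torsionb (M x) (rs x) (w x)).
Proof. by move=> pM prs pw; rewrite /torsionb; ptn; apply: ptime_power; ptn. Qed.

Lemma ptime_witnessb X (cX : code X) (M : X -> nat) (rs : X -> rules) (a b c : X -> word) :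
  ptime M -> ptime rs -> ptime a -> ptime b -> ptime c ->
  ptime (fun x => witnessb (M x) (rs x) (a x) (b x) (c x)).
Proof. by move=> pM prs pa pb pc; rewrite /witnessb; ptn; apply: ptime_torsionb; ptn. Qed.

Lemma ptime_blocks X (cX : code X) (x : X -> seq bool) : ptime x -> ptime (fun e => blocks (x e)).
Proof.
move=> px; apply: (ptime_foldr (F := fun _ (b : bool) acc =>
  if b then (head 0 acc).+1 :: behead acc else 0 :: acc) (s := fun _ => 4)) => //; try by pt.
  by pbounds.
move=> e [] [|k acc]; rewrite /= ?wt_cons ?wt_nil ?wt_nat; lia.
Qed.

Lemma ptime_words X (cX : code X) (ns : X -> word) : ptime ns -> ptime (fun e => words (ns e)).
Proof.
move=> px; apply: (ptime_foldr (F := fun _ k acc =>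
  if k == 0 then [::] :: acc else (k.-1 :: head [::] acc) :: behead acc)
  (s := fun p => wt p + 4)) => //; try by pt.
  by pbounds.
move=> e k acc; rewrite wt_pair !wt_nat; case: k => [|k]; first by rewrite /= wt_cons wt_nil; lia.
case: acc => [|w acc]; rewrite /= ?wt_cons ?wt_nil ?wt_nat; lia.
Qed.

Lemma ptime_pairs X (cX : code X) (ws : X -> seq word) : ptime ws -> ptime (fun e => pairs (ws e)).
Proof.
move=> px; apply: (ptime_foldr (F := fun _ w (p : seq word * rules) =>
  if p.1 is r :: _ then ([::], (w, r) :: p.2) else ([:: w], p.2))
  (s := fun p => wt p + 5)) => //; try by pt.
- apply: (ptime_matchl (F := fun (p : X * ((seq word * rules) * word)) r _ => ([::], (p.2.2, r) :: p.2.1.2)) (l := fun p : X * ((seq word * rules) * word) => p.2.1.1)); by pt.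
- by pbounds.
move=> e w [[|r ?] rs]; rewrite /= !wt_pair ?wt_cons ?wt_nil ?wt_pair; lia.
Qed.

(** The fold carries the rules already seen along with the answer. *)
Definition uniqb (rs : rules) := (foldr (fun lr (p : rules * bool) =>
  (lr :: p.1, (lr \notin p.1) && p.2)) ([::], true) rs).2.

Lemma uniqbE rs : uniqb rs = uniq rs.
Proof.
rewrite /uniqb; suff -> : foldr (fun lr (p : rules * bool) =>
  (lr :: p.1, (lr \notin p.1) && p.2)) ([::], true) rs = (rs, uniq rs) by [].
by elim: rs => //= lr rs ->.
Qed.

Lemma ptime_uniqb : ptime uniqb.
Proof.
apply: ptime_snd; apply: (ptime_foldr (l := fun rs : rules => rs) (F := fun _ lr (p : rules * bool) =>
  (lr :: p.1, (lr \notin p.1) && p.2)) (s := fun p => wt p + 5)); try by pt.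
- by pt; apply: ptime_mem; pt.
- by pbounds.
move=> x lr [rs b]; rewrite !wt_pair wt_cons /=.
set c := wt (_ && _); have : c <= 3 := wt_bool _.
by set r := wt rs; set l := wt lr; lia.
Qed.

Lemma NP_ptime (R : seq bool -> nat) (V : seq bool * seq bool -> bool) (L : seq bool -> Prop) :
  ptime R -> ptime V -> (forall x, L x <-> exists2 u, size u <= R x & V (u, x)) -> in_NP L.
Proof.
move=> pR pV LV; have [qR pqR hR] := ptime_wt pR.
have [r [q1 pq1 [e1 b1]]] := ptime_elim pR; have [v [q2 pq2 [e2 b2]]] := ptime_elim pV.
have wt_bits (x : seq bool) : wt x <= 4 * size x + 1 by exact: sz_enc_bits.
have boundE x : bound r x = R x by rewrite /bound (e1 x) spine_nat.
pose w n := 4 * n + 1.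
have pw : poly w by rewrite /w; polys.
have pqR' : poly (fun n => qR (w n)) := poly_comp pqR pw.
have pq1' : poly (fun n => q1 (w n)) := poly_comp pq1 pw.
have pqU : poly (fun n => 4 * qR (w n) + 1 + w n + 1) by polys.
have pq2' : poly (fun n => q2 (4 * qR (w n) + 1 + w n + 1)) := poly_comp pq2 pqU.
have pq : poly (fun n => qR (w n) + q1 (w n) + q2 (4 * qR (w n) + 1 + w n + 1)).
  by apply: polyD pq2'; apply: polyD.
have leR x : wt (R x) <= qR (w (size x)).
  by apply: leq_trans (hR x) _; case: pqR => + _; apply.
apply: (NP_intro (r := r) (v := v) (q := fun n => qR (w n) + q1 (w n) + q2 (4 * qR (w n) + 1 + w n + 1))).
- by case: pq.
- by move=> x; rewrite (e1 x) -/(wt (R x)); have := leR x; lia.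
- move=> x; have := b1 x => h; apply: leq_trans h _.
  have : q1 (wt x) <= q1 (w (size x)) by case: pq1 => + _; apply.
  lia.
- move=> x u; rewrite boundE => hu; have := b2 (u, x) => h; apply: leq_trans h _.
  have : q2 (wt (u, x)) <= q2 (4 * qR (w (size x)) + 1 + w (size x) + 1).
    case: pq2 => + _; apply; rewrite wt_pair; have := wt_bits u; have := wt_bits x.
    have := leR x; rewrite wt_nat /w; lia.
  lia.
move=> x; rewrite LV; split=> -[u hu hV]; exists u; rewrite ?boundE // in hu *.
  by have := e2 (u, x); rewrite hV => h; rewrite [eval _ _]h.
by move: hV; have := e2 (u, x) => h; rewrite [eval _ _]h; case: (V (u, x)).
Qed.

(** * Correctness of the certificate test *)

Section Verify.
Variables (n : nat) (rs : seq (seq 'I_n * seq 'I_n)).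
Let T : relation (seq 'I_n) := fun l r => (l, r) \in rs.
Hypotheses (h : inverse_closed T) (confl : confluent T).
Hypothesis reducing : all (fun lr => size lr.2 < size lr.1) rs.
Variable M : nat.
Hypothesis lhs_le : forall l r, T l r -> size l <= M.
Let red : length_reducing T := reducingT reducing.
Local Notation cls := (word_class h).

Lemma nf_norm w : nf red (cls w) = norm rs w.
Proof.
have := norm_joinable reducing confl (rw_star_equiv (nf_star h red confl w)).
by rewrite [X in _ = X]norm_irreducible //; exact: nf_irr.
Qed.

Lemma len_norm w : len red (cls w) = size (norm rs w).
Proof. by rewrite /len nf_norm. Qed.

Lemma cls_power w k : cls (power w k) = (cls w ^+ k)%g.
Proof. by elim: k => [|k IH]; rewrite ?cls_nil // /power iterS -/(power w k) cls_cat IH expgS. Qed.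

Lemma torsionbP w : torsionb M rs w <-> torsion (cls w).
Proof.
set N := 8 * size (norm rs w) + 9 * M + 1.
have hN : 8 * len red (cls w) + 4 * M.*2 + M < N by rewrite len_norm /N -muln2; lia.
rewrite (torsion_test confl lhs_le hN) -cls_power !len_norm /torsionb -/N -!muln2.
by rewrite [2 * (_ + _)]mulnC [2 * M]mulnC.
Qed.

Lemma cls_neq1 w : cls w <> 1%g <-> ~~ (norm rs w == [::]).
Proof.
split=> [ne|/eqP ne e].
  apply/eqP => e; apply: ne; rewrite -(nfK red (cls w)) nf_norm e; exact: cls_nil.
by apply: ne; rewrite -nf_norm e -(cls_nil h) nf_norm.
Qed.

Lemma witnessbP a b c : witnessb M rs a b c <-> witness (cls a) (cls b) (cls c).
Proof.
rewrite /witnessb /witness -!cls_cat; split.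
  move=> /and5P[/torsionbP ta /torsionbP tb /torsionbP tc /cls_neq1 nb].
  move=> /and3P[/torsionbP tab /torsionbP tbc tac]; split=> //; split=> //.
  by move=> /torsionbP; apply/negP.
move=> [/torsionbP -> /torsionbP -> /torsionbP -> /cls_neq1 -> [/torsionbP -> /torsionbP -> tac]].
by rewrite /=; apply/negP => /torsionbP.
Qed.

Lemma witness_not_plain a b c : witnessb M rs a b c -> ~ plain (presented h).
Proof. by move=> /witnessbP w /plain_transitive/(_ _ _ _ w). Qed.

Lemma not_plain_witness : ~ plain (presented h) -> exists a b c : seq 'I_n,
  [/\ size a <= 598 * M + 200, size b <= 598 * M + 200, size c <= 598 * M + 200 & witnessb M rs a b c].
Proof.
move=> np; have [a [b [c w]]] : exists a b c : presented h, witness a b c.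
  apply: contrapT => nw; apply/np/(transitive_plain red confl lhs_le) => a b c w.
  by apply: nw; exists a, b, c.
have [{w}a [{}b [{}c [w [la lb lc]]]]] := short_witness red confl lhs_le w.
exists (nf red a), (nf red b), (nf red c); split=> //.
by apply/witnessbP; rewrite !nfK.
Qed.

End Verify.

Definition rules_over n (rs : rules) := all (fun lr => all (fun k => k < n) lr.1 && all (fun k => k < n) lr.2) rs.

Definition parse_rules (x : seq bool) := pairs (words (behead (blocks x))).
Definition parse_alph (x : seq bool) := head 0 (blocks x).

(** Here [head d (rev s)] is the last entry of [s]. The default [true] rejects the empty string,
    while the default 0 admits an empty list of rules. *)
Definition well_formed (x : seq bool) :=
  [&& ~~ head true (rev x), head 0 (rev (behead (blocks x))) == 0, (parse_rules x).1 == [::],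
      0 < parse_alph x, rules_over (parse_alph x) (parse_rules x).2,
      all (fun lr => size lr.2 < size lr.1) (parse_rules x).2, uniqb (parse_rules x).2,
      confluentb (parse_rules x).2 & invertibleb (parse_rules x).2 (below (parse_alph x))].

(** The input length serves as the bound [M] on left-hand sides, by [lhs_le]. *)
Definition verify (p : seq bool * seq bool) :=
  well_formed p.2 &&
  ([&& all (fun k => k < parse_alph p.2) (head [::] (words (blocks p.1))),
       all (fun k => k < parse_alph p.2) (head [::] (behead (words (blocks p.1)))),
       all (fun k => k < parse_alph p.2) (head [::] (behead (behead (words (blocks p.1))))) &
       witnessb (size p.2) (parse_rules p.2).2 (head [::] (words (blocks p.1)))
         (head [::] (behead (words (blocks p.1))))
         (head [::] (behead (behead (words (blocks p.1)))))]).

Lemma ptime_verify : ptime verify.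
Proof.
pose R (p : seq bool * seq bool) := parse_rules p.2.
have pblocks : ptime (fun p : seq bool * seq bool => blocks p.2) by apply: ptime_blocks; pt.
have pR : ptime (fun p : seq bool * seq bool => parse_rules p.2).
  by apply: ptime_pairs; apply: ptime_words; pt.
have pn : ptime (fun p : seq bool * seq bool => parse_alph p.2) by rewrite /parse_alph; pt.
have pcs : ptime (fun p : seq bool * seq bool => words (blocks p.1)).
  by apply: ptime_words; apply: ptime_blocks; pt.
have pn' Y (cY : code Y) (f : Y -> seq bool * seq bool) : ptime f -> ptime (fun e => parse_alph (f e).2).
  by move=> pf; apply: ptime_comp pn pf.
rewrite /verify /well_formed /rules_over; pt.
- by apply: pn'; pt.
- by apply: pn'; pt.
- by apply: (ptime_comp (g := uniqb)) ptime_uniqb _; pt.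
- by apply: (ptime_comp (g := fun rs : rules => confluentb rs)) ptime_confluentb _; pt.
- apply: (ptime_comp (g := fun p : rules * word => invertibleb p.1 p.2)
    (f := fun p : seq bool * seq bool => ((parse_rules p.2).2, below (parse_alph p.2)))) ptime_invertibleb _.
  by pt; apply: ptime_below; pt.
- by apply: pn'; pt.
- by apply: pn'; pt.
- by apply: pn'; pt.
by apply: ptime_witnessb; pt.
Qed.

(** With [n] the input length, each of the three words has at most [600 (n + 1)] letters of at most
    [n + 1] bits and one closing bit: [1800 (n + 1)^2 + 3] bits in all. *)
Definition cert_bound (x : seq bool) := 2000 * (size x).+1 * (size x).+1.

Lemma ptime_cert_bound : ptime cert_bound.
Proof. by rewrite /cert_bound; pt. Qed.

Definition val_rules n (rs : seq (seq 'I_n * seq 'I_n)) : rules :=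
  [seq (map val lr.1, map val lr.2) | lr <- rs].

Lemma word_over n (w : word) : all (fun k => k < n) w -> exists w' : seq 'I_n, w = map val w'.
Proof.
elim: w => [|k w IH] /=; first by exists [::].
by move=> /andP[lk /IH[w' ->]]; exists (Ordinal lk :: w').
Qed.

Lemma rules_over_val n (rs : rules) : rules_over n rs -> exists rs' : seq (seq 'I_n * seq 'I_n), rs = val_rules rs'.
Proof.
elim: rs => [|[l r] rs IH] /=; first by exists [::].
by move=> /andP[/andP[/word_over[l' ->] /word_over[r' ->]] /IH[rs' ->]]; exists ((l', r') :: rs').
Qed.

Lemma val_letters n (w : seq 'I_n) : all (fun k => k < n) (map val w).
Proof. by rewrite all_map; apply/allP => i _ /=. Qed.

Lemma val_below n : below n = map val (rev (enum 'I_n)).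
Proof. by rewrite belowE map_rev val_enum_ord. Qed.

Lemma parse_encode (S : lr_system) :
  parse_alph (encode S) = lr_alph S /\ parse_rules (encode S) = ([::], val_rules (lr_rules S)).
Proof. by rewrite /parse_alph /parse_rules /encode encode_unary blocksK /= wordsK pairsK. Qed.

Lemma val_FF_inj n : injective (fun lr : seq 'I_n * seq 'I_n => (map val lr.1, map val lr.2)).
Proof. by move=> [l r] [l' r'] [] /(inj_map val_inj) -> /(inj_map val_inj) ->. Qed.

Lemma invertiblebP n (rs : seq (seq 'I_n * seq 'I_n)) : all (fun lr => size lr.2 < size lr.1) rs ->
  confluent (fun l r => (l, r) \in rs) ->
  inverse_closed (fun l r => (l, r) \in rs) <-> invertibleb (val_rules rs) (below n).
Proof.
move=> red confl; rewrite val_below (map_invertibleb val_inj); split=> [h|/allP h a].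
  apply/allP => a _; have [b hb] := h a; apply/hasP; exists b; first by rewrite mem_rev mem_enum.
  apply/eqP; rewrite (norm_joinable red confl (rw_star_equiv hb)) norm_irreducible // => y s.
  by have := step_size (reducingT red) s.
have [|b _ /eqP e] := hasP (h a _); first by rewrite mem_rev mem_enum.
by exists b; rewrite -[X in rw_star _ _ X]e; have [] := normP red [:: a; b].
Qed.

Lemma val_reducing n (rs : seq (seq 'I_n * seq 'I_n)) :
  all (fun lr => size lr.2 < size lr.1) (val_rules rs) = all (fun lr => size lr.2 < size lr.1) rs.
Proof. by rewrite all_map; apply: eq_all => lr /=; rewrite !size_map. Qed.

(** The language concerns arbitrary strings, so the verifier has to recognize encodings exactly:
    decoding must lose nothing, and convergence and inverse-closedness must be decided. *)
Lemma well_formedP x : well_formed x <-> exists S : icl_system, x = encode S.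
Proof.
have head_rev (Y : Type) (d : Y) s : head d (rev s) = last d s.
  by case/lastP: s => // s y; rewrite rev_rcons last_rcons.
rewrite /well_formed !head_rev; split.
  move=> /and5P[/negbTE/blocksP[ex nx] /eqP/wordsP ens /eqP/pairsP ews n0].
  move=> /and5P[ln red uq cf iv]; rewrite uniqbE in uq.
  rewrite /parse_rules in ews; set n := parse_alph x in ln n0 iv.
  have [rs ers] := rules_over_val ln; rewrite /parse_rules in ers.
  move: red uq cf iv; rewrite /parse_rules ers val_reducing => red.
  rewrite map_inj_uniq; last exact: val_FF_inj.
  rewrite (map_confluentb val_inj) => uq /(confluentbP red) confl /(invertiblebP red confl) inv.
  pose S := LrSystem n0 uq red.
  have term : terminating (@lr_rule S) := reducing_terminating (reducingT red).
  exists (@IclSystem S inv (conj term confl)).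
  rewrite /encode encode_unary -/(val_rules _) /= -ers -ews -ens.
  by rewrite {1}ex /n /parse_alph; case: (blocks x) nx.
move=> [S ->]; have [eT eR] := parse_encode S; rewrite eT eR /=.
have [term confl] := icl_convergent S; have red := lr_reducing S.
rewrite lr_alph_gt0 val_reducing red uniqbE map_inj_uniq ?lr_rules_uniq; last exact: val_FF_inj.
rewrite (map_confluentb val_inj) (proj1 (confluentbP red) confl).
rewrite (proj1 (invertiblebP red confl) (icl_inverse_closed S)) /= !andbT.
apply/and3P; split.
- rewrite /encode encode_unary /=; move: (flatten (map flat_word _)) => ns.
  move: (lr_alph S) => m; elim: ns m => [|k ns IH] m.
    by rewrite cats0 /unary last_rcons.
  by rewrite last_cat /unary /= last_cat last_rcons; exact: (IH 0).
- rewrite /encode encode_unary blocksK [behead _]/=.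
  have last0 k ws : k = 0 -> last k (flatten (map flat_word ws)) = 0.
    by elim: ws k => //= w ws IH k _; rewrite last_cat; apply: IH; rewrite /flat_word last_rcons.
  by rewrite last0.
rewrite /rules_over all_map; apply/allP => lr _ /=; by rewrite !val_letters.
Qed.

Lemma lhs_le (S : icl_system) l r : lr_rule l r -> size (l : seq 'I_(lr_alph S)) <= size (encode S).
Proof.
move=> lr; apply: leq_trans (input_size_le_encode S); rewrite /input_size.
rewrite (big_rem _ lr) /= size_cat; lia.
Qed.

Definition cert A (a b c : seq A) (f : A -> nat) :=
  flatten (map unary (flatten (map flat_word [:: map f a; map f b; map f c]))).

Lemma size_cert_word n (w : seq 'I_n) L K : size w <= L -> n < K ->
  size (flatten (map unary (flat_word (map val w)))) <= L * K + 1.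
Proof.
move=> lw nK; apply: (@leq_trans (size w * K + 1)); last by rewrite leq_add2r leq_mul2r lw orbT.
elim: w {lw} => //= i w IH; rewrite size_cat /unary size_rcons size_nseq mulSn -addnA.
by rewrite -addSn; apply: leq_add; [have := ltn_ord i; lia|exact: IH].
Qed.

Lemma size_cert n (a b c : seq 'I_n) M : n <= M ->
  size a <= 598 * M + 200 -> size b <= 598 * M + 200 -> size c <= 598 * M + 200 ->
  size (cert a b c val) <= 2000 * M.+1 * M.+1.
Proof.
move=> nM la lb lc; rewrite /cert /= cats0 !map_cat !flatten_cat !size_cat.
have hL : 598 * M + 200 <= 600 * M.+1 by lia.
have := size_cert_word (leq_trans la hL) (nM : n < M.+1).
have := size_cert_word (leq_trans lb hL) (nM : n < M.+1).
have := size_cert_word (leq_trans lc hL) (nM : n < M.+1).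
have : 0 < M.+1 * M.+1 by [].
rewrite -!mulnA; move: (M.+1 * M.+1) => K; move: (size _) (size _) (size _) => x y z; lia.
Qed.

Theorem theoremC :
  in_NP (language (fun S : icl_system => encode S)
                  (fun S : icl_system => ~ plain (presented_group S))).
Proof.
apply: (NP_ptime (R := cert_bound) (V := verify) ptime_cert_bound ptime_verify) => x.
have wit (S : icl_system) := not_plain_witness (h := icl_inverse_closed S)
  (proj2 (icl_convergent S)) (lr_reducing S) (@lhs_le S).
split=> [[S -> /wit[a [b [c [la lb lc w]]]]]|[u _]].
  exists (cert a b c val).
    apply: size_cert => //; apply: leq_trans (input_size_le_encode S); exact: leq_addr.
  rewrite /verify; apply/andP; split; first by apply/well_formedP; exists S.
  have [eT eR] := parse_encode S; cbn [fst snd].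
  rewrite /cert blocksK wordsK eT eR /=.
  by rewrite !val_letters (map_witnessb val_inj).
rewrite /verify; cbn [fst snd]; move=> /andP[/well_formedP[S ->]].
have [eT eR] := parse_encode S; rewrite eT eR [(_, _).2]/=.
move=> /and4P[/word_over[a ea] /word_over[b eb] /word_over[c ec]].
rewrite ea eb ec (map_witnessb val_inj) => w; exists S; first by [].
exact: (witness_not_plain (h := icl_inverse_closed S) (proj2 (icl_convergent S)) (lr_reducing S) (@lhs_le S) w).
Qed.
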